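(* In the setting described in the context, on the subdomain $\Upsilon_i=(0,1)\times(0,1)$ let $\chi$ be the function equal to $a=u_1-u_2$ on $\Omega_{1i}$ and to $0$ on $\Omega_{2i}$. Then there are constants $D_1,D_2$, independent of $\varepsilon_2$ and $\varepsilon_3$, such that for any $\varepsilon_2>0$ and $\varepsilon_3>0$ there exists a continuous piecewise linear function $p_i$ on $\Upsilon_i$ with $$\left(\|\chi-p_i\|_{0,\Upsilon_i}^2+\|(\chi-p_i)_{\boldsymbol\beta}\|_{0,\Upsilon_i}^2\right)^{1/2}\le D_1\sqrt{\varepsilon_2}+D_2\sqrt{\varepsilon_3}.$$
   Context: Linear advection-reaction equation: $u_{\boldsymbol\beta}+\gamma u=f$ in a domain, with $u=g$ on its inflow boundary (the set of boundary points where $\boldsymbol\beta\cdot\boldsymbol n<0$, $\boldsymbol n$ the unit outward normal). Here $u_{\boldsymbol\beta}$ denotes the directional derivative of $u$ along $\boldsymbol\beta$ (that is, $\boldsymbol\beta\cdot\nabla u$, in the weak sense), $\boldsymbol\beta$ and $\gamma$ are continuous up to the boundary, $f\in L^2$, and $g$ is square-integrable on the inflow boundary. Solutions are taken in the space of $L^2$ functions $v$ with $v_{\boldsymbol\beta}\in L^2$. $\|\cdot\|_{0,\Upsilon_i}$ is the $L^2(\Upsilon_i)$ norm. Setting on the subdomain: $\Upsilon_i=(0,1)\times(0,1)\subset\mathbb R^2$; $\boldsymbol\beta(\mathbf x)=(0,v_2(\mathbf x))^T$ is vertical, the bottom edge $y=0$ being the inflow edge; $x_0\in(0,1)$ is fixed.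 The interface, which is the streamline emanating from $(x_0,0)$, is the vertical segment $I=\{(x_0,y):y\in(0,1)\}$, and it divides $\Upsilon_i$ into $$\Omega_{1i}=\{(x,y)\in\Upsilon_i: x<x_0\},\qquad \Omega_{2i}=\{(x,y)\in\Upsilon_i: x>x_0\}.$$ Let $\alpha_1,\alpha_2\in\mathbb R$ be the two one-sided values of the discontinuous inflow data at $(x_0,0)$. Let $u_1$ and $u_2$ be the solutions, on $\Omega_{1i}$ only, of $u_{\boldsymbol\beta}+\gamma u=f$ with the constant inflow boundary conditions $g=\alpha_1$ and $g=\alpha_2$, respectively, on $\{(x,0):x\in[0,x_0]\}$. Put $a=u_1-u_2$. *)

(* Defs.v *)
From HB Require Import structures.
From mathcomp Require Import all_boot all_order all_algebra.
From mathcomp Require Import all_classical all_reals all_analysis.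
Set Implicit Arguments.
Unset Strict Implicit.
Unset Printing Implicit Defensive.
Import Order.TTheory GRing.Theory Num.Theory.
Import numFieldNormedType.Exports.
Local Open Scope classical_set_scope.
Local Open Scope ring_scope.

Section Defs.
Context {R : realType}.
Implicit Types (A D : set (R * R)) (u v w g gam f phi p : R * R -> R).
Implicit Types (b : R * R -> R * R).

Definition leb2 := (@lebesgue_measure R \x @lebesgue_measure R)%E.

Definition L2 D u := (u \_ D : R * R -> R) \in Lfun leb2 2%:E.

(* Only meaningful when [L2 D u], since [fine +oo = 0]. *)
Definition L2norm D u : R := fine ('N[leb2]_2%:E[EFin \o (u \_ D)])%E.

Definition Upsilon : set (R * R) := `]0, 1[ `*` `]0, 1[.
Definition Omega1 (x0 : R) : set (R * R) := Upsilon `&` [set q | q.1 < x0].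
Definition Interface (x0 : R) : set (R * R) := [set q | q.1 = x0 /\ 0 < q.2 < 1].

Definition vertical v : R * R -> R * R := fun q => (0, v q).

(* [n] is the unit outward normal to [Upsilon] at [q]; none exists at the
   corners. *)
Definition outward_normal (q n : R * R) : Prop :=
  [\/ [/\ 0 < q.1 < 1, q.2 = 0 & n = (0, -1)],
      [/\ 0 < q.1 < 1, q.2 = 1 & n = (0, 1)],
      [/\ q.1 = 0, 0 < q.2 < 1 & n = (-1, 0)] |
      [/\ q.1 = 1, 0 < q.2 < 1 & n = (1, 0)]].

Definition inflow_boundary b : set (R * R) :=
  [set q | exists n, outward_normal q n /\ (b q).1 * n.1 + (b q).2 * n.2 < 0].

(* [A] is the trajectory of the field [b] starting from [q0] ([q0] excluded);
   the travel time [T] may be infinite.  As usual for streamlines, stagnation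
   points are not allowed on it. *)
Definition streamline b (q0 : R * R) A : Prop :=
  exists (c : R -> R * R) (T : \bar R),
    [/\ (0%:E < T)%E,
        c t @[t --> (0 : R)^'+] --> q0,
        forall t : R, 0 < t -> (t%:E < T)%E ->
          is_derive t (1 : R) c (b (c t)) /\ b (c t) != (0, 0) &
        c @` [set t | 0 < t /\ (t%:E < T)%E] = A].

(* The library's [locally_integrable] is restricted to functions on [R]. *)
Definition locally_integrable2 D u : Prop :=
  measurable_fun (D : set (measurableTypeR R * measurableTypeR R)) u /\
  forall K, K `<=` D -> compact K -> leb2.-integrable K (EFin \o u).

Definition C1 phi : Prop :=
  continuous phi /\
  forall e : R * R, e = (1, 0) \/ e = (0, 1) ->
    (forall q, derivable phi q e) /\ continuous ('D_e phi).

Definition C1c D phi : Prop :=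
  [/\ C1 phi, compact (closure [set q | phi q != 0]) &
      closure [set q | phi q != 0] `<=` D].

Definition weak_dy D u g : Prop :=
  [/\ locally_integrable2 D u, locally_integrable2 D g &
      forall phi, C1c D phi ->
        \int[leb2]_(q in D) (u q * 'D_((0, 1) : R * R) phi q) =
        - \int[leb2]_(q in D) (g q * phi q)].

(* [w] is the directional derivative of [u] on [D] along the field
   [vertical v]: the product beta . grad u is [v] times the weak partial
   derivative of [u] in the second variable, so that no derivative of [v],
   which is only continuous, is needed. *)
Definition weak_dbeta D v u w : Prop :=
  exists g, weak_dy D u g /\ {ae leb2, forall q, D q -> w q = v q * g q}.

(* [u] takes the constant value [al] on the bottom edge of [Omega1 x0], in the
   sense of Green's formula (outward normal (0, -1)); the test functions may
   be nonzero on the bottom edge but vanish near the rest of the boundary. *)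
Definition inflow_value (x0 al : R) u : Prop :=
  exists g, weak_dy (Omega1 x0) u g /\
    forall phi, C1c (`]0, x0[ `*` `]-oo, 1[) phi ->
      \int[leb2]_(q in Omega1 x0)
        (u q * 'D_((0, 1) : R * R) phi q + g q * phi q) =
      - \int[@lebesgue_measure R]_(x in `]0, x0[) (al * phi (x, 0)).

Definition solution (x0 : R) v gam f (al : R) u : Prop :=
  [/\ L2 (Omega1 x0) u,
      exists w, [/\ weak_dbeta (Omega1 x0) v u w, L2 (Omega1 x0) w &
        {ae leb2, forall q, Omega1 x0 q -> w q + gam q * u q = f q}] &
      inflow_value x0 al u].

(* A triple ((a1, a2), a3) encodes the half-plane a1 x + a2 y <= a3. *)
Definition polyhedron (h : seq (R * R * R)) : set (R * R) :=
  [set q | all (fun a => a.1.1 * q.1 + a.1.2 * q.2 <= a.2) h].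

Definition continuous_piecewise_linear D p : Prop :=
  {within D, continuous p} /\
  exists hs : seq (seq (R * R * R)),
    (forall q, D q -> exists2 h, h \in hs & polyhedron h q) /\
    (forall h, h \in hs -> exists a1 a2 a3 : R,
      forall q, D q -> polyhedron h q -> p q = a1 * q.1 + a2 * q.2 + a3).

End Defs.

(* Main.v *)
(** One approximates [chi] and its weak [y]-derivative [G] simultaneously,
    measuring the error on [G] with the bounded weight [v2].  Crossing the
    interface is harmless because [v2] does not vanish on it (it is a
    streamline): there [v2 G] in [L2] makes [G] integrable up to the interface.

    Along almost every vertical line, [chi] cut off near the bottom and the top
    is the primitive of its weak derivative.  Replace the part [dcutoff chi] of
    that derivative by a datum on the bottom edge, namely an average of [chi]
    over [d < y < 2 d].  The error lives on rows of height O(d) and, by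
    Cauchy-Schwarz on each line, its square is at most O(1 / d) times the energy
    outside an inner rectangle, so it vanishes with [d].  Truncation then
    reduces the problem to primitives of bounded functions.

    Bounded functions are limits of combinations of indicators of rectangles.
    If [m] is a trapezoid close to the indicator of ]a, b], the indicator of
    [c < y <= c + (d - c) m(x)] is close to that of ]a, b] x ]c, d] and is the
    weak derivative of [max (0, min (y - c, (d - c) m(x)))], a continuous
    piecewise linear function.  The squared error can be made at most [eps2],
    hence [D1 = D2 = 1]. *)

Require Import Defs.
From HB Require Import structures.
From mathcomp Require Import all_boot all_order all_algebra.
From mathcomp Require Import all_classical all_reals all_analysis.
From mathcomp Require Import measurable_realfun ring lra.
Set Implicit Arguments.
Unset Strict Implicit.
Unset Printing Implicit Defensive.
Import Order.TTheory GRing.Theory Num.Theory.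
Import numFieldNormedType.Exports.
Local Open Scope classical_set_scope.
Local Open Scope ring_scope.

(** The obstacle is the weight. Only [v2 * G] is known to be square-integrable: [v2] is merely
    continuous and may vanish inside the square, where [G] is only locally integrable. Averaging [G]
    over neighbouring points is then not controlled by [v2 * G], which excludes a plain
    mollification. Hence, inside the square, the first reductions act on [G] at each point by a
    factor between 0 and 1, which any weight tolerates. Once [G] is replaced by a bounded function,
    the bound on [|v2|] removes the weight, and unweighted approximation in L2 is enough. The datum
    on the bottom edge is encoded as a derivative living in a band of height 1 below the square. One
    operator, integration in y from minus infinity, then serves both for the datum and for the
    derivative, so only derivatives have to be approximated. *)

Local Notation plane R := (measurableTypeR R * measurableTypeR R)%type.

(** * Measurability and integrability on the plane *)

Lemma open_measurable2 (R : realType) (U : set (R * R)) :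
  open U -> measurable (U : set (measurableTypeR R * measurableTypeR R)).
Proof.
move=> oU.
pose B (i : (rat * rat) * (rat * rat)) : set (measurableTypeR R * measurableTypeR R) :=
  `]ratr i.1.1, ratr i.1.2[ `*` `]ratr i.2.1, ratr i.2.2[.
pose F i := if `[< B i `<=` U >] then B i else set0.
have -> : U = \bigcup_i F i.
  apply/seteqP; split => [q Uq|q [i _]]; last first.
    by rewrite /F; case: asboolP => // BU Bq; exact: BU.
  have /nbhs_ballP[e /= e0 eU] : nbhs q U by exact: open_nbhs_nbhs.
  have [a] := @rat_in_itvoo R (q.1 - e) q.1 ltac:(lra).
  have [b] := @rat_in_itvoo R q.1 (q.1 + e) ltac:(lra).
  have [c] := @rat_in_itvoo R (q.2 - e) q.2 ltac:(lra).
  have [d] := @rat_in_itvoo R q.2 (q.2 + e) ltac:(lra).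
  rewrite !in_itv/= => /andP[d1 d2] /andP[c1 c2] /andP[b1 b2] /andP[a1 a2].
  exists ((a, b), (c, d)) => //; rewrite /F ifT; last first.
    apply/asboolP => -[x y] [/=]; rewrite !in_itv/= => /andP[x1 x2] /andP[y1 y2].
    by apply: eU; split => /=; rewrite /ball/= ltr_distlC; apply/andP; split; lra.
  by split; rewrite /= in_itv/=; apply/andP; split.
apply: countable_bigcupT_measurable => // i; rewrite /F; case: ifP => // _.
by apply: measurableX; exact: measurable_itv.
Qed.

Lemma within_continuous_measurable2 (R : realType) (D : set (R * R)) (f : R * R -> R) :
  measurable (D : set (plane R)) -> {within D, continuous f} ->
  measurable_fun (D : set (plane R)) f.
Proof.
move=> mD /continuousP cf; apply: (measurability _ (RGenOpens.measurableE R)).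
move=> _ [_ [a [b ->] <-]].
have /open_subspaceP [V oV VD] : open (f @^-1` `]a, b[ : set (subspace D)).
  by apply: cf; exact: interval_open.
rewrite setIC -VD; apply: measurableI => //; exact: open_measurable2.
Qed.

Lemma continuous_measurable2 (R : realType) (f : R * R -> R) :
  continuous f -> measurable_fun (setT : set (plane R)) f.
Proof.
move=> cf; apply: within_continuous_measurable2 => //.
exact: continuous_subspaceT.
Qed.

Lemma compact_measurable2 (R : realType) (K : set (R * R)) :
  compact K -> measurable (K : set (plane R)).
Proof.
move=> cK; rewrite -(setCK K); apply: measurableC; apply: open_measurable2.
apply: closed_openC; apply: compact_closed => //; exact: norm_hausdorff.
Qed.

Section real_integrable.
Context d (T : measurableType d) (R : realType).
Variables (mu : {measure set T -> \bar R}) (D : set T).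
Hypothesis mD : measurable D.

Lemma integrableZ_real (k : R) (f : T -> R) :
  mu.-integrable D (EFin \o f) -> mu.-integrable D (EFin \o (fun x => k * f x)).
Proof. by move=> /(integrableZl mD k). Qed.

Lemma integrableD_real (f g : T -> R) :
  mu.-integrable D (EFin \o f) -> mu.-integrable D (EFin \o g) ->
  mu.-integrable D (EFin \o (fun x => f x + g x)).
Proof. by move=> /(integrableD mD) /[apply]. Qed.

Lemma integrableB_real (f g : T -> R) :
  mu.-integrable D (EFin \o f) -> mu.-integrable D (EFin \o g) ->
  mu.-integrable D (EFin \o (fun x => f x - g x)).
Proof. by move=> /(integrableB mD) /[apply]. Qed.

Lemma integrable_restrictT (f : T -> R) :
  mu.-integrable D (EFin \o f) <-> mu.-integrable setT (EFin \o (f \_ D)).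
Proof. by rewrite -restrict_EFin; exact: integrable_mkcond. Qed.

End real_integrable.

Lemma compact_continuous_bound (T : topologicalType) (R : realType) (K : set T) (f : T -> R) :
  compact K -> {within K, continuous f} ->
  exists2 M : R, 0 <= M & forall x, K x -> `|f x| <= M.
Proof.
move=> cK cf.
have /compact_bounded [M [_ HM]] := continuous_compact cf cK.
exists (Num.max (M + 1) 0); first by rewrite le_max lexx orbT.
move=> x Kx; apply: (HM (Num.max (M + 1) 0)); last by exists x.
by rewrite lt_max ltrDl ltr01.
Qed.

(** The factor is bounded on [K] and zero off it, so the product is dominated by a multiple of [u]
    restricted to [K], where local integrability applies. *)
Lemma locint_mul_integrable (R : realType) (D K : set (R * R)) (u psi : R * R -> R) :
  measurable (D : set (plane R)) -> locally_integrable2 D u ->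
  continuous psi -> compact K -> K `<=` D -> (forall q, ~ K q -> psi q = 0) ->
  leb2.-integrable (D : set (plane R)) (EFin \o (fun q => u q * psi q)).
Proof.
move=> mD [mu iu] cpsi cK KD psi0.
have mK := compact_measurable2 cK.
have mpsi := continuous_measurable2 cpsi.
have [M M0 HM] := compact_continuous_bound cK (continuous_subspaceT cpsi).
have iK : leb2.-integrable (K : set (plane R)) (EFin \o (fun q => M * u q)).
  by apply: integrableZ_real => //; exact: iu.
have iD : leb2.-integrable (D : set (plane R)) (EFin \o ((fun q => M * u q) \_ K)).
  apply: (@integrableS _ _ _ _ setT) => //.
  exact/(integrable_restrictT _ mK).
apply: (le_integrable mD _ _ iD).
  apply/measurable_EFinP; apply: measurable_funM => //.
  exact: measurable_funS mpsi.
move=> q Dq /=; rewrite patchE; case: ifPn => [/set_mem Kq|/negP nKq].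
  rewrite lee_fin !normrM mulrC ler_pM// [leRHS]ger0_norm//; exact: HM.
by rewrite psi0 ?mulr0// => Kq; apply: nKq; exact: mem_set.
Qed.

(** * Continuous piecewise linear functions *)

Section cpl.
Context {R : realType}.
Implicit Types (D : set (R * R)) (p : R * R -> R).

Lemma polyhedron_cat (h1 h2 : seq (R * R * R)) q :
  polyhedron (h1 ++ h2) q <-> polyhedron h1 q /\ polyhedron h2 q.
Proof. by rewrite /polyhedron/= all_cat; split => [/andP|[-> ->]]. Qed.

Lemma polyhedron_cons a (h : seq (R * R * R)) q :
  polyhedron (a :: h) q <-> a.1.1 * q.1 + a.1.2 * q.2 <= a.2 /\ polyhedron h q.
Proof. by rewrite /polyhedron/=; split => [/andP|[-> ->]]. Qed.

(** The affine coefficients are chosen as a function of the cell, so that those of two functions can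
    be combined cell by cell. *)
Lemma cpl_affine_pieces D p : continuous_piecewise_linear D p ->
  exists (hs : seq (seq (R * R * R))) (A : seq (R * R * R) -> R * R * R),
    (forall q, D q -> exists2 h, h \in hs & polyhedron h q) /\
    (forall h, h \in hs -> forall q, D q -> polyhedron h q ->
       p q = (A h).1.1 * q.1 + (A h).1.2 * q.2 + (A h).2).
Proof.
move=> [_ [hs [Dhs phs]]].
have /choice[A HA] : forall h, exists a : R * R * R, h \in hs -> forall q, D q ->
    polyhedron h q -> p q = a.1.1 * q.1 + a.1.2 * q.2 + a.2.
  move=> h; have [hhs|nhs] := boolP (h \in hs); last by exists (0, 0, 0).
  by have [a1 [a2 [a3 H]]] := phs _ hhs; exists (a1, a2, a3).
by exists hs, A.
Qed.

Lemma cpl_affine D a b c :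
  continuous_piecewise_linear D (fun q => a * q.1 + b * q.2 + c).
Proof.
split.
  apply: continuous_subspaceT => q.
  by apply: cvgD; [apply: cvgD; apply: cvgM|]; try exact: cvg_cst;
    [exact: cvg_fst|exact: cvg_snd].
exists [:: [::]]; split => [q Dq|h _]; first by exists [::].
by exists a, b, c.
Qed.

(** Concatenating lists of inequalities intersects cells and gives a common refinement. *)
Lemma cpl_lin D p1 p2 k1 k2 : continuous_piecewise_linear D p1 ->
  continuous_piecewise_linear D p2 ->
  continuous_piecewise_linear D (fun q => k1 * p1 q + k2 * p2 q).
Proof.
move=> /[dup] /cpl_affine_pieces [hs1 [A1 [D1 H1]]] [c1 _].
move=> /[dup] /cpl_affine_pieces [hs2 [A2 [D2 H2]]] [c2 _].
split.
  move=> q; apply: cvgD; apply: cvgM; try exact: cvg_cst; [exact: c1|exact: c2].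
exists [seq h1 ++ h2 | h1 <- hs1, h2 <- hs2]; split.
  move=> q Dq; have [h1 h1s ph1] := D1 q Dq; have [h2 h2s ph2] := D2 q Dq.
  by exists (h1 ++ h2); [exact: allpairs_f|exact/polyhedron_cat].
move=> h /allpairsP[[h1 h2] [/= h1s h2s ->]].
exists (k1 * (A1 h1).1.1 + k2 * (A2 h2).1.1), (k1 * (A1 h1).1.2 + k2 * (A2 h2).1.2),
  (k1 * (A1 h1).2 + k2 * (A2 h2).2).
move=> q Dq /polyhedron_cat[q1 q2].
by rewrite (H1 _ h1s)// (H2 _ h2s)//; ring.
Qed.

(** On a cell of the common refinement both functions are affine; the two half-planes in which one
    is below the other cut the cell into polyhedra on which the maximum is affine. *)
Lemma cpl_max D p1 p2 : continuous_piecewise_linear D p1 ->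
  continuous_piecewise_linear D p2 ->
  continuous_piecewise_linear D (fun q => Num.max (p1 q) (p2 q)).
Proof.
move=> /[dup] /cpl_affine_pieces [hs1 [A1 [D1 H1]]] [c1 _].
move=> /[dup] /cpl_affine_pieces [hs2 [A2 [D2 H2]]] [c2 _].
split; first by move=> q; apply: continuous_max; [exact: c1|exact: c2].
(* [cut a b] is the half-plane where the affine function with coefficients [a] is at most the one
   with coefficients [b]. *)
pose cut (a b : R * R * R) : R * R * R := (a.1.1 - b.1.1, a.1.2 - b.1.2, b.2 - a.2).
exists ([seq cut (A1 h1) (A2 h2) :: h1 ++ h2 | h1 <- hs1, h2 <- hs2] ++
        [seq cut (A2 h2) (A1 h1) :: h1 ++ h2 | h1 <- hs1, h2 <- hs2]); split.
  move=> q Dq; have [h1 h1s ph1] := D1 q Dq; have [h2 h2s ph2] := D2 q Dq.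
  have [p12|/ltW p21] := leP (p1 q) (p2 q).
    exists (cut (A1 h1) (A2 h2) :: h1 ++ h2).
      by rewrite mem_cat; apply/orP; left; apply/allpairsP; exists (h1, h2).
    apply/polyhedron_cons; split; last exact/polyhedron_cat.
    by move: p12; rewrite (H1 _ h1s)// (H2 _ h2s)//=; lra.
  exists (cut (A2 h2) (A1 h1) :: h1 ++ h2).
    by rewrite mem_cat; apply/orP; right; apply/allpairsP; exists (h1, h2).
  apply/polyhedron_cons; split; last exact/polyhedron_cat.
  by move: p21; rewrite (H1 _ h1s)// (H2 _ h2s)//=; lra.
move=> h; rewrite mem_cat => /orP[] /allpairsP[[h1 h2] [/= h1s h2s ->]].
  exists (A2 h2).1.1, (A2 h2).1.2, (A2 h2).2 => q Dq.
  move=> /polyhedron_cons[/= le12 /polyhedron_cat[q1 q2]].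
  by rewrite (H1 _ h1s)// (H2 _ h2s)//; apply: max_r; lra.
exists (A1 h1).1.1, (A1 h1).1.2, (A1 h1).2 => q Dq.
move=> /polyhedron_cons[/= le12 /polyhedron_cat[q1 q2]].
by rewrite (H1 _ h1s)// (H2 _ h2s)//; apply: max_l; lra.
Qed.

Lemma cpl_min D p1 p2 : continuous_piecewise_linear D p1 ->
  continuous_piecewise_linear D p2 ->
  continuous_piecewise_linear D (fun q => Num.min (p1 q) (p2 q)).
Proof.
move=> P1 P2.
have opp p : continuous_piecewise_linear D p -> continuous_piecewise_linear D (\- p).
  move=> Pp; have := cpl_lin (-1) 0 Pp Pp.
  by congr continuous_piecewise_linear; apply/funext => q /=; ring.
have := opp _ (cpl_max (opp _ P1) (opp _ P2)).
by congr continuous_piecewise_linear; apply/funext => q /=; rewrite oppr_max !opprK.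
Qed.

End cpl.

(** * Continuously differentiable functions on the line and the plane *)

Section bump.
Context {R : realType}.
Implicit Types t x : R.

Definition posp t := Num.max t 0.

Lemma posp_ge0 t : 0 <= posp t. Proof. by rewrite /posp le_max lexx orbT. Qed.

Lemma pospE t : 0 <= t -> posp t = t. Proof. by move=> t0; apply/max_l. Qed.

Lemma posp0 t : t <= 0 -> posp t = 0. Proof. by move=> t0; apply/max_r. Qed.

Lemma continuous_posp : continuous posp.
Proof. by move=> t; apply: continuous_max; [exact: cvg_id|exact: cvg_cst]. Qed.

Lemma is_derive_posp2 t : is_derive t (1 : R) (fun z => posp z ^+ 2) (2 * posp t).
Proof.
have [t0|t0|->] := ltgtP t 0.
- rewrite posp0 ?mulr0; last exact: ltW.
  have : is_derive t (1 : R) (cst 0 : R -> R) 0 by exact: is_derive_cst.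
  apply: near_eq_is_derive; near=> z; rewrite /= posp0 ?expr0n//; near: z.
  by apply: filterS (lt_nbhsl t0) => z /= /ltW.
- rewrite pospE; last exact: ltW.
  have : is_derive t (1 : R) (fun z : R => z ^+ 2) (2 * t).
    apply: is_derive_eq; rewrite /GRing.scale/= mulr1; ring.
  apply: near_eq_is_derive; near=> z; rewrite /= pospE//; near: z.
  by apply: filterS (lt_nbhsr t0) => z /= /ltW.
(* At the kink the slope function is [posp] itself, since [posp z ^+ 2 = posp z * z]. *)
apply/is_derive1_caratheodory; exists posp; split.
- move=> z; rewrite (posp0 (lexx 0)) expr0n subr0 subr0 /posp.
  by have [z0|z0] := leP z 0; rewrite ?expr0n ?mul0r.
- exact: continuous_posp.
- by rewrite posp0// mulr0.
Unshelve. all: by end_near. Qed.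

(** A C^1 switch from 0 on t <= 0 to 1 on t >= 1. Nesting the squared positive part twice requires
    no derivative other than that of [posp t ^+ 2]. *)
Definition kappa t := 1 - posp (1 - posp t ^+ 2) ^+ 2.
Definition dkappa t := 4 * posp t * posp (1 - posp t ^+ 2).

Lemma is_derive_kappa t : is_derive t (1 : R) kappa (dkappa t).
Proof.
have D1 := is_derive_posp2 t.
have D2 : is_derive t (1 : R) (fun z => 1 - posp z ^+ 2) (0 - 2 * posp t).
  by apply: is_deriveB.
have D3 := @is_derive1_comp _ (fun z => posp z ^+ 2) (fun z => 1 - posp z ^+ 2) t _ _
  (is_derive_posp2 (1 - posp t ^+ 2)) D2.
have : is_derive t (1 : R) kappa (0 - 2 * posp (1 - posp t ^+ 2) * (0 - 2 * posp t)).
  by apply: is_deriveB.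
by move/is_derive_eq; apply; rewrite /dkappa; ring.
Qed.

Lemma continuous_dkappa : continuous dkappa.
Proof.
move=> t; rewrite /dkappa.
apply: (@cvgM _ _ _ _ (fun t => 4 * posp t) (fun t => posp (1 - posp t ^+ 2))).
  by apply: cvgM; [exact: cvg_cst|exact: continuous_posp].
apply: (@continuous_comp _ _ _ (fun t => 1 - posp t ^+ 2) posp); last exact: continuous_posp.
apply: cvgB; first exact: cvg_cst.
rewrite (_ : (fun x => _) = (fun x => posp x * posp x)); last first.
  by apply/funext => z; rewrite expr2.
by rewrite expr2; apply: cvgM; exact: continuous_posp.
Qed.

Lemma kappa0 t : t <= 0 -> kappa t = 0.
Proof. by move=> t0; rewrite /kappa (posp0 t0) expr0n subr0 pospE// expr1n subrr. Qed.

Lemma kappa1 t : 1 <= t -> kappa t = 1.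
Proof.
move=> t1; rewrite /kappa (@pospE t); last lra.
by rewrite posp0 ?expr0n ?subr0//; nra.
Qed.

Lemma kappa_bounds t : 0 <= kappa t <= 1.
Proof.
have p1 : 0 <= posp (1 - posp t ^+ 2) <= 1.
  rewrite posp_ge0/= /posp ge_max ler01 andbT.
  by have := sqr_ge0 (Num.max t 0); lra.
by rewrite /kappa; move: p1; nra.
Qed.

Lemma dkappa0 t : t <= 0 -> dkappa t = 0.
Proof. by move=> t0; rewrite /dkappa posp0// mulr0 mul0r. Qed.

Lemma dkappa1 t : 1 <= t -> dkappa t = 0.
Proof.
move=> t1; rewrite /dkappa (@pospE t); last lra.
by rewrite (@posp0 (1 - _)) ?mulr0//; nra.
Qed.

Lemma dkappa_bounds t : 0 <= dkappa t <= 4.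
Proof.
have [t0|t0] := leP t 0; first by rewrite dkappa0//; lra.
have [t1|t1] := leP 1 t; first by rewrite dkappa1//; lra.
rewrite /dkappa (@pospE t); last exact: ltW.
rewrite pospE; last by nra.
by apply/andP; split; nra.
Qed.

Definition C1_with (X X' : R -> R) :=
  (forall t, is_derive t (1 : R) X (X' t)) /\ continuous X'.

Lemma C1_with_continuous X X' : C1_with X X' -> continuous X.
Proof.
move=> [dX _] t.
by apply/differentiable_continuous/derivable1_diffP; exact: ex_derive.
Qed.

Lemma C1_with_mul X X' Y Y' : C1_with X X' -> C1_with Y Y' ->
  C1_with (fun t => X t * Y t) (fun t => X' t * Y t + X t * Y' t).
Proof.
move=> CX CY; have cX := C1_with_continuous CX; have cY := C1_with_continuous CY.
move: CX CY => [dX cX'] [dY cY']; split=> [t|t].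
  have := is_deriveM (dX t) (dY t).
  by move/is_derive_eq; apply; rewrite /GRing.scale/=; ring.
by apply: cvgD; apply: cvgM; (exact: cX || exact: cX' || exact: cY || exact: cY').
Qed.

Lemma C1_with_lin X X' Y Y' k l : C1_with X X' -> C1_with Y Y' ->
  C1_with (fun t => k * X t + l * Y t) (fun t => k * X' t + l * Y' t).
Proof.
move=> [dX cX'] [dY cY']; split=> [t|t].
  exact: (is_deriveD (is_deriveZ k (dX t)) (is_deriveZ l (dY t))).
by apply: cvgD; apply: cvgM; (exact: cX' || exact: cY' || exact: cvg_cst).
Qed.

Lemma C1_with_comp_affine X X' k l : C1_with X X' ->
  C1_with (fun t => X (k * t + l)) (fun t => X' (k * t + l) * k).
Proof.
move=> [dX cX']; split=> [t|t].
  have D : is_derive t (1 : R) (fun t => k * t + l) k.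
    have : is_derive t (1 : R) (fun t => k * t + l) (k *: 1 + 0) by apply: is_deriveD.
    by move/is_derive_eq; apply; rewrite addr0 /GRing.scale/= mulr1.
  exact: (@is_derive1_comp _ X (fun t => k * t + l) t _ _ (dX _) D).
apply: cvgM; last exact: cvg_cst.
apply: (@continuous_comp _ _ _ (fun t => k * t + l) X'); last exact: cX'.
by apply: cvgD; [apply: cvgM; [exact: cvg_cst|exact: cvg_id]|exact: cvg_cst].
Qed.

Lemma C1_with_kappa k l : C1_with (fun t => kappa (k * t + l)) (fun t => dkappa (k * t + l) * k).
Proof.
by apply: C1_with_comp_affine; split; [exact: is_derive_kappa|exact: continuous_dkappa].
Qed.

End bump.

Section C1_plane.
Context {R : realType}.
Implicit Types (q e : R * R) (phi : R * R -> R).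

(** A directional derivative sees only the restriction to the line through the point, so derivatives
    of plane functions along the axes and derivatives on the real line can be exchanged. *)
Lemma is_derive_transfer (V W : normedModType R) (f : V -> R) (g : W -> R)
    (a v : V) (b w : W) (d : R) :
  (forall h : R, f (h *: v + a) = g (h *: w + b)) ->
  is_derive a v f d -> is_derive b w g d.
Proof.
move=> fg [d1 d2].
have fgab : f a = g b by have := fg 0; rewrite !scale0r !add0r.
have E : (fun h => h^-1 *: ((f \o shift a) (h *: v) - f a)) =
         (fun h => h^-1 *: ((g \o shift b) (h *: w) - g b)).
  by apply/funext => h /=; rewrite fg fgab.
by apply: DeriveDef; [rewrite /derivable -E|rewrite /derive -E].
Qed.

Lemma is_derive_slice phi q v : is_derive q ((0, 1) : R * R) phi v ->
  is_derive q.2 (1 : R) (fun t => phi (q.1, t)) v.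
Proof.
apply: is_derive_transfer => h; congr phi; case: q => a b.
by rewrite -[LHS]/(h *: 0 + a, h *: 1 + b) scaler0 add0r.
Qed.

Lemma is_derive_fst (X X' : R -> R) q (k : R * R) :
  (forall t, is_derive t (1 : R) X (X' t)) ->
  k = (1, 0) \/ k = (0, 1) -> is_derive q k (fun q => X q.1) (k.1 * X' q.1).
Proof.
move=> dX [->|->]; rewrite /= ?mul1r ?mul0r.
  by apply: is_derive_transfer (dX q.1) => h; case: q.
apply: is_derive_transfer (is_derive_cst (X q.1) (0 : R) (1 : R)) => h.
by case: q => a b; congr X; rewrite -[RHS]/(h *: (0 : R) + a) scaler0 add0r.
Qed.

Lemma is_derive_snd (X X' : R -> R) q (k : R * R) :
  (forall t, is_derive t (1 : R) X (X' t)) ->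
  k = (1, 0) \/ k = (0, 1) -> is_derive q k (fun q => X q.2) (k.2 * X' q.2).
Proof.
move=> dX [->|->]; rewrite /= ?mul1r ?mul0r; last first.
  by apply: is_derive_transfer (dX q.2) => h; case: q.
apply: is_derive_transfer (is_derive_cst (X q.2) (0 : R) (1 : R)) => h.
by case: q => a b; congr X; rewrite -[RHS]/(h *: (0 : R) + b) scaler0 add0r.
Qed.

Lemma continuous_comp_fst (X : R -> R) : continuous X -> continuous (fun q : R * R => X q.1).
Proof. by move=> cX q; apply: (@continuous_comp _ _ _ fst X); [exact: cvg_fst|exact: cX]. Qed.

Lemma continuous_comp_snd (X : R -> R) : continuous X -> continuous (fun q : R * R => X q.2).
Proof. by move=> cX q; apply: (@continuous_comp _ _ _ snd X); [exact: cvg_snd|exact: cX]. Qed.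

Lemma C1_fst (X X' : R -> R) : C1_with X X' -> C1 (fun q : R * R => X q.1).
Proof.
move=> CX; split; first exact/continuous_comp_fst/(C1_with_continuous CX).
move=> e he; have D q := is_derive_fst q CX.1 he; split=> [q|]; first exact: ex_derive.
rewrite (_ : 'D_e _ = (fun q => e.1 * X' q.1)); last by apply/funext => q; exact: derive_val.
by move=> q; apply: cvgM; [exact: cvg_cst|exact: (continuous_comp_fst CX.2)].
Qed.

Lemma C1_snd (X X' : R -> R) : C1_with X X' -> C1 (fun q : R * R => X q.2).
Proof.
move=> CX; split; first exact/continuous_comp_snd/(C1_with_continuous CX).
move=> e he; have D q := is_derive_snd q CX.1 he; split=> [q|]; first exact: ex_derive.
rewrite (_ : 'D_e _ = (fun q => e.2 * X' q.2)); last by apply/funext => q; exact: derive_val.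
by move=> q; apply: cvgM; [exact: cvg_cst|exact: (continuous_comp_snd CX.2)].
Qed.

Lemma C1_mul phi psi : C1 phi -> C1 psi -> C1 (fun q => phi q * psi q).
Proof.
move=> [c1 d1] [c2 d2]; split; first by move=> q; apply: cvgM; [exact: c1|exact: c2].
move=> e he; have [e1 ce1] := d1 e he; have [e2 ce2] := d2 e he.
split=> [q|]; first exact: derivableM.
rewrite (_ : 'D_e _ = (fun q => phi q * 'D_e psi q + psi q * 'D_e phi q)).
  by move=> q; apply: cvgD;
    [apply: cvgM; [exact: c1|exact: ce2]|apply: cvgM; [exact: c2|exact: ce1]].
by apply/funext => q; rewrite deriveM.
Qed.

Lemma derive_y_mul_fst phi (X X' : R -> R) q : C1 phi -> C1_with X X' ->
  'D_((0, 1) : R * R) (fun q => phi q * X q.1) q = 'D_((0, 1) : R * R) phi q * X q.1.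
Proof.
move=> [_ /(_ (0, 1) (or_intror erefl))[d1 _]] [dX _].
have dq := is_derive_fst q dX (or_intror erefl).
have dXq : derivable (fun q : R * R => X q.1) q ((0, 1) : R * R) by case: dq.
rewrite (deriveM (d1 q) dXq); case: dq => _ ->.
by rewrite /GRing.scale/= mul0r mulr0 add0r mulrC.
Qed.

Lemma derive_y_snd (Y Y' : R -> R) q : C1_with Y Y' ->
  'D_((0, 1) : R * R) (fun q => Y q.2) q = Y' q.2.
Proof.
by move=> [dY _]; case: (is_derive_snd q dY (or_intror erefl)) => _ ->; rewrite /= mul1r.
Qed.

Lemma derive_y_tensor (X X' Y Y' : R -> R) q : C1_with X X' -> C1_with Y Y' ->
  'D_((0, 1) : R * R) (fun q => Y q.2 * X q.1) q = Y' q.2 * X q.1.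
Proof.
move=> CX CY; rewrite (derive_y_mul_fst _ (C1_snd CY) CX).
by rewrite (derive_y_snd _ CY).
Qed.

Lemma C1_continuous_dy phi : C1 phi -> continuous ('D_((0, 1) : R * R) phi).
Proof. by move=> [_ /(_ (0, 1) (or_intror erefl))[]]. Qed.

Lemma derive_y_eq0 phi q : ~ closure [set q | phi q != 0] q ->
  'D_((0, 1) : R * R) phi q = 0.
Proof.
move=> nq; have : \forall z \near q, phi z = cst 0 z.
  have : nbhs q (~` closure [set q | phi q != 0]).
    by apply: open_nbhs_nbhs; split => //; apply: closed_openC; exact: closed_closure.
  apply: filterS => z nz; apply/eqP; apply/negPn/negP => pz; apply: nz.
  exact: subset_closure.
by move=> /(near_eq_derive ((0, 1) : R * R)) ->; rewrite derive_cst.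
Qed.

Lemma C1c_integrable (D : set (R * R)) (u phi : R * R -> R) :
  measurable (D : set (plane R)) -> locally_integrable2 D u -> C1c D phi ->
  leb2.-integrable (D : set (plane R)) (EFin \o (fun q => u q * phi q)).
Proof.
move=> mD lu [[cphi _] cK KD]; apply: (locint_mul_integrable mD lu cphi cK KD).
move=> q nq; apply/eqP/negPn/negP => pq; apply: nq; exact: subset_closure.
Qed.

Lemma C1c_integrable_dy (D : set (R * R)) (u phi : R * R -> R) :
  measurable (D : set (plane R)) -> locally_integrable2 D u -> C1c D phi ->
  leb2.-integrable (D : set (plane R))
    (EFin \o (fun q => u q * 'D_((0, 1) : R * R) phi q)).
Proof.
move=> mD lu [C1phi cK KD].
apply: (locint_mul_integrable mD lu (C1_continuous_dy C1phi) cK KD).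
by move=> q nq; exact: derive_y_eq0.
Qed.

End C1_plane.

(** * Primitives along vertical lines *)

Section param_integral.
Context d1 d2 (T1 : measurableType d1) (T2 : measurableType d2) (R : realType).
Variable m2 : {sigma_finite_measure set T2 -> \bar R}.

(** Splitting into positive and negative parts reduces a signed integrand to Tonelli. *)
Lemma measurable_param_integral (f : T1 * T2 -> \bar R) :
  measurable_fun setT f -> measurable_fun setT (fun x => (\int[m2]_y f (x, y))%E).
Proof.
move=> mf.
rewrite (_ : (fun _ => _) = ((fun x => (\int[m2]_y f^\+ (x, y))%E) \-
   (fun x => (\int[m2]_y f^\- (x, y))%E))%E); last first.
  apply/funext => x /=; rewrite integralE; congr (_ - _)%E;
    by apply: eq_integral => y _; rewrite ?funeposE ?funenegE.
apply: emeasurable_funB.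
- by apply: (measurable_fun_fubini_tonelli_F f^\+%E) => //; exact: measurable_funepos.
- by apply: (measurable_fun_fubini_tonelli_F f^\-%E) => //; exact: measurable_funeneg.
Qed.

Lemma measurable_param_Rintegral (f : T1 * T2 -> R) :
  measurable_fun setT f -> measurable_fun setT (fun x => \int[m2]_y f (x, y)).
Proof.
move=> mf; apply: (measurableT_comp (fine_measurable measurableT)).
apply: (@measurable_param_integral (EFin \o f)).
exact/measurable_EFinP.
Qed.

End param_integral.

Section vint.
Context {R : realType}.
Local Notation leb := (@lebesgue_measure R).
Implicit Types (g phi : R * R -> R).

Definition step (t y : R) : R := (t < y)%R%:R.

Lemma measurable_step : measurable_fun setT (fun q : plane R => step q.1 q.2).
Proof.
rewrite (_ : (fun _ => _) = \1_[set q : plane R | q.1 < q.2]); last first.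
  by apply/funext => q; rewrite indicE /step mem_setE.
apply: measurable_indic; apply: open_measurable2.
rewrite (_ : mkset _ = (fun q : R * R => q.2 - q.1) @^-1` [set x | 0 < x]).
  apply: open_comp; last exact: open_gt.
  by move=> q _; apply: cvgB; [exact: cvg_snd|exact: cvg_fst].
by apply/seteqP; split => q /=; rewrite subr_gt0.
Qed.

Lemma measurable_step_comp d (T : measurableType d) (a b : T -> R) :
  measurable_fun setT a -> measurable_fun setT b ->
  measurable_fun setT (fun z => step (a z) (b z)).
Proof.
by move=> ma mb; have := measurableT_comp measurable_step (measurable_fun_pair ma mb).
Qed.

(** Primitive in y from minus infinity. With the kernel [step] it is a parametric integral over the
    whole line, so joint measurability and Fubini apply directly. An infinite slice integral is sent
    to 0 by [fine]. *)
Definition vint g (q : R * R) : R := \int[leb]_t (g (q.1, t) * step t q.2).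

Lemma measurable_vint g : measurable_fun (setT : set (plane R)) g ->
  measurable_fun (setT : set (plane R)) (vint g).
Proof.
move=> mg.
apply: (@measurable_param_Rintegral _ _ (plane R) (measurableTypeR R) R leb
  (fun z => g (z.1.1, z.2) * step z.2 z.1.2)).
apply: measurable_funM.
  apply: (measurableT_comp mg); apply: measurable_fun_pair => //.
  exact: measurableT_comp.
by apply: measurable_step_comp => //; exact: measurableT_comp.
Qed.

Lemma step_bounds t y : 0 <= step t y <= 1.
Proof. by rewrite /step; case: (t < y); rewrite ?lexx ?ler01. Qed.

Lemma measurable_slice g x : measurable_fun (setT : set (plane R)) g ->
  measurable_fun setT (fun t => g (x, t)).
Proof. by move=> mg; exact: measurableT_comp. Qed.

Lemma measurable_stepl y : measurable_fun setT (fun t => step t y).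
Proof. exact: measurable_step_comp. Qed.

Lemma measurable_slice_step g x y : measurable_fun (setT : set (plane R)) g ->
  measurable_fun setT (fun t => g (x, t) * step t y).
Proof. 
by move=> mg; apply: measurable_funM; [exact: measurable_slice|exact: measurable_stepl].
Qed.

(** Holds for every [x]: on a slice that is not integrable the right-hand side is infinite. *)
Lemma vint_le g x y : measurable_fun (setT : set (plane R)) g ->
  (`|vint g (x, y)|%:E <= \int[leb]_t `|g (x, t)|%:E)%E.
Proof.
move=> mg; rewrite /vint/= /Rintegral.
have mgs := measurable_slice_step x y mg.
apply: (@le_trans _ _ (`|\int[leb]_t (g (x, t) * step t y)%:E|)%E).
  by case: (integral _ _ _) => [r| |]//=; rewrite normr0 leey.
apply: le_trans (le_abse_integral _ _ _) _ => //.
  exact/measurable_EFinP.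
apply: ge0_le_integral => //.
- by apply/measurable_EFinP/measurableT_comp.
- by apply/measurable_EFinP/measurableT_comp => //; exact: measurable_slice.
- move=> t _; rewrite lee_fin normrM ler_piMr//.
  by have /andP[s0 s1] := step_bounds t y; rewrite ger0_norm.
Qed.

End vint.

Section by_parts.
Context {R : realType}.
Local Notation leb := (@lebesgue_measure R).
Implicit Types (g phi : R * R -> R).

Lemma integral_step_derive (F f : R -> R) (M t : R) :
  C1_with F f -> (forall y, M <= y -> F y = 0) -> (forall y, M <= y -> f y = 0) ->
  (\int[leb]_y (step t y * f y)%:E)%E = (- F t)%:E.
Proof.
move=> CF F0 f0; have [dF cf] := CF; have cF := C1_with_continuous CF.
(* Beyond both [t] and [M]: the interval []t, N]] is nonempty, [F N = 0], and [f] vanishes to its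
   right. *)
pose N := Num.max t M + 1.
have tN : t < N by rewrite /N ltr_pwDr// le_max lexx.
have MN : M <= N by rewrite /N -[leLHS]addr0 lerD// le_max lexx orbT.
have mf : measurable_fun setT f by exact: continuous_measurable_fun.
transitivity (\int[leb]_(y in `]t, N]) (f y)%:E)%E.
  rewrite [RHS]integral_mkcond; apply: eq_integral => y _.
  rewrite patchE; case: ifPn => [|/negP yn].
    by rewrite inE/= in_itv/= => /andP[ty _]; rewrite /step ty mul1r.
  have [ty|] := ltP t y; last by rewrite /step leNgt => /negbTE ->; rewrite mul0r.
  rewrite f0 ?mulr0// leNgt; apply/negP => yM; apply: yn.
  by rewrite inE/= in_itv/= ty/= ltW// (lt_le_trans yM).
rewrite integral_itv_obnd_cbnd; last first.
  by apply/measurable_EFinP; exact: measurable_funS mf.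
rewrite (@continuous_FTC2 _ f F)//.
- by rewrite (F0 N)// sub0e EFinN.
- exact: continuous_subspaceT.
- split => [x _|//|]; first exact: ex_derive.
  + by apply: cvg_at_right_filter; exact: cF.
  + by apply: cvg_at_left_filter; exact: cF.
- by move=> x _; rewrite derive1E derive_val.
Qed.

Lemma integrable_mul_bounded d (T : measurableType d) (mu : {measure set T -> \bar R})
    (D : set T) (f b : T -> R) (C : R) : measurable D ->
  mu.-integrable D (EFin \o f) -> measurable_fun D b -> (forall x, D x -> `|b x| <= C) ->
  mu.-integrable D (EFin \o (fun x => f x * b x)).
Proof.
move=> mD fi mb bC.
have mf : measurable_fun D f by apply/measurable_EFinP; exact: measurable_int fi.
apply: (le_integrable mD _ _ (integrableZ_real mD C fi)).
  by apply/measurable_EFinP; exact: measurable_funM.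
move=> x Dx /=; rewrite lee_fin !normrM mulrC ler_wpM2r//.
by rewrite (le_trans (bC x Dx))// ler_norm.
Qed.

(** Fubini on the half-plane t < y: for fixed [t] the integral of [f] over y > t is [- F t]. *)
Lemma slice_by_parts (h F f : R -> R) (M : R) :
  leb.-integrable setT (EFin \o h) -> leb.-integrable setT (EFin \o f) ->
  C1_with F f -> (forall y, M <= y -> F y = 0) -> (forall y, M <= y -> f y = 0) ->
  (\int[leb]_y ((\int[leb]_t (h t * step t y)) * f y)%:E =
   \int[leb]_t (- (h t * F t))%:E)%E.
Proof.
move=> ih jf CF F0 f0; have [dF cf] := CF.
have mh : measurable_fun setT h by apply/measurable_EFinP; exact: measurable_int ih.
have mf : measurable_fun setT f by exact: continuous_measurable_fun.
have isf t : leb.-integrable setT (EFin \o (fun y => f y * step t y)).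
  apply: (integrable_mul_bounded (C := 1) _ jf) => //.
    exact: measurable_step_comp.
  by move=> y _; have /andP[s0 s1] := step_bounds t y; rewrite ger0_norm.
have ish y : leb.-integrable setT (EFin \o (fun t => h t * step t y)).
  apply: (integrable_mul_bounded (C := 1) _ ih) => //.
    exact: measurable_stepl.
  by move=> t _; have /andP[s0 s1] := step_bounds t y; rewrite ger0_norm.
pose k (q : plane R) : R := h q.1 * step q.1 q.2 * f q.2.
have mk : measurable_fun setT k.
  apply: measurable_funM; last exact: measurableT_comp.
  by apply: measurable_funM; [exact: measurableT_comp|exact: measurable_step].
have ik : (leb \x leb)%E.-integrable setT (EFin \o k).
  apply/integrable12ltyP; first exact/measurable_EFinP.
  apply: (@le_lt_trans _ _ (\int[leb]_t (`|h t|%:E * \int[leb]_y `|f y|%:E))%E).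
    apply: ge0_le_integral => //.
    - by move=> t _; exact: integral_ge0.
    - have mak : measurable_fun setT (fun q : plane R => `|(k q)%:E|%E).
        by apply: measurableT_comp => //; exact/measurable_EFinP.
      exact: (measurable_param_integral leb mak).
    - by apply: emeasurable_funM => //; apply/measurable_EFinP; exact: measurableT_comp.
    move=> t _; rewrite -ge0_integralZl//; last first.
      by apply/measurable_EFinP; exact: measurableT_comp.
    apply: ge0_le_integral => //.
    - apply/measurable_EFinP; apply: measurableT_comp => //.
      by apply: (measurable_slice t mk).
    - by apply: emeasurable_funM => //; apply/measurable_EFinP; exact: measurableT_comp.
    move=> y _; rewrite /k/= lee_fin !normrM -mulrA ler_wpM2l// ler_piMl//.
    by have /andP[s0 s1] := step_bounds t y; rewrite ger0_norm.
  have /integrableP[_ hlt] := ih; have /integrableP[_ flt] := jf.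
  have fE : (\int[leb]_y `|f y|%:E)%E \is a fin_num.
    by rewrite ge0_fin_numE// integral_ge0.
  rewrite -(fineK fE) ge0_integralZr//.
  - have hE : (\int[leb]_y `|h y|%:E)%E \is a fin_num.
      by rewrite ge0_fin_numE// integral_ge0.
    by rewrite -(fineK hE) -EFinM ltry.
  - by apply/measurable_EFinP; exact: measurableT_comp.
  - by rewrite lee_fin fine_ge0// integral_ge0.
have -> : (\int[leb]_y ((\int[leb]_t (h t * step t y)) * f y)%:E =
           \int[leb]_y \int[leb]_t (k (t, y))%:E)%E.
  apply: eq_integral => y _; rewrite /k/=.
  under [in RHS]eq_integral do rewrite EFinM.
  rewrite integralZr//; last exact: ish.
  rewrite EFinM; congr (_ * _)%E; rewrite /Rintegral fineK//.
  exact: integrable_fin_num (ish y).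
rewrite -(Fubini ik); apply: eq_integral => t _; rewrite /k/=.
under eq_integral do rewrite -mulrA EFinM.
rewrite integralZl//; last first.
  by under eq_fun do rewrite mulrC; exact: isf.
by rewrite (integral_step_derive t CF F0 f0) -EFinM mulrN.
Qed.

Lemma integrable_bounded_itv (f : R -> R) (C a b : R) :
  measurable_fun setT f -> (forall y, `|f y| <= C * \1_`[a, b] y) ->
  leb.-integrable setT (EFin \o f).
Proof.
move=> mf fC.
have ic : leb.-integrable setT (EFin \o (fun y => C * \1_`[a, b] y)).
  by apply: integrableZ_real => //; exact: integrable_indic_itv.
apply: (le_integrable _ _ _ ic) => //; first exact/measurable_EFinP.
by move=> y _; rewrite /= lee_fin (le_trans (fC y))// ler_norm.
Qed.

(* [vint g] is only bounded by the slice integrals of [|g|], so the cutoff in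
   [y] has to come from [dphi]. *)
Lemma integrable_vint_mul g (b : R * R -> R) (M C : R) :
  leb2.-integrable (setT : set (plane R)) (EFin \o g) ->
  measurable_fun (setT : set (plane R)) b ->
  (forall x y, `|b (x, y)| <= C * \1_`[-M, M] y) ->
  leb2.-integrable (setT : set (plane R)) (EFin \o (fun q => vint g q * b q)).
Proof.
move=> ig mb bC.
have mg : measurable_fun (setT : set (plane R)) g.
  by apply/measurable_EFinP; exact: measurable_int ig.
have C0 y : 0 <= C * \1_`[-M, M] y by apply: le_trans (bC 0 y).
have mv := measurable_vint mg.
have ic : leb.-integrable setT (EFin \o (fun y => C * \1_`[-M, M] y)).
  by apply: integrableZ_real => //; exact: integrable_indic_itv.
have cE : (\int[leb]_y (C * \1_`[-M, M] y)%:E)%E \is a fin_num.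
  exact: integrable_fin_num ic.
have mc : measurable_fun setT (fun y : R => (C * \1_`[-M, M] y)%:E).
  exact: measurable_int ic.
have mN : measurable_fun setT (fun x => \int[leb]_t `|g (x, t)|%:E)%E.
  have mag : measurable_fun setT (fun q : plane R => `|(g q)%:E|%E).
    by apply: measurableT_comp => //; exact/measurable_EFinP.
  exact: (measurable_param_integral leb mag).
have mvb : measurable_fun (setT : set (plane R)) (fun q => vint g q * b q).
  exact: measurable_funM.
apply/(@integrable12ltyP _ _ _ _ _ leb leb); first exact/measurable_EFinP.
apply: (@le_lt_trans _ _ (\int[leb]_x ((\int[leb]_t `|g (x, t)|%:E) *
  \int[leb]_y (C * \1_`[-M, M] y)%:E))%E).
  apply: ge0_le_integral => //.
  - by move=> x _; exact: integral_ge0.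
  - have mavb : measurable_fun setT (fun q : plane R => `|(vint g q * b q)%:E|%E).
      by apply: measurableT_comp => //; exact/measurable_EFinP.
    exact: (measurable_param_integral leb mavb).
  - exact: emeasurable_funM.
  move=> x _; rewrite -ge0_integralZl//; last 2 first.
  - by move=> y _; rewrite lee_fin.
  - exact: integral_ge0.
  apply: ge0_le_integral => //.
  - by apply/measurable_EFinP; apply: measurableT_comp => //; exact: (measurable_slice x mvb).
  - exact: emeasurable_funM.
  move=> y _; rewrite /= normrM EFinM; apply: lee_pmul => //.
    exact: vint_le.
  by rewrite lee_fin.
have c0 : (0 <= \int[leb]_y (C * \1_`[-M, M] y)%:E)%E.
  by apply: integral_ge0 => y _; rewrite lee_fin.
rewrite -(fineK cE) ge0_integralZr ?fineK//; last by move=> x _; exact: integral_ge0.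
move/(@integrable12ltyP _ _ _ _ _ leb leb _ (measurable_int _ ig)) : ig => igl.
have gE : (\int[leb]_x \int[leb]_t `|g (x, t)|%:E)%E \is a fin_num.
  by rewrite ge0_fin_numE//; apply: integral_ge0 => x _; exact: integral_ge0.
by rewrite -(fineK gE) -(fineK cE) -EFinM ltry.
Qed.

(** Integrates [slice_by_parts] over almost every vertical line. The test function has to vanish
    only for large y: the primitive starts from 0 at minus infinity, so no boundary term arises
    there. [bridge] relies on this. *)
Lemma vint_by_parts g phi dphi (M C : R) :
  leb2.-integrable (setT : set (plane R)) (EFin \o g) ->
  (forall x, C1_with (fun y => phi (x, y)) (fun y => dphi (x, y))) ->
  measurable_fun (setT : set (plane R)) phi ->
  measurable_fun (setT : set (plane R)) dphi ->
  (forall q, `|phi q| <= C) ->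
  (forall x y, `|dphi (x, y)| <= C * \1_`[-M, M] y) ->
  (forall x y, M < y -> phi (x, y) = 0) ->
  \int[leb2]_q (vint g q * dphi q) = - \int[leb2]_q (g q * phi q).
Proof.
move=> ig Cphi mphi mdphi phiC dphiC phi0.
have iv := integrable_vint_mul ig mdphi dphiC.
have igp : leb2.-integrable (setT : set (plane R)) (EFin \o (fun q => - (g q * phi q))).
  rewrite (_ : _ \o _ = (\- (EFin \o (fun q => (g q * phi q)%R)))%E)//.
  by apply: integrableN => //; exact: (integrable_mul_bounded (C := C)).
have -> : - (\int[leb2]_q (g q * phi q)) = \int[leb2]_q (- (g q * phi q)).
  rewrite -mulN1r -RintegralZl//; last exact: (integrable_mul_bounded (C := C)).
  by apply: eq_Rintegral => q _; rewrite mulN1r.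
rewrite /Rintegral /leb2; congr fine.
rewrite -(integral12_prod_meas1 iv) -(integral12_prod_meas1 igp).
apply: ae_eq_integral => //.
- exact: measurable_fubini_F iv.
- exact: measurable_fubini_F igp.
apply: filterS (ae_integrable1 ig) => x igx _; rewrite /fubini_F/=.
apply: (@slice_by_parts (fun t => g (x, t)) (fun y => phi (x, y)) (fun y => dphi (x, y)) (M + 1)) => //.
- by apply: (integrable_bounded_itv (measurable_slice x mdphi)) => y; exact: dphiC.
- by move=> y My; apply: phi0; apply: lt_le_trans My; rewrite ltrDl.
move=> y My; apply/eqP; rewrite -normr_le0 (le_trans (dphiC x y))// indicE memNset ?mulr0//=.
by rewrite in_itv/= => /andP[_ yM]; lra.
Qed.

End by_parts.

(** * Sets generated by rectangles *)

Section plane_generators.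
Context {R : realType}.

(** Half-open rectangles are stable under intersection and generate the product Borel sets, the two
    properties that Dynkin's theorem asks for. *)
Definition oc_rectangles : set (set (plane R)) :=
  [set A | exists a b c d : R, A = `]a, b] `*` `]c, d]].

Lemma oc_rectangles_setI : setI_closed oc_rectangles.
Proof.
move=> _ _ [a [b [c [d ->]]]] [a' [b' [c' [d' ->]]]].
exists (Num.max a a'), (Num.min b b'), (Num.max c c'), (Num.min d d').
apply/seteqP; split => -[x y] /=; rewrite !in_itv/= !gt_max !le_min.
  by move=> [[/andP[-> ->] /andP[-> ->]] [/andP[-> ->] /andP[-> ->]]].
by move=> [/andP[/andP[-> ->] /andP[-> ->]] /andP[/andP[-> ->] /andP[-> ->]]].
Qed.

Lemma measurable_oc_rectangles :
  (measurable : set (set (plane R))) = <<s oc_rectangles >>.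
Proof.
have bigN (x : R) : exists n : nat, - n%:R < x /\ x <= n%:R.
  have [n xn] : exists n : nat, `|x| < n%:R.
    by exists (Num.bound `|x|); exact: archi_boundP.
  by exists n; move: xn; rewrite ltr_norml => /andP[? /ltW].
rewrite measurable_prod_measurableType; apply/seteqP; split; last first.
  apply: smallest_sub; first exact: smallest_sigma_algebra.
  move=> _ [a [b [c [d ->]]]]; apply: sub_sigma_algebra.
  by exists `]a, b]%classic => //; exists `]c, d]%classic.
have sC A : <<s oc_rectangles >> A -> <<s oc_rectangles >> (~` A).
  by move=> /sigma_algebraCD; rewrite setTD.
have sU (F : (set (plane R))^nat) : (forall n, <<s oc_rectangles >> (F n)) ->
  <<s oc_rectangles >> (\bigcup_n F n) by exact: sigma_algebra_bigcup.
have s0 : <<s oc_rectangles >> set0 by exact: sigma_algebra0.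
have H1 (A : set (measurableTypeR R)) : measurable A -> <<s oc_rectangles >> (A `*` setT).
  pose H := [set A : set R | <<s oc_rectangles >> (A `*` setT)].
  suff : measurable A -> H A by [].
  apply: smallest_sub; last first.
    move=> _ [[a b] _ <-]; rewrite /H/=.
    rewrite (_ : _ `*` _ = \bigcup_n (`]a, b] `*` `](- n%:R : R), n%:R])).
      by apply: sU => n; apply: sub_sigma_algebra; exists a, b, (- n%:R), n%:R.
    apply/seteqP; split => [[x y] [/= xab _]|[x y] [n _ [/= xab _]]]; last by split.
    by have [n [yn1 yn2]] := bigN y; exists n => //; split; rewrite //= in_itv/= yn1 yn2.
  split.
  - by rewrite /H/= set0X.
  - move=> B; rewrite /H/= setTD => /sC; congr (<<s _ >> _).
    by apply/seteqP; split => -[x y] /=; [move=> nB; split => // Bx; apply: nB|move=> [nB _] []].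
  - move=> F HF; rewrite /H/= (_ : _ `*` _ = \bigcup_n (F n `*` setT)); first exact: sU.
    by apply/seteqP; split => [[x y] [[n _ Fx] _]|[x y] [n _ [Fx _]]];
      [exists n|split => //; exists n].
have H2 (A : set (measurableTypeR R)) : measurable A -> <<s oc_rectangles >> (setT `*` A).
  pose H := [set A : set R | <<s oc_rectangles >> (setT `*` A)].
  suff : measurable A -> H A by [].
  apply: smallest_sub; last first.
    move=> _ [[a b] _ <-]; rewrite /H/=.
    rewrite (_ : _ `*` _ = \bigcup_n (`](- n%:R : R), n%:R] `*` `]a, b])).
      by apply: sU => n; apply: sub_sigma_algebra; exists (- n%:R), n%:R, a, b.
    apply/seteqP; split => [[x y] [_ /= yab]|[x y] [n _ [_ /= yab]]]; last by split.
    by have [n [yn1 yn2]] := bigN x; exists n => //; split; rewrite //= in_itv/= yn1 yn2.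
  split.
  - by rewrite /H/= setX0.
  - move=> B; rewrite /H/= setTD => /sC; congr (<<s _ >> _).
    by apply/seteqP; split => -[x y] /=; [move=> nB; split => // Bx; apply: nB|move=> [_ nB] []].
  - move=> F HF; rewrite /H/= (_ : _ `*` _ = \bigcup_n (setT `*` F n)); first exact: sU.
    by apply/seteqP; split => [[x y] [_ [n _ Fx]]|[x y] [n _ [_ Fx]]];
      [exists n|split => //; exists n].
apply: smallest_sub => //.
move=> _ [A mA [B mB <-]].
rewrite (_ : A `*` B = ~` (~` (A `*` setT) `|` ~` (setT `*` B))).
  rewrite -bigcup2E; apply: (sC); apply: sU => -[|[|n]] //=; apply: sC; [exact: H1|exact: H2].
by rewrite setCU !setCK; apply/seteqP; split => -[x y] /=; tauto.
Qed.

(** Dynkin's pi-lambda theorem, with the half-open rectangles as pi-system. *)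
Lemma plane_induction (P : set (plane R) -> Prop) :
  P setT -> (forall a b c d : R, P (`]a, b] `*` `]c, d])) ->
  (forall S, measurable S -> P S -> P (~` S)) ->
  (forall F : (set (plane R))^nat, (forall n, measurable (F n)) ->
     trivIset setT F -> (forall n, P (F n)) -> P (\bigcup_k F k)) ->
  forall S, measurable S -> P S.
Proof.
move=> PT Pr PC PU S; rewrite measurable_oc_rectangles.
apply: dynkin_induction => //.
- exact: measurable_oc_rectangles.
- exact: oc_rectangles_setI.
- by move=> _ [a [b [c [d ->]]]]; exact: Pr.
Qed.

End plane_generators.

(** The sets over which [F] has integral 0 form a Dynkin class, where the integral over the plane
    handles complements; an integrable function whose integral over every measurable set is 0
    vanishes almost everywhere. *)
Lemma ae_eq0_rectangles (R : realType) (F : R * R -> R) :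
  leb2.-integrable (setT : set (plane R)) (EFin \o F) ->
  (\int[leb2]_(q in (setT : set (plane R))) (F q)%:E = 0)%E ->
  (forall a b c d : R,
    (\int[leb2]_(q in (`]a, b] `*` `]c, d] : set (plane R))) (F q)%:E = 0)%E) ->
  {ae leb2, forall q : plane R, F q = 0}.
Proof.
move=> iF FT Fr.
have iFS (S : set (plane R)) : measurable S -> leb2.-integrable S (EFin \o F).
  by move=> mS; apply: integrableS iF.
have FS (S : set (plane R)) : measurable S -> (\int[leb2]_(q in S) (F q)%:E = 0)%E.
  apply: (plane_induction (P := fun S => (\int[leb2]_(q in S) (F q)%:E = 0)%E)) => //.
  - move=> {}S mS S0; move: FT; rewrite -(setUv S) integral_setU//=.
    + by rewrite S0 add0e.
    + exact: measurableC.
    + by rewrite setUv; exact: measurable_int iF.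
    + by apply/disj_setPS; rewrite setICr.
  - move=> G mG tG G0; rewrite integral_bigcup//.
      by rewrite eseries0// => k _ _; exact: G0.
    by apply: iFS; exact: bigcup_measurable.
have := @integral_ae_eq _ _ _ leb2 setT measurableT (cst 0%E) _ iF (measurable_cst _).
move=> H; have {}H := H (fun E _ mE => etrans (FS E mE) (esym (integral0 _ _))).
by apply: filterS H => q /(_ I) /= [].
Qed.

(** * Approximation of primitives of bounded functions *)

Section pl_pair.
Context {R : realType}.
Local Notation leb := (@lebesgue_measure R).
Implicit Types (p q g u phi : R * R -> R) (D : set (R * R)).

Lemma measurable_Upsilon : measurable (Upsilon : set (plane R)).
Proof. by apply: measurableX; exact: measurable_itv. Qed.

Lemma leb2_rect_lty (a b c d : R) (b1 b2 b3 b4 : bool) :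
  (leb2 ([set` Interval (BSide b1 a) (BSide b2 b)] `*`
         [set` Interval (BSide b3 c) (BSide b4 d)]) < +oo)%E.
Proof.
rewrite /leb2 product_measure1E; [|exact: measurable_itv|exact: measurable_itv].
rewrite [X in (X * _)%E]lebesgue_measure_itv [X in (_ * X)%E]lebesgue_measure_itv/=.
by case: ifP => _; case: ifP => _; rewrite ?mule0 ?mul0e ?ltry// -!EFinD -EFinM ltry.
Qed.

Lemma integrable_bounded (S : set (plane R)) g (C : R) :
  measurable S -> (leb2 S < +oo)%E -> measurable_fun S g ->
  (forall z, S z -> `|g z| <= C) -> leb2.-integrable S (EFin \o g).
Proof.
move=> mS Slt mg gC; apply: measurable_bounded_integrable => //.
exists C; split; first exact: num_real.
by move=> M CM z /gC /le_trans; apply; exact: ltW.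
Qed.

Lemma weak_dy_lin D u1 u2 g1 g2 (k l : R) : measurable (D : set (plane R)) ->
  weak_dy D u1 g1 -> weak_dy D u2 g2 ->
  weak_dy D (fun z => k * u1 z + l * u2 z) (fun z => k * g1 z + l * g2 z).
Proof.
move=> mD [lu1 lg1 w1] [lu2 lg2 w2].
have loc v1 v2 : locally_integrable2 D v1 -> locally_integrable2 D v2 ->
    locally_integrable2 D (fun z => k * v1 z + l * v2 z).
  move=> [m1 i1] [m2 i2]; split.
    by apply: measurable_funD; apply: measurable_funM => //.
  move=> K KD cK; have mK := compact_measurable2 cK.
  by apply: integrableD_real => //; apply: integrableZ_real => //; [exact: i1|exact: i2].
split; [exact: loc|exact: loc|].
have lin v1 v2 b : leb2.-integrable (D : set (plane R)) (EFin \o (fun z => v1 z * b z)) ->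
    leb2.-integrable (D : set (plane R)) (EFin \o (fun z => v2 z * b z)) ->
    \int[leb2]_(z in D) ((k * v1 z + l * v2 z) * b z) =
    k * (\int[leb2]_(z in D) (v1 z * b z)) + l * (\int[leb2]_(z in D) (v2 z * b z)).
  move=> i1 i2; rewrite -!RintegralZl// -RintegralD//.
  - by apply: eq_Rintegral => z _; ring.
  - exact: integrableZ_real.
  - exact: integrableZ_real.
move=> phi cphi; rewrite !lin; first by rewrite w1// w2//; ring.
- exact: C1c_integrable.
- exact: C1c_integrable.
- exact: C1c_integrable_dy.
- exact: C1c_integrable_dy.
Qed.

Lemma locint_bounded g (C : R) : measurable_fun (Upsilon : set (plane R)) g ->
  (forall z, Upsilon z -> `|g z| <= C) -> locally_integrable2 Upsilon g.
Proof.
move=> mg gC; split => // K KU cK.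
apply: (@integrableS _ _ _ _ (Upsilon : set (plane R))) => //.
- exact: measurable_Upsilon.
- exact: compact_measurable2.
apply: (integrable_bounded (C := C)) => //; first exact: measurable_Upsilon.
exact: leb2_rect_lty.
Qed.

Lemma C1c_bounds D phi : C1c D phi ->
  exists2 C : R, 0 <= C & forall z, `|phi z| <= C /\ `|'D_((0, 1) : R * R) phi z| <= C.
Proof.
move=> [C1phi cK KD].
have [A A0 HA] := compact_continuous_bound cK (continuous_subspaceT C1phi.1).
have [B B0 HB] := compact_continuous_bound cK (continuous_subspaceT (C1_continuous_dy C1phi)).
exists (A + B) => [|z]; first exact: addr_ge0.
have [Kz|nKz] := pselect (closure [set q | phi q != 0] z).
  by split; [rewrite (le_trans (HA _ Kz))// lerDl|rewrite (le_trans (HB _ Kz))// lerDr].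
rewrite derive_y_eq0// (_ : phi z = 0) ?normr0 ?addr_ge0//.
by apply/eqP/negPn/negP => pz; apply: nKz; exact: subset_closure.
Qed.

Lemma C1c_supp D phi z : C1c D phi -> ~ D z ->
  phi z = 0 /\ 'D_((0, 1) : R * R) phi z = 0.
Proof.
move=> [C1phi cK KD] nDz; have nKz : ~ closure [set q | phi q != 0] z by move=> /KD.
split; last exact: derive_y_eq0.
by apply/eqP/negPn/negP => pz; apply: nKz; exact: subset_closure.
Qed.

Lemma C1_slice phi x : C1 phi ->
  C1_with (fun y => phi (x, y)) (fun y => 'D_((0, 1) : R * R) phi (x, y)).
Proof.
move=> C1phi; split=> [y|y].
  have [_ /(_ _ (or_intror erefl))[dphi _]] := C1phi.
  have H : is_derive ((x, y) : R * R) ((0, 1) : R * R) phi ('D_((0, 1) : R * R) phi (x, y)).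
    exact: derivableP.
  exact: (is_derive_slice H).
apply: (@continuous_comp _ _ _ (fun y => (x, y)) ('D_((0, 1) : R * R) phi)).
  move=> A [[B1 B2] [/= n1 n2] sub]; apply: filterS n2 => z B2z; apply: sub.
  by split => //=; exact: nbhs_singleton n1.
exact: C1_continuous_dy.
Qed.

Lemma Rintegral_supp D (f : R * R -> R) : (forall z, ~ D z -> f z = 0) ->
  \int[leb2]_(z in D) f z = \int[leb2]_z f z.
Proof.
move=> f0; rewrite Rintegral_mkcond; apply: eq_Rintegral => z _; rewrite patchE.
by case: ifPn => // /negP nz; rewrite f0// => Dz; apply: nz; exact: mem_set.
Qed.

(** Integration by parts against a test function, with [M = 1] because its support lies in 0 < y <
    1. The two bounds yield local integrability. *)
Lemma weak_dy_vint g (C : R) : leb2.-integrable (setT : set (plane R)) (EFin \o g) ->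
  (forall z, `|g z| <= C) -> (forall z, `|vint g z| <= C) -> weak_dy Upsilon (vint g) g.
Proof.
move=> ig gC vC.
have mg : measurable_fun (setT : set (plane R)) g.
  by apply/measurable_EFinP; exact: measurable_int ig.
split.
- apply: (locint_bounded (C := C)) => //.
  by apply: measurable_funS (measurable_vint mg).
- by apply: (locint_bounded (C := C)) => //; exact: measurable_funS mg.
move=> phi cphi; have [B B0 HB] := C1c_bounds cphi; have [C1phi _ _] := cphi.
have cdphi := C1_continuous_dy C1phi.
rewrite [LHS]Rintegral_supp; last by move=> z /(C1c_supp cphi)[_ ->]; rewrite mulr0.
rewrite [X in - X]Rintegral_supp; last by move=> z /(C1c_supp cphi)[-> _]; rewrite mulr0.
apply: (vint_by_parts (M := 1) (C := B)) => //.
- by move=> x; exact: C1_slice.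
- exact: continuous_measurable2 C1phi.1.
- exact: continuous_measurable2.
- by move=> q; case: (HB q).
- move=> x y; have [y1|ny1] := pselect (`[-1, 1]%classic y).
    by rewrite indicE mem_set// mulr1; case: (HB (x, y)).
  rewrite indicE memNset// mulr0 (C1c_supp cphi _).2 ?normr0// => -[_ /=].
  by rewrite in_itv/= => /andP[y0 y1]; apply: ny1; rewrite /= in_itv/=; lra.
move=> x y y1; apply: (C1c_supp cphi _).1 => -[_ /=].
by rewrite in_itv/= => /andP[_]; lra.
Qed.

(** An approximant together with its weak derivative. Measurability and the bound are global because
    errors are later integrated over a strip larger than [Upsilon]. *)
Definition pl_pair p q := [/\ continuous_piecewise_linear Upsilon p, weak_dy Upsilon p q,
  measurable_fun (setT : set (plane R)) p, measurable_fun (setT : set (plane R)) q &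
  exists C : R, forall z, `|p z| <= C /\ `|q z| <= C].

Lemma pl_pair_lin p1 q1 p2 q2 (k l : R) : pl_pair p1 q1 -> pl_pair p2 q2 ->
  pl_pair (fun z => k * p1 z + l * p2 z) (fun z => k * q1 z + l * q2 z).
Proof.
move=> [c1 w1 mp1 mq1 [C1 H1]] [c2 w2 mp2 mq2 [C2 H2]]; split.
- exact: cpl_lin.
- by apply: weak_dy_lin => //; exact: measurable_Upsilon.
- by apply: measurable_funD; exact: measurable_funM.
- by apply: measurable_funD; exact: measurable_funM.
exists (`|k| * C1 + `|l| * C2) => z; have [? ?] := H1 z; have [? ?] := H2 z.
by split; apply: le_trans (ler_normD _ _) _; rewrite !normrM lerD// ler_wpM2l.
Qed.

End pl_pair.

Section appr.
Context {R : realType}.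
Local Notation leb := (@lebesgue_measure R).
Implicit Types (p q g u phi G H : R * R -> R) (D : set (R * R)).

(** The unit square with a band of height 1 below it. A derivative living in the band prescribes the
    value of the primitive on the bottom edge. *)
Definition strip : set (plane R) := `]0, 1[ `*` `]-1, 1].

Lemma measurable_strip : measurable strip.
Proof. by apply: measurableX; exact: measurable_itv. Qed.

Lemma Upsilon_strip : Upsilon `<=` strip.
Proof.
by move=> [x y] [/= xI]; rewrite in_itv/= => yI; split => //=; rewrite in_itv/=; lra.
Qed.

Definition bounded_on_strip (C : R) G := measurable_fun (setT : set (plane R)) G /\
  forall z, strip z -> `|G z| <= C.

Lemma measurable_restrict_strip G : measurable_fun (setT : set (plane R)) G ->
  measurable_fun (setT : set (plane R)) (G \_ strip).
Proof.
move=> mG; apply/(measurable_restrictT _ measurable_strip).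
exact: measurable_funS mG.
Qed.

Lemma restrict_strip_le C G x t : bounded_on_strip C G ->
  `|(G \_ strip) (x, t)| <= C * \1_`[-1, 1] t.
Proof.
move=> [mG GC].
have C0 : 0 <= C.
  apply: le_trans (GC (2^-1, 0) _) => //; split => /=; rewrite in_itv/=; first lra.
  by rewrite ler01 andbT ltrN10.
rewrite patchE; case: ifPn => [/set_mem st|_]; last first.
  by rewrite normr0 mulr_ge0// indicE.
rewrite indicE mem_set ?mulr1; first exact: GC.
by case: st => _ /=; rewrite !in_itv/= => /andP[/ltW -> ->].
Qed.

Lemma slice_strip_integrable C G x : bounded_on_strip C G ->
  leb.-integrable setT (EFin \o (fun t => (G \_ strip) (x, t))).
Proof.
move=> bG; apply: (integrable_bounded_itv (C := C) (a := -1) (b := 1)).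
  exact: (measurable_slice x (measurable_restrict_strip bG.1)).
by move=> t; exact: restrict_strip_le.
Qed.

Lemma slice_strip_step_integrable C G x y : bounded_on_strip C G ->
  leb.-integrable setT (EFin \o (fun t => (G \_ strip) (x, t) * step t y)).
Proof.
move=> bG; apply: (integrable_mul_bounded (C := 1) _ (slice_strip_integrable x bG)) => //.
  exact: measurable_stepl.
by move=> t _; have /andP[s0 s1] := step_bounds t y; rewrite ger0_norm.
Qed.

Lemma vint_strip_bounded C G z : bounded_on_strip C G -> `|vint (G \_ strip) z| <= 2 * C.
Proof.
move=> bG; case: z => x y; rewrite -lee_fin.
apply: le_trans (vint_le _ _ (measurable_restrict_strip bG.1)) _.
apply: (@le_trans _ _ (\int[leb]_t (C * \1_`[-1, 1] t)%:E)%E).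
  apply: ge0_le_integral => //.
  - apply/measurable_EFinP/measurableT_comp => //.
    exact: (measurable_slice x (measurable_restrict_strip bG.1)).
  - have : leb.-integrable setT (EFin \o (fun t => C * \1_`[-1, 1] t)).
      by apply: integrableZ_real => //; exact: integrable_indic_itv.
    exact: measurable_int.
  - by move=> t _; rewrite lee_fin; exact: restrict_strip_le.
under eq_integral do rewrite EFinM.
rewrite integralZl//; last exact: integrable_indic_itv.
rewrite integral_indic ?setIT//.
rewrite [X in (_ * X)%E]lebesgue_measure_itv/= lte_fin ifT ?ltrN10; last lra.
by rewrite -EFinD -EFinM lee_fin; lra.
Qed.

Lemma vint_strip_lin C1 C2 G H (k l : R) z : bounded_on_strip C1 G -> bounded_on_strip C2 H ->
  vint ((fun z => k * G z + l * H z) \_ strip) z =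
  k * vint (G \_ strip) z + l * vint (H \_ strip) z.
Proof.
move=> bG bH; case: z => x y; rewrite /vint/=.
have iG := slice_strip_step_integrable x y bG; have iH := slice_strip_step_integrable x y bH.
rewrite -RintegralZl// -RintegralZl// -RintegralD//; last 2 first.
- exact: integrableZ_real.
- exact: integrableZ_real.
apply: eq_Rintegral => t _; rewrite !patchE; case: ifP => _ /=; first ring.
by rewrite -[point]/(0 : R); ring.
Qed.

Lemma bounded_on_strip_lin C1 C2 G H (k l : R) :
  bounded_on_strip C1 G -> bounded_on_strip C2 H ->
  bounded_on_strip (`|k| * C1 + `|l| * C2) (fun z => k * G z + l * H z).
Proof.
move=> [mG GC] [mH HC]; split.
  by apply: measurable_funD; exact: measurable_funM.
move=> z sz; apply: le_trans (ler_normD _ _) _.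
by rewrite !normrM lerD// ler_wpM2l//; [exact: GC|exact: HC].
Qed.

Lemma vint_strip_cvg C (G_ : (R * R -> R)^nat) G z :
  (forall n, bounded_on_strip C (G_ n)) -> measurable_fun (setT : set (plane R)) G ->
  (forall z, strip z -> G_ n z @[n --> \oo] --> G z) ->
  vint (G_ n \_ strip) z @[n --> \oo] --> vint (G \_ strip) z.
Proof.
move=> bG mG GG; case: z => x y.
have pcv t : (G_ n \_ strip) (x, t) * step t y @[n --> \oo] --> (G \_ strip) (x, t) * step t y.
  apply: cvgM; last exact: cvg_cst.
  have [st|nst] := pselect (strip (x, t)).
    rewrite patchE mem_set//; under eq_fun do rewrite patchE mem_set//.
    exact: GG.
  rewrite patchE memNset//; under eq_fun do rewrite patchE memNset//.
  exact: cvg_cst.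
have ic : leb.-integrable setT (EFin \o (fun t => C * \1_`[-1, 1] t)).
  by apply: integrableZ_real => //; exact: integrable_indic_itv.
have mGs := measurable_restrict_strip mG.
have [] := @dominated_convergence _ _ _ leb setT measurableT
  (fun n t => ((G_ n \_ strip) (x, t) * step t y)%:E)
  (fun t => ((G \_ strip) (x, t) * step t y)%:E) (EFin \o (fun t => C * \1_`[-1, 1] t)) _ _ _ ic.
- move=> n; apply/measurable_EFinP.
  exact: (measurable_slice_step x y (measurable_restrict_strip (bG n).1)).
- by apply/measurable_EFinP; exact: (measurable_slice_step x y mGs).
- by apply: aeW => t _; apply: cvg_EFin; [exact: nearW|exact: pcv].
- apply: aeW => t n _; rewrite /= lee_fin normrM.
  apply: le_trans (restrict_strip_le x t (bG n)).
  by rewrite ler_piMr//; have /andP[s0 s1] := step_bounds t y; rewrite ger0_norm.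
move=> iG _ cv; rewrite /vint /Rintegral/=.
by apply: fine_cvg; rewrite fineK//; exact: integrable_fin_num iG.
Qed.

End appr.

Lemma integral_le_lin d (T : measurableType d) (R : realType)
    (mu : {measure set T -> \bar R}) (S : set T) (f g h : T -> R) (k l a b : R) :
  measurable S -> measurable_fun S f -> measurable_fun S g -> measurable_fun S h ->
  (forall x, S x -> 0 <= f x) -> (forall x, S x -> 0 <= g x) ->
  (forall x, S x -> 0 <= h x <= k * f x + l * g x) -> 0 <= k -> 0 <= l ->
  (\int[mu]_(x in S) (f x)%:E <= a%:E)%E -> (\int[mu]_(x in S) (g x)%:E <= b%:E)%E ->
  (\int[mu]_(x in S) (h x)%:E <= (k * a + l * b)%:E)%E.
Proof.
move=> mS mf mg mh f0 g0 h0 k0 l0 fa gb.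
have emf : measurable_fun S (EFin \o f) by exact/measurable_EFinP.
have emg : measurable_fun S (EFin \o g) by exact/measurable_EFinP.
have mkf : measurable_fun S (fun x => k%:E * (f x)%:E)%E by exact: emeasurable_funM.
have mlg : measurable_fun S (fun x => l%:E * (g x)%:E)%E by exact: emeasurable_funM.
have f0e x : S x -> (0 <= (f x)%:E)%E by move=> /f0; rewrite lee_fin.
have g0e x : S x -> (0 <= (g x)%:E)%E by move=> /g0; rewrite lee_fin.
have kf0 x : S x -> (0 <= k%:E * (f x)%:E)%E by move=> /f0e; exact: mule_ge0.
have lg0 x : S x -> (0 <= l%:E * (g x)%:E)%E by move=> /g0e; exact: mule_ge0.
apply: (@le_trans _ _ (\int[mu]_(x in S) (k%:E * (f x)%:E + l%:E * (g x)%:E))%E).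
  apply: ge0_le_integral => //.
  - by move=> x /h0 /andP[? _]; rewrite lee_fin.
  - exact/measurable_EFinP.
  - exact: emeasurable_funD.
  - by move=> x /h0 /andP[_ ?]; rewrite -!EFinM -EFinD lee_fin.
rewrite ge0_integralD// !ge0_integralZl//.
by rewrite EFinD !EFinM; apply: leeD; apply: lee_wpmul2l.
Qed.

Section appr.
Context {R : realType}.
Implicit Types (p q g u phi G H : R * R -> R) (D : set (R * R)).

Lemma measurable_sqdist (S : set (plane R)) u g p q : measurable_fun S u -> measurable_fun S g ->
  measurable_fun S p -> measurable_fun S q ->
  measurable_fun S (fun z => (u z - p z) ^+ 2 + (g z - q z) ^+ 2).
Proof.
move=> mu mg mp mq.
by apply: measurable_funD; apply: measurable_funX; apply: measurable_funB.
Qed.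

(** One pair has to approximate the primitive and its derivative at the same time; the weight does
    not enter yet. *)
Definition appr G := forall eps : R, 0 < eps -> exists p q, pl_pair p q /\
  (\int[leb2]_(z in strip) ((vint (G \_ strip) z - p z) ^+ 2 + (G z - q z) ^+ 2)%:E <= eps%:E)%E.

Lemma measurable_vint_strip C G (S : set (plane R)) : bounded_on_strip C G ->
  measurable_fun S (vint (G \_ strip)).
Proof.
move=> [mG _]; have := measurable_vint (measurable_restrict_strip mG).
exact: measurable_funS.
Qed.

Lemma sqdist_ge0 (a b : R) : 0 <= a ^+ 2 + b ^+ 2.
Proof. by rewrite addr_ge0// sqr_ge0. Qed.

Lemma appr_lin C1 C2 G H (k l : R) : bounded_on_strip C1 G -> bounded_on_strip C2 H ->
  appr G -> appr H -> appr (fun z => k * G z + l * H z).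
Proof.
move=> bG bH aG aH eps eps0; have bGH := bounded_on_strip_lin k l bG bH.
(* From [(k a + l b)^2 <= 2 k^2 a^2 + 2 l^2 b^2]; the summand 1 keeps both constants positive, as
   divisors, even for [k = 0] or [l = 0]. *)
pose K := 2 * k ^+ 2 + 1; pose L := 2 * l ^+ 2 + 1.
have K0 : 0 < K by rewrite ltr_wpDl// mulr_ge0// sqr_ge0.
have L0 : 0 < L by rewrite ltr_wpDl// mulr_ge0// sqr_ge0.
have [|p1 [q1 [P1 E1]]] := aG (eps / 2 / K); first by rewrite divr_gt0// divr_gt0.
have [|p2 [q2 [P2 E2]]] := aH (eps / 2 / L); first by rewrite divr_gt0// divr_gt0.
have P12 := pl_pair_lin k l P1 P2.
exists (fun z => k * p1 z + l * p2 z), (fun z => k * q1 z + l * q2 z); split => //.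
have -> : eps = K * (eps / 2 / K) + L * (eps / 2 / L).
  by field; rewrite !gt_eqF.
have [_ _ mp1 mq1 _] := P1; have [_ _ mp2 mq2 _] := P2; have [_ _ mp mq _] := P12.
have mT (f : R * R -> R) : measurable_fun (setT : set (plane R)) f -> measurable_fun strip f.
  exact: measurable_funS.
apply: (integral_le_lin _ _ _ _ _ _ _ _ _ E1 E2) => //.
- exact: measurable_strip.
- by apply: measurable_sqdist; [exact: measurable_vint_strip bG|exact: (mT _ bG.1)|exact: mT|exact: mT].
- by apply: measurable_sqdist; [exact: measurable_vint_strip bH|exact: (mT _ bH.1)|exact: mT|exact: mT].
- by apply: measurable_sqdist; [exact: measurable_vint_strip bGH|exact: (mT _ bGH.1)|exact: mT|exact: mT].
- by move=> z _; exact: sqdist_ge0.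
- by move=> z _; exact: sqdist_ge0.
- move=> z _; rewrite sqdist_ge0/= (vint_strip_lin _ _ _ bG bH) /K /L.
  have ineq (a b : R) : (k * a + l * b) ^+ 2 <= (2 * k ^+ 2 + 1) * a ^+ 2 + (2 * l ^+ 2 + 1) * b ^+ 2.
    by have := sqr_ge0 (k * a - l * b); have := sqr_ge0 a; have := sqr_ge0 b; nra.
  have -> : k * vint (G \_ strip) z + l * vint (H \_ strip) z - (k * p1 z + l * p2 z) =
    k * (vint (G \_ strip) z - p1 z) + l * (vint (H \_ strip) z - p2 z) by ring.
  have -> : k * G z + l * H z - (k * q1 z + l * q2 z) =
    k * (G z - q1 z) + l * (H z - q2 z) by ring.
  by apply: le_trans (lerD (ineq _ _) (ineq _ _)) _; lra.
- exact: ltW.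
- exact: ltW.
Qed.

(** Bounded pointwise convergence of the derivatives carries over to the primitives, slice by slice;
    dominated convergence on the strip then makes both squared errors small. *)
Lemma appr_lim C (G_ : (R * R -> R)^nat) G :
  (forall n, bounded_on_strip C (G_ n)) -> bounded_on_strip C G ->
  (forall z, strip z -> G_ n z @[n --> \oo] --> G z) ->
  (forall n, appr (G_ n)) -> appr G.
Proof.
move=> bG_ bG cG aG eps eps0.
have mT (f : R * R -> R) : measurable_fun (setT : set (plane R)) f -> measurable_fun strip f.
  exact: measurable_funS.
pose d n z := (vint (G \_ strip) z - vint (G_ n \_ strip) z) ^+ 2 + (G z - G_ n z) ^+ 2.
have md n : measurable_fun strip (d n).
  by apply: measurable_sqdist; [exact: measurable_vint_strip bG|exact: (mT _ bG.1)|
    exact: measurable_vint_strip (bG_ n)|exact: (mT _ (bG_ n).1)].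
(* Primitives are bounded by [2 * C], so their squared difference is at most [16 * C ^+ 2]; the
   derivatives contribute [4 * C ^+ 2]. *)
have dC n z : strip z -> `|d n z| <= 20 * C ^+ 2.
  move=> sz; rewrite ger0_norm ?sqdist_ge0//.
  have sqb (a b M : R) : `|a| <= M -> `|b| <= M -> (a - b) ^+ 2 <= 4 * M ^+ 2.
    by rewrite !ler_norml => /andP[? ?] /andP[? ?]; nra.
  have := sqb _ _ _ (vint_strip_bounded z bG) (vint_strip_bounded z (bG_ n)).
  have := sqb _ _ _ (bG.2 z sz) ((bG_ n).2 z sz).
  by rewrite /d; nra.
have [|||||] := @dominated_convergence _ _ _ leb2 strip measurable_strip
  (fun n z => (d n z)%:E) (cst 0%E) (EFin \o cst (20 * C ^+ 2)).
- by move=> n; exact/measurable_EFinP.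
- exact: measurable_cst.
- apply: aeW => z sz; apply: cvg_EFin; first exact: nearW.
  have sq0 (f : nat -> R) : f n @[n --> \oo] --> (0 : R) -> f n ^+ 2 @[n --> \oo] --> (0 : R).
    by move=> f0; have H := cvgM f0 f0; rewrite mulr0 in H; exact: H.
  rewrite -[X in _ --> X]addr0; apply: cvgD; apply: sq0.
  + rewrite -(subrr (vint (G \_ strip) z)); apply: cvgB; first exact: cvg_cst.
    exact: vint_strip_cvg bG_ bG.1 cG.
  + by rewrite -(subrr (G z)); apply: cvgB; [exact: cvg_cst|exact: cG].
- apply: (integrable_bounded (C := 20 * C ^+ 2)) => //; first exact: measurable_strip.
    exact: leb2_rect_lty.
  by move=> z _ /=; rewrite ger0_norm// mulr_ge0// sqr_ge0.
- by apply: aeW => z n sz; rewrite /= lee_fin; exact: dC.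
move=> _ _; rewrite integral0 => /fine_cvgP [fin cv].
have [n [dfin dn]] : exists n, (\int[leb2]_(z in strip) (d n z)%:E)%E \is a fin_num /\
    (\int[leb2]_(z in strip) (d n z)%:E <= (eps / 4)%:E)%E.
  have e4 : 0 < eps / 4 by rewrite divr_gt0.
  have [n [/= fn dn]] := @filter_ex _ _ _ _ (filterI fin (cvgr_le _ cv _ e4)).
  by exists n; split=> //; rewrite -(fineK fn) lee_fin.
have [|p [q [Ppq Epq]]] := aG n (eps / 4); first by rewrite divr_gt0.
exists p, q; split => //; have [_ _ mp mq _] := Ppq.
have -> : eps = 2 * (eps / 4) + 2 * (eps / 4) by field.
apply: (integral_le_lin _ _ _ _ _ _ _ _ _ dn Epq) => //.
- exact: measurable_strip.
- by apply: measurable_sqdist; [exact: measurable_vint_strip (bG_ n)|exact: (mT _ (bG_ n).1)|exact: mT|exact: mT].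
- by apply: measurable_sqdist; [exact: measurable_vint_strip bG|exact: (mT _ bG.1)|exact: mT|exact: mT].
- by move=> z _; exact: sqdist_ge0.
- by move=> z _; exact: sqdist_ge0.
move=> z _; rewrite sqdist_ge0/= /d.
have ineq (a b c : R) : (a - c) ^+ 2 <= 2 * (a - b) ^+ 2 + 2 * (b - c) ^+ 2.
  by have := sqr_ge0 (a + c - 2 * b); nra.
by have := ineq (vint (G \_ strip) z) (vint (G_ n \_ strip) z) (p z);
  have := ineq (G z) (G_ n z) (q z); lra.
Qed.

End appr.

(** * Trapezoidal blocks *)

Section blocks.
Context {R : realType}.
Local Notation leb := (@lebesgue_measure R).
Implicit Types (p q g u phi G H : R * R -> R) (D : set (R * R)).

(* Rises to the right of a and falls to the right of b, hence the half-open
   interval ]a, b] in the limit. *)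
Definition trapezoid (a b : R) (n : nat) (x : R) : R :=
  Num.max 0 (Num.min 1 (Num.min (n.+1%:R * (x - a)) (1 - n.+1%:R * (x - b)))).

Lemma trapezoid_bounds a b n x : 0 <= trapezoid a b n x <= 1.
Proof. by rewrite /trapezoid le_max lexx/= ge_max ler01/= ge_min lexx. Qed.

Lemma trapezoid_out a b n x : x <= a \/ b + 1 <= x -> trapezoid a b n x = 0.
Proof.
move=> xab; apply/max_l; rewrite ge_min; apply/orP; right; rewrite ge_min.
have n1 : 1 <= n.+1%:R :> R by rewrite ler1n.
apply/orP; case: xab => xab; [left|right]; last by nra.
by rewrite mulr_ge0_le0// subr_le0.
Qed.

(** For fixed [x] the limit is attained for all large [n], namely once the slopes, of width
    [1 / n.+1], no longer reach [x]. *)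
Lemma trapezoid_near a b x :
  \forall n \near \oo, trapezoid a b n x = \1_`]a, b] x.
Proof.
have big (e : R) : 0 < e -> \forall n \near \oo, 1 <= n.+1%:R * e.
  move=> e0; near=> n.
  rewrite -ler_pdivrMr// div1r (@le_trans _ _ n%:R)// ?ler_nat//; near: n.
  exact: nbhs_infty_ger.
have [xa|ax] := leP x a.
  apply: nearW => n; rewrite trapezoid_out; last by left.
  by rewrite indicE memNset//= in_itv/= => /andP[]; lra.
have [xb|bx] := leP x b.
  have := big _ (_ : 0 < x - a); rewrite subr_gt0 => /(_ ax); apply: filterS => n nx.
  rewrite indicE mem_set/=; last by rewrite in_itv/= ax xb.
  have n0 : 0 <= n.+1%:R :> R by [].
  rewrite /trapezoid (@min_l _ _ 1); first by rewrite max_r.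
  by rewrite le_min nx/=; nra.
have := big _ (_ : 0 < x - b); rewrite subr_gt0 => /(_ bx); apply: filterS => n nx.
rewrite indicE memNset/=; last by rewrite in_itv/= => /andP[]; lra.
by apply/max_l; rewrite !ge_min; apply/orP; right; apply/orP; right; lra.
Unshelve. all: by end_near. Qed.

Lemma cpl_trapezoid D a b n : continuous_piecewise_linear D (fun z => trapezoid a b n z.1).
Proof.
apply: cpl_max.
  have := cpl_affine D 0 0 0; congr continuous_piecewise_linear.
  by apply/funext => z; rewrite !mul0r !addr0.
apply: cpl_min.
  have := cpl_affine D 0 0 1; congr continuous_piecewise_linear.
  by apply/funext => z; rewrite !mul0r !add0r.
apply: cpl_min.
  have := cpl_affine D n.+1%:R 0 (- n.+1%:R * a); congr continuous_piecewise_linear.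
  by apply/funext => z; ring.
have := cpl_affine D (- n.+1%:R) 0 (1 + n.+1%:R * b); congr continuous_piecewise_linear.
by apply/funext => z; ring.
Qed.

Definition block_set a b c d n : set (plane R) :=
  [set z | c < z.2 <= c + (d - c) * trapezoid a b n z.1].

Definition block a b c d n (z : R * R) : R :=
  Num.max 0 (Num.min (z.2 - c) ((d - c) * trapezoid a b n z.1)).

Lemma measurable_block_set a b c d n : measurable (block_set a b c d n).
Proof.
have mtr : measurable_fun (setT : set (plane R)) (fun z => z.2 - (d - c) * trapezoid a b n z.1).
  apply: measurable_funB => //; apply: measurable_funM => //.
  by have [cT _] := cpl_trapezoid setT a b n; exact: within_continuous_measurable2 cT.
rewrite (_ : block_set a b c d n = (snd @^-1` `]c, +oo[) `&`
   ((fun z : plane R => z.2 - (d - c) * trapezoid a b n z.1) @^-1` `]-oo, c])).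
  apply: measurableI.
    by rewrite -[_ @^-1` _]setTI; apply: measurable_snd => //; exact: measurable_itv.
  by rewrite -[_ @^-1` _]setTI; apply: mtr => //; exact: measurable_itv.
apply/seteqP; split => -[x y]; rewrite /block_set/= !in_itv/= andbT.
  by move=> /andP[-> ?]; split => //; lra.
by move=> [-> ?]; lra.
Qed.

Lemma vint_block a b c d n z : c <= d -> vint (\1_(block_set a b c d n)) z = block a b c d n z.
Proof.
case: z => x y cd; rewrite /vint/= /block/=; set m := (d - c) * _.
have m0 : 0 <= m by rewrite mulr_ge0 ?subr_ge0//; have /andP[] := trapezoid_bounds a b n x.
have ind (A : set R) : measurable A -> (forall t, \1_(block_set a b c d n) (x, t) * step t y = \1_A t) ->
    \int[leb]_t (\1_(block_set a b c d n) (x, t) * step t y) = fine (leb A).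
  move=> mA E; under eq_Rintegral do rewrite E.
  by rewrite /Rintegral integral_indic// setIT.
have [ycm|cmy] := leP y (c + m).
  rewrite (ind `]c, y[%classic) //.
    rewrite lebesgue_measure_itv/= lte_fin; case: ifPn => [cy|]; rewrite -?EFinB/=.
      by rewrite max_r min_l//; lra.
    by rewrite -leNgt => yc; rewrite max_l// ge_min; apply/orP; left; lra.
  move=> t; rewrite !indicE /step; have [ty|yt] := ltP t y; last first.
    by rewrite mulr0 memNset//= in_itv/= => /andP[_]; rewrite ltNge yt.
  rewrite mulr1; have [tB|tB] := boolP (t \in `]c, y[%classic).
    rewrite mem_set//; move: tB; rewrite inE/= in_itv/= => /andP[ct _].
    by rewrite /block_set/= ct/= (le_trans (ltW ty)).
  rewrite memNset//; rewrite /block_set/= => /andP[ct _]; move: tB.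
  by rewrite notin_setE/= in_itv/= ct ty; apply.
rewrite (ind `]c, c + m]%classic) //.
  rewrite lebesgue_measure_itv/= lte_fin; case: ifPn => [cy|]; rewrite -?EFinB/=.
    by rewrite max_r min_r//; lra.
  by rewrite -leNgt => yc; rewrite max_l// ge_min; apply/orP; right; lra.
move=> t; rewrite !indicE /step.
have [tB|tB] := boolP (t \in `]c, c + m]%classic).
  move: tB; rewrite inE/= in_itv/= => /andP[ct tm].
  rewrite mem_set; last by rewrite /block_set/= ct tm.
  by rewrite (le_lt_trans tm cmy) mulr1.
rewrite memNset ?mul0r//; rewrite /block_set/= => tB'; move: tB.
by rewrite notin_setE/= in_itv/=; apply; exact: tB'.
Qed.

Lemma pl_pair_block a b c d n : c <= d -> pl_pair (block a b c d n) (\1_(block_set a b c d n)).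
Proof.
move=> cd; have vE : vint (\1_(block_set a b c d n)) = block a b c d n.
  by apply/funext => z; exact: vint_block.
have mB := measurable_block_set a b c d n.
have mi : measurable_fun (setT : set (plane R)) (\1_(block_set a b c d n) : R * R -> R).
  exact: measurable_indic.
have bC z : `|block a b c d n z| <= d - c.
  have /andP[t0 t1] := trapezoid_bounds a b n z.1.
  rewrite ger0_norm; last by rewrite /block le_max lexx.
  rewrite /block ge_max subr_ge0 cd/= ge_min; apply/orP; right.
  by rewrite ler_piMr// subr_ge0.
have iC z : `|(\1_(block_set a b c d n) : R * R -> R) z| <= 1.
  by rewrite indicE; case: (_ \in _); rewrite ?normr1 ?normr0.
have C1 z : `|block a b c d n z| <= 1 + (d - c) /\
    `|(\1_(block_set a b c d n) : R * R -> R) z| <= 1 + (d - c).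
  by split; [rewrite (le_trans (bC z))//; lra|rewrite (le_trans (iC z))//; lra].
have cpl : continuous_piecewise_linear Upsilon (block a b c d n).
  apply: cpl_max.
    have := cpl_affine Upsilon 0 0 (0 : R); congr continuous_piecewise_linear.
    by apply/funext => z; rewrite !mul0r !addr0.
  apply: cpl_min.
    have := cpl_affine Upsilon 0 1 (- c); congr continuous_piecewise_linear.
    by apply/funext => z; ring.
  have := cpl_lin (d - c) 0 (cpl_trapezoid Upsilon a b n) (cpl_trapezoid Upsilon a b n).
  by congr continuous_piecewise_linear; apply/funext => z; ring.
split => //.
- rewrite -vE; apply: (weak_dy_vint (C := 1 + (d - c))) => //.
  (* [b + 1] because the right slope of the trapezoid has width [1 / n.+1], at most 1. *)
  + pose box : set (plane R) := `[a, b + 1] `*` `[c, d].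
    have mbox : measurable box by apply: measurableX; exact: measurable_itv.
    have -> : (\1_(block_set a b c d n) : R * R -> R) =
        ((\1_(block_set a b c d n) : R * R -> R) \_ box).
      apply/funext => -[x y]; rewrite patchE; case: ifPn => // nb.
      rewrite indicE memNset// /block_set/= => /andP[cy yc]; move: nb.
      rewrite notin_setE; apply; rewrite /box/= !in_itv/=.
      have /andP[t0 t1] := trapezoid_bounds a b n x.
      have yd : y <= d.
        by apply: le_trans yc _; rewrite -lerBrDl ler_piMr// subr_ge0.
      split; last by rewrite ltW.
      apply/andP; split; rewrite leNgt; apply/negP => xlt; move: yc; rewrite trapezoid_out;
        by [rewrite mulr0 addr0 leNgt cy|left; exact: ltW|right; exact: ltW].
    apply: (integrable_restrictT _ mbox _).1.
    apply: (integrable_bounded (C := 1)) => //; first exact: leb2_rect_lty.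
  + by move=> z; case: (C1 z).
  + by move=> z; rewrite vE; case: (C1 z).
- by rewrite -vE; exact: measurable_vint.
- by exists (1 + (d - c)).
Qed.

End blocks.

(** * From rectangles to bounded functions *)

Section appr_bounded.
Context {R : realType}.
Local Notation leb := (@lebesgue_measure R).
Implicit Types (p q g u phi G H : R * R -> R) (D : set (R * R)).

Lemma bounded_indic (A : set (plane R)) : measurable A ->
  bounded_on_strip 1 (\1_A : R * R -> R).
Proof.
move=> mA; split; first exact: measurable_indic.
by move=> z _; rewrite indicE; case: (_ \in _); rewrite ?normr1 ?normr0.
Qed.

Lemma eq_appr G H : (forall z, strip z -> G z = H z) -> appr G -> appr H.
Proof.
move=> GH aG eps /aG [p [q [P E]]]; exists p, q; split => //.
apply: le_trans E; rewrite le_eqVlt; apply/orP; left; apply/eqP.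
apply: eq_integral => z /set_mem sz; rewrite GH//; congr ((_ ^+ 2 + _)%:E).
congr (vint _ z - _); apply/funext => z'; rewrite !patchE.
by case: ifPn => // /set_mem sz'; rewrite GH.
Qed.


(** The error is 0: the bounds on [c] and [d] place the block within the heights of the strip, so
    restriction to the strip does not alter its primitive over the unit interval. *)
Lemma appr_block a b c d n : -1 <= c -> c <= d -> d <= 1 ->
  appr (\1_(block_set a b c d n) : R * R -> R).
Proof.
move=> c1 cd d1 eps eps0; exists (block a b c d n), (\1_(block_set a b c d n)).
split; first exact: pl_pair_block.
rewrite integral0_eq ?lee_fin ?ltW// => -[x y] [/= xI yI].
suff -> : vint ((\1_(block_set a b c d n) : R * R -> R) \_ strip) (x, y) = block a b c d n (x, y).
  by rewrite !subrr expr0n addr0.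
rewrite -vint_block//; apply: eq_Rintegral => t _ /=; rewrite patchE; case: ifPn => // nst.
congr (_ * _); rewrite indicE memNset// /block_set/= => /andP[ct tc]; move: nst.
have /andP[t0 t1] := trapezoid_bounds a b n x.
rewrite notin_setE; apply; split => //=; rewrite in_itv/=; apply/andP; split; first lra.
by apply: le_trans tc _; nra.
Qed.

Lemma appr_rect (a b c d : R) : appr (\1_(`]a, b] `*` `]c, d] : set (plane R)) : R * R -> R).
Proof.
(* Heights are clamped to those of the strip, where blocks are exact; the outer [Num.max] ensures
   [c' <= d']. *)
pose c' := Num.max c (-1); pose d' := Num.max c' (Num.min d 1).
have c'1 : -1 <= c' by rewrite le_max lexx orbT.
have c'd' : c' <= d' by rewrite le_max lexx.
(* A rectangle above the strip has an empty trace on it, like a block of height 0. *)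
have [c'le1|c'gt1] := leP c' 1; last first.
  apply: (@eq_appr (\1_(block_set a a 0 0 0))); last by apply: appr_block; lra.
  move=> [x y] [/= _]; rewrite in_itv/= => yI; rewrite !indicE !memNset//.
    move=> [/= _]; rewrite in_itv/= => /andP[cy _].
    by move: c'gt1; rewrite /c' lt_max => /orP[]; lra.
  by rewrite /block_set/= => /andP[y0]; rewrite subrr mul0r addr0 leNgt y0.
have d'1 : d' <= 1 by rewrite /d' ge_max c'le1 ge_min lexx orbT.
apply: (@eq_appr (\1_(`]a, b] `*` `]c', d']))).
  move=> [x y] [/= _]; rewrite in_itv/= => /andP[y0 y1]; rewrite !indicE.
  have [xab|xab] := pselect (`]a, b]%classic x); last by rewrite !memNset// => -[/=].
  have [ycd|ycd] := pselect (`]c, d]%classic y).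
    rewrite !mem_set//; split => //=; move: ycd; rewrite /= !in_itv/= => /andP[cy yd].
    by rewrite /c' gt_max cy y0/= /d' le_max le_min yd y1 orbT.
  rewrite !memNset//; first by move=> [/=].
  move=> [/= _]; rewrite in_itv/= => /andP[cy yd]; apply: ycd; rewrite /= in_itv/=.
  have /andP[-> _] : (c < y) && (-1 < y) by rewrite -gt_max.
  move: yd; rewrite /d' le_max => /orP[yc'|]; last by rewrite le_min => /andP[].
  by move: yc'; rewrite leNgt cy.
apply: (@appr_lim _ 1 (fun n => \1_(block_set a b c' d' n))).
- by move=> n; apply: bounded_indic; exact: measurable_block_set.
- by apply: bounded_indic; apply: measurableX; exact: measurable_itv.
- move=> [x y] _; apply: cvg_near_cst; apply: filterS (trapezoid_near a b x) => n tn.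
  rewrite !indicE; congr (_%:R).
  have [xab|xab] := boolP (x \in `]a, b]%classic).
    have t1 : trapezoid a b n x = 1 by rewrite tn indicE xab.
    congr nat_of_bool; apply/idP/idP; rewrite !inE /block_set/= t1 mulr1 in_itv/=.
      by rewrite subrKC; split => //; move: xab; rewrite inE.
    by move=> [_]; rewrite subrKC.
  have t0 : trapezoid a b n x = 0 by rewrite tn indicE (negbTE xab).
  rewrite !memNset//; first by move=> [/= xI _]; move: xab; rewrite notin_setE; apply.
  by rewrite /block_set/= t0 mulr0 addr0 => /andP[cy]; rewrite leNgt cy.
- by move=> n; exact: appr_block.
Qed.

(** Complements and finite disjoint unions are linear combinations of indicators; countable unions
    are bounded pointwise limits of finite ones. *)
Lemma appr_indic (A : set (plane R)) : measurable A -> appr (\1_A : R * R -> R).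
Proof.
have aT : appr (\1_(setT : set (plane R)) : R * R -> R).
  apply: (@eq_appr (\1_(`]0, 1] `*` `]-1, 1] : set (plane R)))); last exact: appr_rect.
  move=> [x y] [/= xI yI]; rewrite !indicE !mem_set//; split => //=.
  by move: xI; rewrite !in_itv/= => /andP[-> /ltW ->].
move=> mA; move: A mA; apply: plane_induction => //.
- exact: appr_rect.
- move=> S mS aS.
  have := appr_lin 1 (-1) (bounded_indic measurableT) (bounded_indic mS) aT aS.
  apply: eq_appr => z _; rewrite !indicE in_setT in_setC.
  by case: (_ \in _) => /=; ring.
- move=> F mF tF aF.
  have mU n : measurable (\bigcup_(k in `I_n) F k) by apply: bigcup_measurable.
  apply: (@appr_lim _ 1 (fun n => \1_(\bigcup_(k in `I_n) F k))).
  + by move=> n; exact: bounded_indic.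
  + by apply: bounded_indic; exact: bigcupT_measurable.
  + move=> z _; rewrite indicE; have [[k _ Fz]|nF] := pselect ((\bigcup_k F k) z).
      rewrite mem_set; last by exists k.
      apply: cvg_near_cst; near=> n; rewrite indicE mem_set//; exists k => //=.
      by near: n; exact: nbhs_infty_gt.
    rewrite memNset//; apply: cvg_near_cst; apply: nearW => n.
    by rewrite indicE memNset// => -[k _ Fz]; apply: nF; exists k.
  + elim=> [|n IHn].
      apply: (@eq_appr (fun z => 0 * (\1_(setT : set (plane R)) : R * R -> R) z +
          0 * (\1_(setT : set (plane R)) : R * R -> R) z)).
        by move=> z _; rewrite !mul0r addr0 indicE memNset// => -[].
      by apply: appr_lin => //; apply: bounded_indic.
    have := appr_lin 1 1 (bounded_indic (mU n)) (bounded_indic (mF n)) IHn (aF n).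
    apply: eq_appr => z _; rewrite !mul1r !indicE.
    have [Fz|nFz] := pselect (F n z).
      rewrite (mem_set Fz) (mem_set (A := \bigcup_(k in `I_n.+1) F k)); last by exists n => /=.
      rewrite memNset ?add0r// => -[k /= kn Fkz].
      have := tF k n I I (ex_intro _ z (conj Fkz Fz)) => kE.
      by move: kn; rewrite kE ltnn.
    rewrite (memNset nFz) addr0; congr (nat_of_bool _)%:R.
    apply/idP/idP; rewrite !inE => -[k /= kn Fkz]; exists k => //=; first exact: ltnW.
    move: kn; rewrite ltnS leq_eqVlt => /orP[/eqP kn|//].
    by move: Fkz; rewrite kn.
Unshelve. all: by end_near. Qed.

(* [H] sums the first [n] terms of the binary expansion of [G]. *)
Lemma appr_binary n G : measurable_fun (setT : set (plane R)) G ->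
  (forall z, 0 <= G z <= 1) ->
  exists H, [/\ bounded_on_strip 1 H, appr H & forall z, 0 <= H z <= G z /\ G z - H z <= 2^-1 ^+ n].
Proof.
elim: n G => [|n IHn] G mG G01.
  exists (cst 0); split.
  - by split => // z _; rewrite normr0.
  - have := appr_lin 0 0 (bounded_indic measurableT) (bounded_indic measurableT)
      (appr_indic measurableT) (appr_indic measurableT).
    by apply: eq_appr => z _; rewrite !mul0r addr0.
  - by move=> z; rewrite expr0 lexx subr0; have /andP[] := G01 z.
(* The set where the first binary digit of [G] is 1. Doubling [G] and subtracting this digit shifts
   the expansion by one place. *)
pose A := G @^-1` `[2^-1, +oo[.
have mA : measurable (A : set (plane R)).
  by rewrite /A -[_ @^-1` _]setTI; apply: mG => //; exact: measurable_itv.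
have AE z : (\1_A z = 1 :> R /\ 2^-1 <= G z) \/ (\1_A z = 0 :> R /\ G z < 2^-1).
  rewrite !indicE /A; have [Gz|Gz] := leP 2^-1 (G z); [left|right]; split => //.
    by rewrite mem_set//= in_itv/= Gz.
  by rewrite memNset//= in_itv/= andbT leNgt Gz.
pose G' z := 2 * G z - \1_A z.
have mG' : measurable_fun (setT : set (plane R)) G'.
  apply: measurable_funB; first exact: measurable_funM.
  exact: measurable_indic.
have G'01 z : 0 <= G' z <= 1.
  by have /andP[? ?] := G01 z; rewrite /G'; case: (AE z) => -[-> ?]; lra.
have [H [bH aH HG]] := IHn G' mG' G'01.
exists (fun z => 2^-1 * \1_A z + 2^-1 * H z); split.
- have [mH HC] := bounded_on_strip_lin 2^-1 2^-1 (bounded_indic mA) bH.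
  split => // z sz; apply: le_trans (HC z sz) _.
  by rewrite ger0_norm ?invr_ge0//; lra.
- exact: (appr_lin 2^-1 2^-1 (bounded_indic mA) bH (appr_indic mA) aH).
move=> z; have [/andP[H0 HG1] HG2] := HG z; have /andP[g0 g1] := G01 z.
rewrite exprS; move: HG1 HG2; rewrite /G'; set e := 2^-1 ^+ n.
by case: (AE z) => -[-> ?] ? ?; split; lra.
Qed.

(** After an affine rescaling to values in [0, 1] the function is the uniform limit of its binary
    truncations. *)
Lemma appr_bounded C G : bounded_on_strip C G -> appr G.
Proof.
move=> [mG GC].
have [C0|C0] := leP C 0.
  apply: (@eq_appr (fun z => 0 * (\1_(setT : set (plane R)) : R * R -> R) z +
          0 * (\1_(setT : set (plane R)) : R * R -> R) z)).
    move=> z sz; rewrite !mul0r addr0; apply/esym/eqP; rewrite -normr_le0.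
    exact: le_trans (GC z sz) C0.
  by apply: appr_lin; try exact: bounded_indic; exact: appr_indic.
(* [G] is bounded only on the strip. Clipping places [G1] in [0, 1] on the whole plane, as
   [appr_binary] requires, and changes nothing on the strip. *)
pose G1 z := Num.max 0 (Num.min 1 ((2 * C)^-1 * (G z + C))).
have mG1 : measurable_fun (setT : set (plane R)) G1.
  apply: measurable_maxr => //; apply: measurable_minr => //.
  by apply: measurable_funM => //; exact: measurable_funD.
have G01 z : 0 <= G1 z <= 1 by rewrite /G1 le_max lexx/= ge_max ler01/= ge_min lexx.
have bG1 : bounded_on_strip 1 G1.
  by split => // z _; have /andP[? ?] := G01 z; rewrite ger0_norm.
have aG1 : appr G1.
  have /choice[H HP] : forall n, exists H, [/\ bounded_on_strip 1 H, appr H &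
      forall z, 0 <= H z <= G1 z /\ G1 z - H z <= 2^-1 ^+ n].
    by move=> n; exact: appr_binary.
  apply: (@appr_lim _ 1 H) => //; [by move=> n; case: (HP n)| |by move=> n; case: (HP n)].
  move=> z _; apply/cvgrPdist_le => e e0.
  have := @cvg_geometric R 1 2^-1 _; rewrite ger0_norm ?invr_ge0// => /(_ _)/cvgrPdist_le.
  move=> /(_ _ _ e0); rewrite invf_lt1 ?ltr1n// => /(_ isT).
  apply: filterS => n; rewrite sub0r normrN /geometric/= mul1r => en.
  have [_ _ /(_ z)[/andP[H0 H1] H2]] := HP n.
  rewrite ger0_norm ?subr_ge0// (le_trans H2)// (le_trans _ en)// ler_norm//.
have := appr_lin (2 * C) (- C) bG1 (bounded_indic measurableT) aG1 (appr_indic measurableT).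
apply: eq_appr => z sz; rewrite indicE in_setT mulr1 /G1.
have := GC z sz; rewrite ler_norml => /andP[c1 c2].
have C2 : 0 < 2 * C by rewrite mulr_gt0.
rewrite min_r; last by rewrite mulrC ler_pdivrMr//; lra.
rewrite max_r; last by rewrite mulr_ge0// ?invr_ge0 ?(ltW C2)//; lra.
by field; rewrite gt_eqF.
Qed.

End appr_bounded.

(** * Weakly differentiable functions as primitives *)

Section cutoffs.
Context {R : realType}.
Implicit Types t x y : R.

(** Rises from 0 to 1 over [[d, 2 * d]] and falls back over [[1 - 2 * d, 1 - d]], provided
    [4 * d < 1]; its derivative is of size 1 / d on these two rows and 0 elsewhere. *)
Definition cutoff (d y : R) : R :=
  kappa (d^-1 * y + (- 1)) * kappa (- d^-1 * y + (1 - d) / d).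
Definition dcutoff (d y : R) : R :=
  (dkappa (d^-1 * y + (- 1)) * d^-1) * kappa (- d^-1 * y + (1 - d) / d) +
  kappa (d^-1 * y + (- 1)) * (dkappa (- d^-1 * y + (1 - d) / d) * - d^-1).

Lemma C1_cutoff d : C1_with (cutoff d) (dcutoff d).
Proof. by apply: C1_with_mul; exact: C1_with_kappa. Qed.

Section cutoff_facts.
Variable d : R.
Hypothesis d0 : 0 < d.

Let low y : (d^-1 * y + (- 1)) * d = y - d.
Proof. by field; rewrite gt_eqF. Qed.

Let high y : (- d^-1 * y + (1 - d) / d) * d = 1 - d - y.
Proof. by field; rewrite gt_eqF. Qed.

Lemma cutoff_bounds y : 0 <= cutoff d y <= 1.
Proof.
rewrite /cutoff; have := kappa_bounds (d^-1 * y + (- 1)).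
by have := kappa_bounds (- d^-1 * y + (1 - d) / d); nra.
Qed.

Lemma dcutoff_bound y : `|dcutoff d y| <= 8 / d.
Proof.
have i0 : 0 < d^-1 by rewrite invr_gt0.
have aux (k1 k2 l1 l2 : R) : 0 <= k1 <= 1 -> 0 <= k2 <= 1 -> 0 <= l1 <= 4 -> 0 <= l2 <= 4 ->
    `|(l1 * d^-1) * k2 + k1 * (l2 * - d^-1)| <= 8 / d.
  move=> /andP[? ?] /andP[? ?] /andP[? ?] /andP[? ?].
  rewrite (_ : _ + _ = (l1 * k2 - k1 * l2) * d^-1); last by ring.
  rewrite normrM (ger0_norm (ltW i0)) ler_wpM2r// ?(ltW i0)// ler_norml.
  by apply/andP; split; nra.
by apply: aux; [exact: kappa_bounds|exact: kappa_bounds|exact: dkappa_bounds|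
  exact: dkappa_bounds].
Qed.

Lemma cutoff_out y : y <= d \/ 1 - d <= y -> cutoff d y = 0 /\ dcutoff d y = 0.
Proof.
rewrite /cutoff /dcutoff => -[yd|dy].
  have l0 : d^-1 * y + (- 1) <= 0 by rewrite -(pmulr_lle0 _ d0) low; lra.
  by rewrite kappa0// dkappa0// !mul0r addr0.
have l0 : - d^-1 * y + (1 - d) / d <= 0 by rewrite -(pmulr_lle0 _ d0) high; lra.
by rewrite (kappa0 l0) (dkappa0 l0) !mul0r !mulr0 addr0.
Qed.

Lemma cutoff_in y : 2 * d <= y <= 1 - 2 * d -> cutoff d y = 1 /\ dcutoff d y = 0.
Proof.
move=> /andP[yd dy]; rewrite /cutoff /dcutoff.
have l1 : 1 <= d^-1 * y + (- 1) by rewrite -(ler_pM2r d0) low; lra.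
have l2 : 1 <= - d^-1 * y + (1 - d) / d by rewrite -(ler_pM2r d0) high; lra.
by rewrite (kappa1 l1) (dkappa1 l1) (kappa1 l2) (dkappa1 l2) !mul0r !mulr0 mulr1 addr0.
Qed.

End cutoff_facts.

Definition ramp t : R := posp t - posp (t - 1).
Definition ramp_primitive t : R := (posp t ^+ 2 - posp (t - 1) ^+ 2) / 2.

Lemma C1_ramp_primitive : C1_with ramp_primitive ramp.
Proof.
have C2 : C1_with (fun t : R => posp t ^+ 2) (fun t => 2 * posp t).
  split; first exact: is_derive_posp2.
  by move=> t; apply: cvgM; [exact: cvg_cst|exact: continuous_posp].
have := C1_with_lin 2^-1 (- 2^-1) C2 (C1_with_comp_affine 1 (-1) C2).
congr C1_with; apply/funext => t; rewrite /ramp_primitive /ramp mul1r.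
  by field.
by field.
Qed.

Lemma ramp_bounds t : 0 <= ramp t <= 1.
Proof.
rewrite /ramp /posp; have [t0|t0] := leP t 0; have [t1|t1] := leP (t - 1) 0; lra.
Qed.

Lemma ramp0 t : t <= 0 -> ramp t = 0.
Proof. by move=> t0; rewrite /ramp !posp0; lra. Qed.

Lemma ramp1 t : 1 <= t -> ramp t = 1.
Proof. by move=> t0; rewrite /ramp !pospE; lra. Qed.

Lemma ramp_primitive0 t : t <= 0 -> ramp_primitive t = 0.
Proof. by move=> t0; rewrite /ramp_primitive !posp0 ?expr0n ?subrr ?mul0r; lra. Qed.

Lemma ramp_primitive1 t : 1 <= t -> ramp_primitive t = t - 2^-1.
Proof. by move=> t0; rewrite /ramp_primitive !pospE; [field|lra|lra]. Qed.

(* A sequence of C^1 functions with derivatives converging boundedly to the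
   indicator function of ]c, e]; they vanish on the right of e + 1 / N. *)
Definition bridge (N c e y : R) : R :=
  (ramp_primitive (N * y + - (N * c)) - ramp_primitive (N * y + - (N * e))) / N - (e - c).
Definition dbridge (N c e y : R) : R := ramp (N * y + - (N * c)) - ramp (N * y + - (N * e)).

(** A C^1 counterpart of [trapezoid]: here it is a factor of a test function, where corners are not
    allowed. *)
Definition plateau (N a b x : R) : R := kappa (N * x + - (N * a)) - kappa (N * x + - (N * b)).
Definition dplateau (N a b x : R) : R :=
  dkappa (N * x + - (N * a)) * N - dkappa (N * x + - (N * b)) * N.

Section bridge_facts.
Variables (N c e : R).
Hypotheses (N0 : 0 < N) (ce : c <= e).

Lemma C1_plateau : C1_with (plateau N c e) (dplateau N c e).
Proof.
have := C1_with_lin 1 (-1) (C1_with_kappa N (- (N * c))) (C1_with_kappa N (- (N * e))).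
by congr C1_with; apply/funext => t; rewrite /plateau /dplateau; ring.
Qed.

Lemma C1_bridge : C1_with (bridge N c e) (dbridge N c e).
Proof.
have C := C1_ramp_primitive.
have C1 : C1_with (fun _ : R => 1 : R) (fun _ => 0).
  by split=> t; [exact: is_derive_cst|exact: cvg_cst].
have := C1_with_lin 1 (- (e - c)) (C1_with_lin N^-1 (- N^-1) (C1_with_comp_affine N (- (N * c)) C)
  (C1_with_comp_affine N (- (N * e)) C)) C1.
by congr C1_with; apply/funext => t; rewrite /bridge /dbridge; field; rewrite gt_eqF.
Qed.


Let left_le y : y <= c -> N * y + - (N * c) <= 0 /\ N * y + - (N * e) <= 0.
Proof.
move=> yc; have H1 : N * y <= N * c by rewrite ler_wpM2l// ltW.
by have H2 : N * c <= N * e by [rewrite ler_wpM2l// ltW]; split; lra.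
Qed.

Let right_ge y : e + N^-1 <= y -> 1 <= N * y + - (N * c) /\ 1 <= N * y + - (N * e).
Proof.
move=> ye; have Ne : N * N^-1 = 1 by rewrite divff// gt_eqF.
have H : N * (e + N^-1) <= N * y by rewrite ler_wpM2l// ltW.
have H' : N * c <= N * e by rewrite ler_wpM2l// ltW.
by rewrite mulrDr Ne in H; split; lra.
Qed.

Lemma dbridge_out y : y <= c \/ e + N^-1 <= y -> dbridge N c e y = 0.
Proof.
rewrite /dbridge => -[/left_le[? ?]|/right_ge[? ?]].
  by rewrite !ramp0 ?subrr.
by rewrite !ramp1 ?subrr.
Qed.

Lemma plateau_out y : y <= c \/ e + N^-1 <= y -> plateau N c e y = 0.
Proof.
rewrite /plateau => -[/left_le[? ?]|/right_ge[? ?]].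
  by rewrite !kappa0 ?subrr.
by rewrite !kappa1 ?subrr.
Qed.

Lemma bridge_out y : e + N^-1 <= y -> bridge N c e y = 0.
Proof.
move=> /right_ge[? ?]; rewrite /bridge !ramp_primitive1//.
by field; rewrite gt_eqF.
Qed.

Lemma dbridge_bound y : `|dbridge N c e y| <= 1.
Proof.
rewrite /dbridge; have := ramp_bounds (N * y + - (N * c)).
by have := ramp_bounds (N * y + - (N * e)); rewrite ler_norml; lra.
Qed.

Lemma plateau_bound y : `|plateau N c e y| <= 1.
Proof.
rewrite /plateau; have := kappa_bounds (N * y + - (N * c)).
by have := kappa_bounds (N * y + - (N * e)); rewrite ler_norml; lra.
Qed.

End bridge_facts.

(** Constant [- (e - c)] to the left of [c], 0 to the right of [e + N^-1], and continuous on the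
    compact interval between them. *)
Lemma bridge_bounded (N c e : R) : 0 < N -> c <= e ->
  exists C : R, forall y, `|bridge N c e y| <= C.
Proof.
move=> N0 ce; have C := C1_bridge c e N0; have cb := C1_with_continuous C.
have [M M0 HM] := compact_continuous_bound (@segment_compact R c (e + N^-1)) (continuous_subspaceT cb).
exists (M + (e - c)) => y.
have [yc|cy] := leP y c.
  rewrite /bridge !ramp_primitive0; [|nra|nra].
  by rewrite subrr mul0r sub0r normrN ger0_norm; lra.
have [ye|ey] := leP y (e + N^-1).
  rewrite (@le_trans _ _ M)//; last lra.
  by apply: HM; rewrite /= in_itv/= ye ltW.
by rewrite bridge_out ?normr0//; [lra|exact: ltW].
Qed.

(** Covers [ramp] and [kappa] at once: steepening moves each fixed [y] off the slopes, where the two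
    functions are known to be 0 or 1. *)
Lemma ramp_like_cvg (f : R -> R) (N : R^nat) (c e y : R) :
  (forall n, 0 < N n) -> N n @[n --> \oo] --> +oo ->
  (forall t, t <= 0 -> f t = 0) -> (forall t, 1 <= t -> f t = 1) -> c <= e ->
  f (N n * y + - (N n * c)) - f (N n * y + - (N n * e)) @[n --> \oo] --> (\1_`]c, e] y : R).
Proof.
move=> N0 Noo f0 f1 ce; apply: cvg_near_cst.
have big (r : R) : 0 < r -> \forall n \near \oo, 1 <= N n * r.
  move=> r0; have /cvgryPge/(_ r^-1) := Noo; apply: filterS => n nr.
  by rewrite -ler_pdivrMr// div1r.
have [yc|cy] := leP y c.
  apply: nearW => n; have := N0 n => Nn.
  rewrite !f0; [|nra|nra]; rewrite subrr indicE memNset//= in_itv/= => /andP[]; lra.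
have [ye|ey] := leP y e.
  have := big (y - c); rewrite subr_gt0 => /(_ cy); apply: filterS => n nn; have := N0 n => Nn.
  rewrite f1; last by nra.
  rewrite f0; last by nra.
  by rewrite subr0 indicE mem_set//= in_itv/= cy ye.
have := big (y - e); rewrite subr_gt0 => /(_ ey); apply: filterS => n nn; have := N0 n => Nn.
rewrite !f1; [|nra|nra]; rewrite subrr indicE memNset//= in_itv/= => /andP[]; lra.
Qed.

End cutoffs.

(** * Testing the cut-off function against its primitive *)

Section primitive.
Context {R : realType}.
Implicit Types (u G phi : R * R -> R) (d : R).

(** A compact part of [Upsilon]: on it local integrability is integrability. *)
Definition square d : set (plane R) := `[d, 1 - d] `*` `[d, 1 - d].

Lemma compact_square d : compact (square d : set (R * R)).
Proof. by apply: (@compact_setX R R); exact: segment_compact. Qed.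

Lemma measurable_square d : measurable (square d).
Proof. by apply: measurableX; exact: measurable_itv. Qed.

Lemma square_Upsilon d : 0 < d -> square d `<=` Upsilon.
Proof.
move=> d0 [x y]; rewrite /square/= !in_itv/= => -[/andP[? ?] /andP[? ?]].
by split => /=; rewrite in_itv/=; apply/andP; split; lra.
Qed.

Lemma C1c_closed_in (K D : set (R * R)) phi : C1 phi -> compact K -> K `<=` D ->
  (forall z, ~ K z -> phi z = 0) -> C1c D phi.
Proof.
move=> C1phi cK KD phi0.
have cl : closure [set q | phi q != 0] `<=` K.
  have -> : K = closure K.
    by apply/closure_id; apply: compact_closed => //; exact: norm_hausdorff.
  apply: closureS => z /= pz; apply: contrapT => nKz.
  by move: pz; rewrite phi0// eqxx.
split => //; last exact: subset_trans KD.
by apply: (subclosed_compact _ cK) => //; exact: closed_closure.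
Qed.

Section test.
Variables (u G : R * R -> R) (d : R).
Hypotheses (d0 : 0 < d) (d1 : 4 * d < 1) (uG : weak_dy Upsilon u G).

(** The cut is sharp in x and smooth in y: only y is differentiated, and [cutoff] and [dcutoff]
    already vanish on the horizontal sides of the square, so the restriction adds no term to the
    Leibniz rule behind [cut_dy]. *)
Definition cut_u : R * R -> R := (fun z => cutoff d z.2 * u z) \_ (square d).
Definition cut_dy : R * R -> R := (fun z => cutoff d z.2 * G z + dcutoff d z.2 * u z) \_ (square d).

Lemma measurable_cutoff_snd (D : set (plane R)) : measurable_fun D (fun z : plane R => cutoff d z.2).
Proof.
apply: (@measurable_funS _ _ _ _ setT) => //.
apply: continuous_measurable2; apply: continuous_comp_snd.
exact: C1_with_continuous (C1_cutoff d).
Qed.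

Lemma measurable_dcutoff_snd (D : set (plane R)) : measurable_fun D (fun z : plane R => dcutoff d z.2).
Proof.
apply: (@measurable_funS _ _ _ _ setT) => //.
by apply: continuous_measurable2; apply: continuous_comp_snd; case: (C1_cutoff d).
Qed.

Lemma cut_integrable v : locally_integrable2 Upsilon v ->
  leb2.-integrable (setT : set (plane R)) (EFin \o ((fun z => cutoff d z.2 * v z) \_ (square d))) /\
  leb2.-integrable (setT : set (plane R)) (EFin \o ((fun z => dcutoff d z.2 * v z) \_ (square d))).
Proof.
move=> [_ iv]; have {}iv := iv _ (square_Upsilon d0) (compact_square (d := d)).
have mS := measurable_square d.
split; apply: (integrable_restrictT _ mS _).1.
  rewrite (_ : (fun z => _) = (fun z => v z * cutoff d z.2)); last by apply/funext => z; rewrite mulrC.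
  apply: (integrable_mul_bounded (C := 1) mS iv); first exact: measurable_cutoff_snd.
  by move=> z _; have /andP[? ?] := cutoff_bounds d z.2; rewrite ger0_norm.
rewrite (_ : (fun z => _) = (fun z => v z * dcutoff d z.2)); last by apply/funext => z; rewrite mulrC.
apply: (integrable_mul_bounded (C := 8 / d) mS iv); first exact: measurable_dcutoff_snd.
by move=> z _; exact: dcutoff_bound.
Qed.

Lemma cut_u_integrable : leb2.-integrable (setT : set (plane R)) (EFin \o cut_u).
Proof. by have [lu _ _] := uG; case: (cut_integrable lu). Qed.

Lemma cut_dyE : cut_dy = (fun z => ((fun z => cutoff d z.2 * G z) \_ (square d)) z +
  ((fun z => dcutoff d z.2 * u z) \_ (square d)) z).
Proof.
by apply/funext => z; rewrite /cut_dy !patchE; case: ifP => // _; rewrite -[point]/(0 : R) addr0.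
Qed.

Lemma cut_dy_integrable : leb2.-integrable (setT : set (plane R)) (EFin \o cut_dy).
Proof.
have [lu lG _] := uG; rewrite cut_dyE; apply: integrableD_real => //.
  by case: (cut_integrable lG).
by case: (cut_integrable lu).
Qed.

Lemma measurable_fst_comp (X : R -> R) : continuous X ->
  measurable_fun (setT : set (plane R)) (fun z => X z.1).
Proof. by move=> cX; apply: continuous_measurable2; exact: continuous_comp_fst. Qed.

Lemma measurable_snd_comp (X : R -> R) : continuous X ->
  measurable_fun (setT : set (plane R)) (fun z => X z.2).
Proof. by move=> cX; apply: continuous_measurable2; exact: continuous_comp_snd. Qed.

(** The weak derivative tested with bridge times cutoff times plateau, and the integration by parts
    of [vint cut_dy] against bridge times plateau, produce the same value. The bounds on [b] and [N]
    keep the right slope of [plateau], of width [N^-1], inside the square. *)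
Lemma test_bridge (N a b c e : R) : d^-1 <= N -> d <= a -> a <= b -> b <= 1 - 2 * d -> c <= e ->
  \int[leb2]_z ((cut_u z - vint cut_dy z) * (dbridge N c e z.2 * plateau N a b z.1)) = 0.
Proof.
move=> dN da ab bd ce.
have N0 : 0 < N by apply: lt_le_trans dN; rewrite invr_gt0.
have Nd : N^-1 <= d by rewrite -[leRHS]invrK lef_pV2// posrE invr_gt0.
have CX := C1_plateau N a b; have CB := C1_bridge c e N0.
have cX := C1_with_continuous CX; have cB := C1_with_continuous CB; have cdB := CB.2.
have CY := C1_with_mul CB (C1_cutoff d).
have [lu lG wuG] := uG.
have Xout x : ~ `[d, 1 - d]%classic x -> plateau N a b x = 0.
  move=> nx; apply: plateau_out => //.
  have [xa|ax] := leP x a; [by left|right]; rewrite leNgt; apply/negP => xb.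
  by apply: nx; rewrite /= in_itv/=; apply/andP; split; lra.
have Yout y : ~ `[d, 1 - d]%classic y -> cutoff d y = 0 /\ dcutoff d y = 0.
  move=> ny; apply: cutoff_out => //.
  have [yd|dy] := leP y d; [by left|right]; rewrite leNgt; apply/negP => yd.
  by apply: ny; rewrite /= in_itv/=; apply/andP; split; lra.
(* [cutoff] is carried by the test function: [bridge] alone does not vanish for small y, the product
   does. *)
pose phi (z : R * R) := (bridge N c e z.2 * cutoff d z.2) * plateau N a b z.1.
have cphi : C1c Upsilon phi.
  apply: (C1c_closed_in (K := square d)).
  - exact: (C1_mul (C1_snd CY) (C1_fst CX)).
  - exact: compact_square.
  - exact: square_Upsilon.
  move=> [x y] nz; rewrite /phi/=; have [xI|xI] := pselect (`[d, 1 - d]%classic x).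
    by have [|-> _] := Yout y; [move=> yI; exact: nz|rewrite mulr0 mul0r].
  by rewrite Xout// mulr0.
have Dphi z : 'D_((0, 1) : R * R) phi z =
    (dbridge N c e z.2 * cutoff d z.2 + bridge N c e z.2 * dcutoff d z.2) * plateau N a b z.1.
  exact: (derive_y_tensor z CX CY).
have [Bb HBb] := bridge_bounded N0 ce.
pose psi (z : R * R) := bridge N c e z.2 * plateau N a b z.1.
pose dpsi (z : R * R) := dbridge N c e z.2 * plateau N a b z.1.
have mpsi : measurable_fun (setT : set (plane R)) psi.
  by apply: measurable_funM; [exact: measurable_snd_comp|exact: measurable_fst_comp].
have mdpsi : measurable_fun (setT : set (plane R)) dpsi.
  by apply: measurable_funM; [exact: measurable_snd_comp|exact: measurable_fst_comp].
have Bb0 : 0 <= Bb by apply: le_trans (HBb 0).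
pose C := Bb + 1.
have psiC z : `|psi z| <= C.
  rewrite normrM (@le_trans _ _ (Bb * 1))//; last by rewrite /C; lra.
  by rewrite ler_pM// plateau_bound.
pose M := `|c| + `|e| + N^-1.
have iN0 : 0 < N^-1 by rewrite invr_gt0.
have dpsi1 z : `|dpsi z| <= 1.
  by rewrite normrM mulr_ile1// ?dbridge_bound// plateau_bound.
have [nc ne] : - `|c| <= c /\ e <= `|e| by rewrite lerNl ler_norm -normrN ler_norm.
have dpsiC x y : `|dpsi (x, y)| <= C * \1_`[-M, M] y.
  rewrite indicE; have [yI|yI] := pselect (`[-M, M]%classic y).
    by rewrite mem_set// mulr1 (le_trans (dpsi1 _))// /C; lra.
  rewrite memNset// mulr0 /dpsi/= dbridge_out ?mul0r ?normr0//.
  have [yc|cy] := leP y c; [by left|right]; rewrite leNgt; apply/negP => ye.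
  apply: yI; rewrite /= in_itv/= /M; have := normr_ge0 c; have := normr_ge0 e.
  by move=> ? ?; apply/andP; split; lra.
have by_parts : \int[leb2]_z (vint cut_dy z * dpsi z) = - \int[leb2]_z (cut_dy z * psi z).
  apply: (vint_by_parts (M := M) (C := C) cut_dy_integrable) => //.
  - move=> x; have := C1_with_lin (plateau N a b x) 0 CB CB.
    by congr C1_with; apply/funext => y; rewrite /psi /dpsi/=; ring.
  - move=> x y My; rewrite /psi/= bridge_out ?mul0r//.
    by apply: le_trans (ltW My); rewrite /M; have := normr_ge0 c; lra.
have iuD := C1c_integrable_dy measurable_Upsilon lu cphi.
have iGp := C1c_integrable measurable_Upsilon lG cphi.
have i1 : leb2.-integrable (setT : set (plane R)) (EFin \o (fun z => cut_u z * dpsi z)).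
  exact: (integrable_mul_bounded (C := 1) _ cut_u_integrable).
have i2 : leb2.-integrable (setT : set (plane R)) (EFin \o (fun z => cut_dy z * psi z)).
  exact: (integrable_mul_bounded (C := C) _ cut_dy_integrable).
have i3 : leb2.-integrable (setT : set (plane R)) (EFin \o (fun z => vint cut_dy z * dpsi z)).
  exact: (integrable_vint_mul cut_dy_integrable mdpsi dpsiC).
have sum0 : \int[leb2]_z (cut_u z * dpsi z) + \int[leb2]_z (cut_dy z * psi z) = 0.
  rewrite -RintegralD//.
  transitivity (\int[leb2]_(z in Upsilon) (u z * 'D_((0, 1) : R * R) phi z + G z * phi z)).
    rewrite [RHS]Rintegral_supp; last first.
      by move=> z /(C1c_supp cphi)[-> ->]; rewrite !mulr0 addr0.
    apply: eq_Rintegral => -[x y] _; rewrite Dphi /phi /cut_u /cut_dy /psi /dpsi !patchE/=.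
    case: ifPn => [_|]; first ring.
    rewrite notin_setE => nz; rewrite -[point]/(0 : R).
    have [xI|xI] := pselect (`[d, 1 - d]%classic x).
      by have [|-> ->] := Yout y; [move=> yI; exact: nz|ring].
    by rewrite Xout//; ring.
  by rewrite RintegralD//; [rewrite wuG// addNr|exact: measurable_Upsilon].
rewrite (_ : (fun z => _) = (fun z => cut_u z * dpsi z - vint cut_dy z * dpsi z)); last first.
  by apply/funext => z; rewrite /dpsi; ring.
by rewrite RintegralB// by_parts opprK.
Qed.

End test.
End primitive.

Section primitive_ae.
Context {R : realType}.
Variables (u G : R * R -> R) (d : R).
Hypotheses (d0 : 0 < d) (d1 : 4 * d < 1) (uG : weak_dy Upsilon u G).

Let F0 z := cut_u u d z - vint (cut_dy u G d) z.

Lemma integral_EFin_Rintegral d' (T : measurableType d') (mu : {measure set T -> \bar R})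
    (D : set T) (f : T -> R) : measurable D -> mu.-integrable D (EFin \o f) ->
  (\int[mu]_(x in D) (f x)%:E)%E = (\int[mu]_(x in D) f x)%:E.
Proof. by move=> mD fi; rewrite /Rintegral fineK//; exact: (integrable_fin_num mD fi). Qed.

Lemma integrable_defect (b : R * R -> R) (M : R) : measurable_fun (setT : set (plane R)) b ->
  (forall x y, `|b (x, y)| <= 1 * \1_`[-M, M] y) ->
  leb2.-integrable (setT : set (plane R)) (EFin \o (fun z => F0 z * b z)).
Proof.
move=> mb bM.
have bM1 z : `|b z| <= 1.
  case: z => x y; apply: le_trans (bM x y) _.
  by rewrite mul1r indicE; case: (_ \in _).
have i1 : leb2.-integrable (setT : set (plane R)) (EFin \o (fun z => cut_u u d z * b z)).
  exact: (integrable_mul_bounded (C := 1) _ (cut_u_integrable d0 uG)).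
have i2 := integrable_vint_mul (cut_dy_integrable d0 uG) mb bM.
rewrite (_ : (fun z => _) = (fun z => cut_u u d z * b z - vint (cut_dy u G d) z * b z)).
  exact: integrableB_real.
by apply/funext => z; rewrite /F0; ring.
Qed.

(** Limit of [test_bridge] for steeper and steeper slopes. The majorant contains the indicator of
    [[-M, M]] because [vint] need not decay for large y. *)
Lemma defect_rect (a b c e : R) : d <= a -> b <= 1 - 2 * d ->
  (\int[leb2]_z (F0 z * \1_(`]a, b] `*` `]c, e] : set (plane R)) z)%:E = 0)%E.
Proof.
move=> da bd; have [ab|/ltW ba] := leP a b; last first.
  rewrite integral0_eq// => -[x y] _; rewrite indicE memNset ?mulr0// => -[/=].
  by rewrite in_itv/= => /andP[ax xb]; lra.
have [ce|/ltW ec] := leP c e; last first.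
  rewrite integral0_eq// => -[x y] _; rewrite indicE memNset ?mulr0// => -[_ /=].
  by rewrite in_itv/= => /andP[ax xb]; lra.
(* The factor [1 / d] provides [d^-1 <= N n] from [n = 0] on. *)
pose N (n : nat) : R := n.+1%:R / d.
have N0 n : 0 < N n by rewrite divr_gt0.
have dN n : d^-1 <= N n by rewrite /N ler_peMl ?invr_ge0 ?ler1n// ltW.
have Noo : N n @[n --> \oo] --> +oo.
  apply/cvgryPge => A; near=> n; rewrite /N ler_pdivlMr//.
  rewrite (@le_trans _ _ n%:R)// ?ler_nat//; near: n; exact: nbhs_infty_ger.
have Ninv n : (N n)^-1 <= 1.
  by rewrite invf_le1// (le_trans _ (dN n))// invf_ge1//; lra.
pose M := `|c| + `|e| + 1.
have nc : - `|c| <= c by rewrite lerNl -normrN ler_norm.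
have ne : e <= `|e| by rewrite ler_norm.
have nc0 := normr_ge0 c; have ne0 := normr_ge0 e.
have ndE n y : `|dbridge (N n) c e y| <= 1 * \1_`[-M, M] y.
  rewrite mul1r indicE; have [yI|yI] := pselect (`[-M, M]%classic y).
    by rewrite mem_set// dbridge_bound.
  rewrite memNset// dbridge_out ?normr0//.
  have [yc|cy] := leP y c; [by left|right]; rewrite leNgt; apply/negP => ye.
  by apply: yI; rewrite /= in_itv/= /M; have ? := Ninv n; apply/andP; split; lra.
pose t n (z : R * R) := dbridge (N n) c e z.2 * plateau (N n) a b z.1.
have mt n : measurable_fun (setT : set (plane R)) (t n).
  apply: measurable_funM.
    by apply: measurable_snd_comp; case: (C1_bridge c e (N0 n)).
  by apply: measurable_fst_comp; exact: C1_with_continuous (C1_plateau (N n) a b).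
have tM n x y : `|t n (x, y)| <= 1 * \1_`[-M, M] y.
  rewrite normrM /= -[leRHS]mulr1 ler_pM//.
  exact: plateau_bound.
have ii := @integrable_defect (fun z => \1_`[-M, M] z.2) M.
have iF : leb2.-integrable (setT : set (plane R)) (EFin \o (fun z => F0 z * \1_`[-M, M] z.2)).
  apply: ii; last by move=> x y; rewrite /= mul1r ger0_norm// indicE.
  have mI : measurable_fun setT (\1_`[-M, M] : R -> R).
    by apply: measurable_indic; exact: measurable_itv.
  exact: (measurableT_comp mI).
have rect01 z : (\1_(`]a, b] `*` `]c, e] : set (plane R)) z : R) = \1_`]c, e] z.2 * \1_`]a, b] z.1.
  case: z => x y; rewrite !indicE in_setX/=.
  by case: (x \in _); case: (y \in _); rewrite /= ?mulr1 ?mulr0 ?mul0r.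
have := @dominated_convergence _ _ _ leb2 setT measurableT
  (fun n z => (F0 z * t n z)%:E)
  (fun z => (F0 z * \1_(`]a, b] `*` `]c, e] : set (plane R)) z)%:E)
  (fun z => `|(F0 z * \1_`[-M, M] z.2)%:E|%E) _ _ _ (integrable_abse iF) _.
case.
- by move=> n; exact: measurable_int (integrable_defect (mt n) (tM n)).
- apply: measurable_int (integrable_defect (M := M) _ _).
    by apply: measurable_indic; apply: measurableX; exact: measurable_itv.
  have ind1 (A : set R) (x : R) : `|\1_A x : R| <= 1.
    by rewrite indicE; case: (_ \in _); rewrite ?normr1 ?normr0.
  move=> x y; rewrite rect01 /= mul1r; have [yI|yI] := pselect (`]c, e]%classic y).
    rewrite [leRHS]indicE mem_set ?normrM ?mulr_ile1//.
    by move: yI; rewrite /= !in_itv/= /M => /andP[? ?]; apply/andP; split; lra.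
  by rewrite indicE memNset// mul0r normr0 indicE.
- apply: aeW => -[x y] _; apply: cvg_EFin; first exact: nearW.
  apply: cvgM; first exact: cvg_cst.
  rewrite rect01; apply: cvgM => /=.
    exact: (ramp_like_cvg (y := y) N0 Noo (@ramp0 R) (@ramp1 R) ce).
  exact: (ramp_like_cvg (y := x) N0 Noo (@kappa0 R) (@kappa1 R) ab).
- apply: aeW => -[x y] n _; rewrite /= lee_fin !(normrM (F0 _)) ler_wpM2l//.
  by apply: le_trans (tM n x y) _; rewrite mul1r ler_norm.
move=> _ _ cv; rewrite -(cvg_lim (@ereal_hausdorff R) cv).
rewrite (_ : (fun _ => _) = cst 0%E); first exact: lim_cst.
apply/funext => n /=; rewrite integral_EFin_Rintegral//; last exact: integrable_defect (mt n) (tM n).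
by rewrite (test_bridge d0 uG (dN n) da ab bd ce).
Unshelve. all: by end_near. Qed.

(** The window ends at [1 - 2 * d], not at [1 - d], which leaves room for the right slope of
    [plateau]. *)
Lemma cutoff_primitive : {ae leb2, forall z : plane R,
  (`]d, 1 - 2 * d] `*` `]0, 1]) z -> cut_u u d z = vint (cut_dy u G d) z}.
Proof.
pose W : set (plane R) := `]d, 1 - 2 * d] `*` `]0, 1].
have mW : measurable W by apply: measurableX; exact: measurable_itv.
pose F z := F0 z * \1_W z.
have iF : leb2.-integrable (setT : set (plane R)) (EFin \o F).
  apply: (integrable_defect (M := 1)); first exact: measurable_indic.
  move=> x y; rewrite mul1r !indicE in_setX/=; have [yI|yI] := boolP (y \in `]0, 1]%classic).
    rewrite (mem_set (A := `[-1, 1]%classic)) ?andbT.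
      by case: (_ \in _); rewrite ?normr1 ?normr0.
    by move: yI; rewrite inE/= !in_itv/= => /andP[? ?]; apply/andP; split; lra.
  by rewrite andbF normr0.
have rectW (a b c e : R) :
    (\int[leb2]_(z in (`]a, b] `*` `]c, e] : set (plane R))) (F z)%:E = 0)%E.
  (* The maxima and minima intersect the rectangle with the window, which is again a rectangle. *)
  have := @defect_rect (Num.max a d) (Num.min b (1 - 2 * d)) (Num.max c 0) (Num.min e 1).
  rewrite le_max lexx orbT ge_min lexx orbT => /(_ isT isT) <-.
  rewrite integral_mkcond; apply: eq_integral => -[x y] _; rewrite patchE /F.
  have E : (x, y) \in (`]Num.max a d, Num.min b (1 - 2 * d)] `*` `]Num.max c 0, Num.min e 1] : set (plane R)) =
     ((x, y) \in (`]a, b] `*` `]c, e] : set (plane R))) && ((x, y) \in W).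
    apply/idP/andP; rewrite !inE/= /W/= !in_itv/= !gt_max !le_min.
      by move=> [/andP[/andP[-> ->] /andP[-> ->]] /andP[/andP[-> ->] /andP[-> ->]]].
    by move=> [[/andP[-> ->] /andP[-> ->]] [/andP[-> ->] /andP[-> ->]]].
  by rewrite !indicE E; case: (_ \in _) => //=; rewrite mulr0.
have FT : (\int[leb2]_(z in (setT : set (plane R))) (F z)%:E = 0)%E.
  rewrite -(rectW d (1 - 2 * d) 0 1) [RHS]integral_mkcond; apply: eq_integral => z _.
  rewrite patchE /F indicE -/W; case: (_ \in _) => //; last by rewrite mulr0.
have := ae_eq0_rectangles iF FT rectW; apply: filterS => z Fz Wz; apply/eqP; rewrite -subr_eq0.
by move: Fz; rewrite /F indicE mem_set// mulr1 => /eqP.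
Qed.

End primitive_ae.

(** * Cutting off and truncating *)

Section slices.
Context {R : realType}.
Local Notation leb := (@lebesgue_measure R).

(* From [2 m |f| <= f^2 + m^2 1_S] with [m = A / s]. *)
Lemma slice_cauchy_schwarz (f : R -> R) (S : set R) (s A : R) :
  measurable_fun setT f -> measurable (S : set (measurableTypeR R)) ->
  0 < s -> (leb S <= s%:E)%E ->
  (forall t, ~ S t -> f t = 0) -> (\int[leb]_t `|f t|%:E = A%:E)%E ->
  ((A ^+ 2)%:E <= s%:E * \int[leb]_t (f t ^+ 2)%:E)%E.
Proof.
move=> mf mS s0 Ss fS fA.
have A0 : 0 <= A by rewrite -lee_fin -fA integral_ge0.
pose m := A / s.
have m0 : 0 <= m by rewrite divr_ge0// ltW.
have mf2 : measurable_fun setT (fun t => (f t ^+ 2)%:E).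
  by apply/measurable_EFinP; exact: measurable_funX.
have mI : measurable_fun setT (fun t => (m ^+ 2 * \1_S t)%:E).
  by apply/measurable_EFinP; apply: measurable_funM => //; exact: measurable_indic.
have key : ((2 * m * A)%:E <= \int[leb]_t (f t ^+ 2)%:E + (m ^+ 2 * s)%:E)%E.
  have -> : ((2 * m * A)%:E = \int[leb]_t ((2 * m)%:E * `|f t|%:E))%E.
    rewrite ge0_integralZl//; first by rewrite fA -EFinM.
      by apply/measurable_EFinP; exact: measurableT_comp.
    by rewrite lee_fin mulr_ge0.
  apply: (@le_trans _ _ (\int[leb]_t ((f t ^+ 2)%:E + (m ^+ 2 * \1_S t)%:E))%E).
    apply: ge0_le_integral => //.
    - by move=> t _; rewrite mule_ge0// lee_fin mulr_ge0.
    - by apply: emeasurable_funM => //; apply/measurable_EFinP; exact: measurableT_comp.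
    - exact: emeasurable_funD.
    move=> t _; rewrite -EFinM -EFinD lee_fin.
    have [St|nSt] := pselect (S t).
      rewrite indicE mem_set// mulr1 -[f t ^+ 2]real_normK ?num_real//.
      by have := sqr_ge0 (`|f t| - m); nra.
    by rewrite fS// normr0 mulr0 expr0n add0r mulr_ge0// ?sqr_ge0// indicE.
  rewrite ge0_integralD//; last 2 first.
  - by move=> t _; rewrite lee_fin sqr_ge0.
  - by move=> t _; rewrite lee_fin mulr_ge0// ?sqr_ge0// indicE.
  apply: leeD => //; under eq_integral do rewrite EFinM.
  rewrite ge0_integralZl//; last 2 first.
  - by apply/measurable_EFinP; exact: measurable_indic.
  - by rewrite lee_fin sqr_ge0.
  by rewrite integral_indic// setIT [leRHS]EFinM; apply: lee_wpmul2l => //; rewrite lee_fin sqr_ge0.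
have f20 : (0 <= \int[leb]_t (f t ^+ 2)%:E)%E.
  by apply: integral_ge0 => t _; rewrite lee_fin sqr_ge0.
move: key f20; case: (integral _ _ _) => [B| |]//=.
- rewrite -EFinD -EFinM !lee_fin => key B0.
  have sm : s * m = A by rewrite /m mulrC divfK// gt_eqF.
  have := ler_wpM2l (ltW s0) key; rewrite mulrDr.
  have -> : s * (2 * m * A) = 2 * A ^+ 2 by rewrite -sm; ring.
  have -> : s * (m ^+ 2 * s) = A ^+ 2 by rewrite -sm; ring.
  lra.
- by move=> _ _; rewrite gt0_muley ?leey// lte_fin.
Qed.

Lemma ae_fst (P : set R) : {ae leb, forall x, P x} ->
  {ae leb2, forall z : plane R, P z.1}.
Proof.
move=> [N [mN N0 PN]]; exists (N `*` setT); split.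
- exact: measurableX.
- by rewrite /leb2 product_measure1E// [X in (X * _)%E]N0 mul0e.
- by move=> [x y] nP; split => //; exact: PN.
Qed.

Lemma measurable_slice_abs (h : R * R -> R) : measurable_fun (setT : set (plane R)) h ->
  measurable_fun setT (fun x => \int[leb]_t `|h (x, t)|%:E)%E.
Proof.
move=> mh; have mah : measurable_fun setT (fun q : plane R => `|h q|%:E).
  by apply/measurable_EFinP; exact: measurableT_comp.
exact: (measurable_param_integral leb mah).
Qed.

Lemma slice_integrable (h : R * R -> R) x : measurable_fun (setT : set (plane R)) h ->
  (\int[leb]_t `|h (x, t)|%:E < +oo)%E -> leb.-integrable setT (EFin \o (fun t => h (x, t))).
Proof.
move=> mh hx; apply/integrableP; split => //.
by apply/measurable_EFinP; exact: measurable_slice.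
Qed.

Lemma slice_step_integrable (h : R * R -> R) x y :
  leb.-integrable setT (EFin \o (fun t => h (x, t))) ->
  leb.-integrable setT (EFin \o (fun t => h (x, t) * step t y)).
Proof.
move=> ih; apply: (integrable_mul_bounded (C := 1) _ ih) => //.
  exact: measurable_stepl.
by move=> t _; have /andP[s0 s1] := step_bounds t y; rewrite ger0_norm.
Qed.

(** Large values are replaced by 0 instead of being clipped, so [keep k h] is [h] times a factor 0
    or 1. *)
Definition keep (k : R) (h : R * R -> R) : R * R -> R := fun z => h z * (`|h z| <= k)%R%:R.

Lemma measurable_keep k h : measurable_fun (setT : set (plane R)) h ->
  measurable_fun (setT : set (plane R)) (keep k h).
Proof.
move=> mh; apply: measurable_funM => //.
rewrite (_ : (fun z => _) = \1_((fun z => `|h z|) @^-1` `]-oo, k])); last first.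
  apply/funext => z; rewrite indicE; congr (nat_of_bool _)%:R.
  by apply/idP/idP; rewrite inE/= in_itv.
apply: measurable_indic; rewrite -[_ @^-1` _]setTI.
have mnh : measurable_fun (setT : set (plane R)) (fun z => `|h z|) by exact: measurableT_comp.
by apply: mnh => //; exact: measurable_itv.
Qed.

Lemma keep_le k h z : `|keep k h z| <= `|h z|.
Proof. by rewrite /keep; case: (_ <= k); rewrite ?mulr1 ?mulr0 ?normr0. Qed.

Lemma keep_bound k h z : 0 <= k -> `|keep k h z| <= k.
Proof. by move=> k0; rewrite /keep; have [hk|_] := boolP (`|h z| <= k); rewrite ?mulr1 ?mulr0 ?normr0. Qed.

Lemma drop_le k h z : `|h z - keep k h z| <= `|h z|.
Proof.
by rewrite /keep; case: (_ <= k); rewrite ?mulr1 ?mulr0 ?subr0 ?subrr ?normr0.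
Qed.

(** Dominated by [|h|]; at each point nothing is dropped any more once [k] exceeds the value
    there. *)
Lemma drop_cvg (h : R * R -> R) x : measurable_fun (setT : set (plane R)) h ->
  (\int[leb]_t `|h (x, t)|%:E < +oo)%E ->
  (\int[leb]_t `|h (x, t) - keep k%:R h (x, t)|%:E @[k --> \oo] --> 0)%E.
Proof.
move=> mh hx; have ih := slice_integrable mh hx.
have mk k : measurable_fun setT (fun t => `|h (x, t) - keep k h (x, t)|%:E).
  apply/measurable_EFinP; apply: measurableT_comp => //.
  apply: measurable_funB; first exact: measurable_slice.
  exact: (measurable_slice x (measurable_keep k mh)).
have := @dominated_convergence _ _ _ leb setT measurableT
  (fun (k : nat) t => `|h (x, t) - keep k%:R h (x, t)|%:E) (cst 0%E)
  (fun t => `|(h (x, t))%:E|%E) _ _ _ (integrable_abse ih) _.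
case.
- by move=> k; exact: mk.
- exact: measurable_cst.
- apply: aeW => t _; apply: cvg_near_cst; near=> k.
  rewrite /keep (_ : `|h (x, t)| <= k%:R) ?mulr1 ?subrr ?normr0//.
  have le1 : `|h (x, t)| <= (Num.bound `|h (x, t)|)%:R by rewrite ltW// archi_boundP.
  by apply: le_trans le1 _; rewrite ler_nat; near: k; exact: nbhs_infty_ge.
- by apply: aeW => t k _; rewrite /= lee_fin normr_id drop_le.
by move=> _ _; rewrite integral0.
Unshelve. all: by end_near. Qed.

End slices.

(** * The truncated derivative and its primitive *)

Section truncation.
Context {R : realType}.
Local Notation leb := (@lebesgue_measure R).
Variables (u G : R * R -> R) (d : R).
Hypotheses (d0 : 0 < d) (d1 : 4 * d < 1) (uG : weak_dy Upsilon u G).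

(** The two Leibniz terms of [cut_dy]: [flux] carries the weak derivative, [leak] the derivative of
    the cutoff, which lives on the rows d < y < 2 d and 1 - 2 d < y < 1 - d. *)
Definition flux : R * R -> R := (fun z => cutoff d z.2 * G z) \_ (square d).
Definition leak : R * R -> R := (fun z => dcutoff d z.2 * u z) \_ (square d).

Lemma measurable_flux : measurable_fun (setT : set (plane R)) flux.
Proof.
have [_ lG _] := uG; have [iG _] := cut_integrable d0 lG.
by apply/measurable_EFinP; exact: measurable_int iG.
Qed.

Lemma measurable_leak : measurable_fun (setT : set (plane R)) leak.
Proof.
have [lu _ _] := uG; have [_ iu] := cut_integrable d0 lu.
by apply/measurable_EFinP; exact: measurable_int iu.
Qed.

Lemma leak_mid x t : 2 * d <= t <= 1 - 2 * d -> leak (x, t) = 0.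
Proof.
move=> td; rewrite /leak patchE; case: ifP => // _ /=.
by have [_ ->] := cutoff_in d0 td; rewrite mul0r.
Qed.

Definition slice_mass (h : R * R -> R) (x : R) : \bar R := (\int[leb]_t `|h (x, t)|%:E)%E.

(** The mass bounds make the truncated derivative bounded by a multiple of [k]; the last condition
    makes the truncation of the flux change the primitive by at most [e]. For fixed [e > 0], almost
    every abscissa of the interval is good for all large integers [k]. *)
Definition good_abscissae (k e : R) : set (measurableTypeR R) :=
  `]d, 1 - 2 * d] `&` ([set x | slice_mass flux x <= k%:E]%E `&`
    ([set x | slice_mass leak x <= k%:E]%E `&`
     [set x | slice_mass (fun z => flux z - keep k flux z)%R x <= e%:E]%E)).

Lemma measurable_slice_mass_le h (c : R) : measurable_fun (setT : set (plane R)) h ->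
  measurable ([set x | slice_mass h x <= c%:E]%E : set (measurableTypeR R)).
Proof.
move=> mh; have mm := measurable_slice_abs mh.
by rewrite -[X in measurable X]setTI; exact: emeasurable_fun_infty_c.
Qed.

Lemma measurable_drop k : measurable_fun (setT : set (plane R)) (fun z => flux z - keep k flux z).
Proof.
by apply: measurable_funB; [exact: measurable_flux|apply: measurable_keep; exact: measurable_flux].
Qed.

Lemma measurable_good k e : measurable (good_abscissae k e).
Proof.
apply: measurableI; first exact: measurable_itv.
apply: measurableI; first by apply: measurable_slice_mass_le; exact: measurable_flux.
apply: measurableI; first by apply: measurable_slice_mass_le; exact: measurable_leak.
by apply: measurable_slice_mass_le; exact: measurable_drop.
Qed.

(* The datum of the primitive on the bottom edge is stored as its derivative on
   the strip -1 < t <= 0. *)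
Definition truncated (k e : R) (z : R * R) : R :=
  \1_(good_abscissae k e) z.1 * (\1_`]-oo, 0] z.2 * vint leak (z.1, 2^-1) + keep k flux z).

(** On a good line the datum is at most the mass of the leak, hence at most [k], and the kept flux
    is at most [k]. *)
Lemma truncated_bounded k e : 0 <= k -> bounded_on_strip (k + k) (truncated k e).
Proof.
move=> k0; split.
  apply: measurable_funM.
    have mg : measurable_fun setT (\1_(good_abscissae k e) : R -> R).
      by apply: measurable_indic; exact: measurable_good.
    exact: (measurableT_comp mg).
  apply: measurable_funD; last by apply: measurable_keep; exact: measurable_flux.
  apply: measurable_funM.
    have mI : measurable_fun setT (\1_`]-oo, 0] : R -> R).
      by apply: measurable_indic; exact: measurable_itv.
    exact: (measurableT_comp mI).
  apply: (measurableT_comp (measurable_vint measurable_leak)).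
  exact: measurable_fun_pair.
move=> [x t] _; rewrite /truncated/=.
have [gx|ngx] := pselect (good_abscissae k e x); last first.
  by rewrite indicE memNset// mul0r normr0 addr_ge0.
rewrite indicE mem_set// mul1r; apply: le_trans (ler_normD _ _) _; apply: lerD.
  rewrite normrM (@le_trans _ _ `|vint leak (x, 2^-1)|)//.
    by rewrite ler_piMl// indicE; case: (_ \in _); rewrite ?normr1 ?normr0.
  rewrite -lee_fin; apply: le_trans (vint_le _ _ measurable_leak) _.
  by case: gx => _ [_ []].
exact: keep_bound.
Qed.

Lemma good_integrable k e x : good_abscissae k e x ->
  [/\ leb.-integrable setT (EFin \o (fun t => flux (x, t))),
      leb.-integrable setT (EFin \o (fun t => leak (x, t))) &
      leb.-integrable setT (EFin \o (fun t => keep k flux (x, t)))].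
Proof.
move=> [_ [Jf [Jl _]]]; have mf := measurable_flux; have mk := measurable_keep k mf.
split; apply: slice_integrable => //.
- exact: le_lt_trans Jf (ltry _).
- exact: measurable_leak.
- exact: le_lt_trans Jl (ltry _).
apply: le_lt_trans (ltry k); apply: le_trans Jf; apply: ge0_le_integral => //.
- by apply/measurable_EFinP; apply: measurableT_comp => //; exact: (measurable_slice x mk).
- by apply/measurable_EFinP; apply: measurableT_comp => //; exact: (measurable_slice x mf).
- by move=> t _; rewrite lee_fin keep_le.
Qed.

(** The stored datum occupies []-1, 0]], an interval of length 1 lying below every y > 0, so
    integration returns it unchanged. *)
Lemma vint_truncated_good k e x y : good_abscissae k e x -> Upsilon (x, y) ->
  vint (truncated k e \_ strip) (x, y) = vint leak (x, 2^-1) + vint (keep k flux) (x, y).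
Proof.
have dgt : -1 < d by rewrite (lt_trans _ d0)// ltrN10.
have dle : 1 - d <= 1 by rewrite lerBlDr lerDl ltW.
move=> gx [/= xI]; rewrite in_itv/= => /andP[y0 y1].
have [_ _ ik] := good_integrable gx; have iks := slice_step_integrable y ik.
set H := vint leak (x, 2^-1).
transitivity (\int[leb]_t (H * \1_`]-1, 0] t + keep k flux (x, t) * step t y)).
  apply: eq_Rintegral => t _; rewrite patchE.
  have [st|nst] := boolP ((x, t) \in strip).
    rewrite /truncated/= [\1_(good_abscissae k e) x]indicE mem_set// mul1r -/H.
    move: st; rewrite inE /strip/= => -[_ /=]; rewrite in_itv/= => /andP[t1 t2].
    rewrite mulrDl; congr (_ + _); rewrite !indicE.
    have [t0|t0] := leP t 0.
      rewrite !mem_set/=; [|by rewrite in_itv/= t1|by rewrite in_itv/=].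
      by rewrite /step (le_lt_trans t0)// mul1r !mulr1.
    by rewrite !memNset/= ?in_itv/= ?mul0r ?mulr0//; [move=> /andP[_]|]; rewrite leNgt t0.
  rewrite -[point]/(0 : R) mul0r indicE memNset; last first.
    move=> /= tI; move: nst; rewrite notin_setE; apply; split => //=.
    by move: tI; rewrite !in_itv/= => /andP[-> t0]; rewrite (le_trans t0).
  rewrite mulr0 add0r /keep /flux patchE memNset ?mul0r//= => -[_ /=].
  rewrite in_itv/= => /andP[dt td]; move: nst; rewrite notin_setE; apply; split => //=.
  by rewrite in_itv/= (lt_le_trans _ dt)/= ?(le_trans td).
rewrite RintegralD//; last first.
  by apply: integrableZ_real => //; exact: integrable_indic_itv.
congr (_ + _); rewrite RintegralZl//; last exact: integrable_indic_itv.
rewrite /Rintegral integral_indic//.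
rewrite setIT [X in fine X]lebesgue_measure_itv/= lte_fin ifT; last exact: ltrN10.
by rewrite -EFinB/=; ring.
Qed.

Lemma vint_truncated_bad k e x y : ~ good_abscissae k e x ->
  vint (truncated k e \_ strip) (x, y) = 0.
Proof.
move=> ngx; rewrite /vint/= (_ : (fun t => _) = cst 0).
  by rewrite /Rintegral integral0.
apply/funext => t; rewrite patchE; case: ifP => _; last by rewrite -[point]/(0 : R) mul0r.
by rewrite /truncated/= indicE memNset// !mul0r.
Qed.

(** Height 1/2 lies between the two rows since [4 * d < 1], and the leak vanishes between them. The
    value at 1/2 is thus the integral of the leak over the lower row; there [dcutoff] is nonnegative
    with integral 1, so it is a weighted average of [u]. At other heights the difference is bounded
    by the whole mass. *)
Lemma vint_leak_diff k e x y : good_abscissae k e x -> Upsilon (x, y) ->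
  (2 * d <= y <= 1 - 2 * d -> vint leak (x, y) - vint leak (x, 2^-1) = 0) /\
  (`|vint leak (x, y) - vint leak (x, 2^-1)|%:E <= slice_mass leak x)%E.
Proof.
have d2 : 2 * d < 2^-1 by move: (d1); lra.
have d3 : 2^-1 <= 1 - 2 * d by move: (d1); lra.
move=> gx _; have [_ il _] := good_integrable gx.
have i1 := slice_step_integrable y il; have i2 := slice_step_integrable 2^-1 il.
rewrite /vint/= -RintegralB//.
have E : (fun t => leak (x, t) * step t y - leak (x, t) * step t 2^-1) =
    (fun t => leak (x, t) * (step t y - step t 2^-1)) by apply/funext => t; ring.
rewrite E; split.
  move=> /andP[yd dy]; rewrite (_ : (fun t => _) = cst 0); first by rewrite /Rintegral integral0.
  apply/funext => t; have [td|dt] := ltP t (2 * d).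
    have -> : step t y = 1 by rewrite /step (lt_le_trans td yd).
    have -> : step t 2^-1 = 1 by rewrite /step (lt_trans td d2).
    by rewrite subrr mulr0.
  have [td'|dt'] := leP t (1 - 2 * d); first by rewrite leak_mid ?mul0r// dt td'.
  have -> : step t y = 0 by rewrite /step ltNge ltW// (le_lt_trans dy).
  have -> : step t 2^-1 = 0 by rewrite /step ltNge ltW// (le_lt_trans d3).
  by rewrite subrr mulr0.
have i3 : leb.-integrable setT (EFin \o (fun t => leak (x, t) * (step t y - step t 2^-1))).
  by rewrite -E; exact: integrableB_real.
apply: (@le_trans _ _ (\int[leb]_t `|(leak (x, t) * (step t y - step t 2^-1))%:E|)%E).
  rewrite EFin_normr_Rintegral//; apply: le_abse_integral => //.
  exact: measurable_int i3.
apply: ge0_le_integral => //.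
- by apply: measurableT_comp => //; exact: measurable_int i3.
- apply/measurable_EFinP; apply: measurableT_comp => //.
  exact: (measurable_slice x measurable_leak).
move=> t _; rewrite /= lee_fin normrM ler_piMr//.
have /andP[? ?] := step_bounds t y; have /andP[? ?] := step_bounds t 2^-1.
by rewrite ler_norml; lra.
Qed.

Lemma vint_drop k e x y : good_abscissae k e x ->
  `|vint flux (x, y) - vint (keep k flux) (x, y)| <= e.
Proof.
move=> gx; have [i1 _ i2] := good_integrable gx.
have s1 := slice_step_integrable y i1; have s2 := slice_step_integrable y i2.
have -> : vint flux (x, y) - vint (keep k flux) (x, y) = vint (fun z => flux z - keep k flux z) (x, y).
  rewrite /vint/= -RintegralB//; apply: eq_Rintegral => t _; ring.
rewrite -lee_fin; apply: le_trans (vint_le _ _ (measurable_drop k)) _.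
by case: gx => _ [_ []].
Qed.

Lemma vint_cut_dy k e x y : good_abscissae k e x ->
  vint (cut_dy u G d) (x, y) = vint flux (x, y) + vint leak (x, y).
Proof.
move=> gx; have [i1 i2 _] := good_integrable gx.
have s1 := slice_step_integrable y i1; have s2 := slice_step_integrable y i2.
rewrite /vint/= -RintegralD//; apply: eq_Rintegral => t _.
by rewrite cut_dyE -/flux -/leak mulrDl.
Qed.

End truncation.

Lemma sqr_le_norm (R : realType) (a b : R) : `|a| <= b -> a ^+ 2 <= b ^+ 2.
Proof.
by move=> ab; rewrite -[leLHS]real_normK ?num_real//; have := normr_ge0 a; nra.
Qed.

(** * Pointwise truncation error *)

Section truncation_error.
Context {R : realType}.
Local Notation leb := (@lebesgue_measure R).
Variables (u G v : R * R -> R) (d : R).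
Hypotheses (d0 : 0 < d) (d1 : 4 * d < 1) (uG : weak_dy Upsilon u G).

Definition energy (z : R * R) : R := u z ^+ 2 + (v z * G z) ^+ 2.

Hypothesis ie : leb2.-integrable (Upsilon : set (plane R)) (EFin \o energy).

Definition inner : set (plane R) := `]d, 1 - 2 * d] `*` `[2 * d, 1 - 2 * d].

Lemma measurable_inner : measurable inner.
Proof. by apply: measurableX; exact: measurable_itv. Qed.

Definition outer_energy : R * R -> R := (fun z => energy z * \1_(~` inner) z) \_ Upsilon.

Lemma energy_ge0 z : 0 <= energy z.
Proof. by rewrite addr_ge0// sqr_ge0. Qed.

Lemma outer_energy_ge0 z : 0 <= outer_energy z.
Proof.
by rewrite /outer_energy patchE; case: ifP => // _; rewrite mulr_ge0 ?energy_ge0// indicE.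
Qed.

Lemma measurable_energy : measurable_fun (Upsilon : set (plane R)) energy.
Proof. by apply/measurable_EFinP; exact: measurable_int ie. Qed.

Lemma measurable_outer_energy : measurable_fun (setT : set (plane R)) outer_energy.
Proof.
apply/(measurable_restrictT _ measurable_Upsilon).
apply: measurable_funM; first exact: measurable_energy.
by apply: measurable_indic; apply: measurableC; exact: measurable_inner.
Qed.

Definition outer_slice (x : R) : \bar R := (\int[leb]_t (outer_energy (x, t))%:E)%E.

Lemma outer_slice_ge0 x : (0 <= outer_slice x)%E.
Proof. by apply: integral_ge0 => t _; rewrite lee_fin outer_energy_ge0. Qed.

Lemma measurable_outer_slice : measurable_fun setT outer_slice.
Proof.
have moe : measurable_fun (setT : set (plane R)) (EFin \o outer_energy).
  by apply/measurable_EFinP; exact: measurable_outer_energy.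
exact: (measurable_param_integral leb moe).
Qed.

(** Where the leak is nonzero the height is in one of the rows, hence outside [inner], and [dcutoff]
    is at most [8 / d]. *)
Lemma leak_sq_le x t : leak u d (x, t) ^+ 2 <= (8 / d) ^+ 2 * outer_energy (x, t).
Proof.
have [z|] := boolP (leak u d (x, t) == 0).
  by rewrite (eqP z) expr0n mulr_ge0// ?sqr_ge0// outer_energy_ge0.
have [tm|tm] := boolP (2 * d <= t <= 1 - 2 * d); first by rewrite leak_mid ?eqxx.
rewrite /leak patchE; case: ifPn => [sq|_]; last by rewrite eqxx.
move=> /= _; rewrite /outer_energy patchE ifT; last first.
  by apply: mem_set; move: sq; rewrite inE; exact: square_Upsilon.
rewrite indicE mem_set; last first.
  by move=> [_ /=]; rewrite in_itv/= => tI; move: tm; rewrite tI.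
rewrite mulr1 exprMn /energy.
have db : dcutoff d t ^+ 2 <= (8 / d) ^+ 2.
  by apply: sqr_le_norm; exact: dcutoff_bound.
by apply: ler_pM => //; rewrite ?sqr_ge0// lerDl sqr_ge0.
Qed.

(** Cauchy-Schwarz over the two rows, of total height at most [2 * d], combined with [leak_sq_le]:
    [2 * d * (8 / d) ^+ 2 = 128 / d]. *)
Lemma leak_slice x (A : R) : slice_mass (leak u d) x = A%:E ->
  ((A ^+ 2)%:E <= (128 / d)%:E * outer_slice x)%E.
Proof.
have dd0 := d0; have dd1 := d1.
move=> lA; pose S : set R := `[d, 2 * d] `|` `[1 - 2 * d, 1 - d].
have mS : measurable (S : set (measurableTypeR R)).
  by apply: measurableU; exact: measurable_itv.
have ml := measurable_leak d0 uG.
have leS : (leb S <= (2 * d)%:E)%E.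
  apply: le_trans (measureU2 _ _ _) _; [exact: measurable_itv|exact: measurable_itv|].
  rewrite [X in (X + _)%E]lebesgue_measure_itv [X in (_ + X)%E]lebesgue_measure_itv/=.
  rewrite !lte_fin ifT; last lra.
  by rewrite ifT; [rewrite -!EFinB -EFinD lee_fin; lra|lra].
have s0 : 0 < 2 * d by lra.
have out t : ~ S t -> leak u d (x, t) = 0.
  move=> nSt; have [tm|tm] := boolP (2 * d <= t <= 1 - 2 * d); first exact: leak_mid.
  rewrite /leak patchE; case: ifP => // /set_mem [_ /=]; rewrite in_itv/= => /andP[dt td].
  exfalso; apply: nSt; rewrite /S/= !in_itv/=.
  have [t2|t2] := leP t (2 * d); [left|right]; first by rewrite dt.
  by rewrite td andbT; move: tm; rewrite (ltW t2)/= -ltNge => /ltW.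
apply: (le_trans (slice_cauchy_schwarz (measurable_slice x ml) mS s0 leS out lA)).
apply: (@le_trans _ _ ((2 * d)%:E * \int[leb]_t (((8 / d) ^+ 2)%:E * (outer_energy (x, t))%:E))%E).
  apply: lee_wpmul2l; first by rewrite lee_fin ltW.
  apply: ge0_le_integral => //.
  - by move=> t _; rewrite lee_fin sqr_ge0.
  - by apply/measurable_EFinP; apply: measurable_funX; exact: (measurable_slice x ml).
  - apply: emeasurable_funM => //; apply/measurable_EFinP.
    exact: (measurable_slice x measurable_outer_energy).
  - by move=> t _; rewrite -EFinM lee_fin leak_sq_le.
rewrite ge0_integralZl//; last 3 first.
- by apply/measurable_EFinP; exact: (measurable_slice x measurable_outer_energy).
- by move=> t _; rewrite lee_fin outer_energy_ge0.
- by rewrite lee_fin sqr_ge0.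
rewrite muleA -EFinM (_ : 2 * d * (8 / d) ^+ 2 = 128 / d)//.
by field; rewrite gt_eqF.
Qed.

Definition rows : set (measurableTypeR R) := `]0, 2 * d] `|` `]1 - 2 * d, 1].

(** Off this set the line is good, [cutoff] is 1 and the flux is kept, so the derivative is exact
    and the function errs only by flux dropped elsewhere on the line, at most [e]. *)
Definition bad_set (k e : R) : set (plane R) :=
  ~` ((fst @^-1` good_abscissae u G d k e) `&`
      ((snd @^-1` `[2 * d, 1 - 2 * d]) `&` [set z | `|flux G d z| <= k])).

Lemma measurable_bad_set k e : measurable (bad_set k e).
Proof.
apply: measurableC; apply: measurableI.
  rewrite -[_ @^-1` _]setTI; apply: measurable_fst => //.
  exact: (measurable_good d0 uG).
apply: measurableI.
  by rewrite -[_ @^-1` _]setTI; apply: measurable_snd => //; exact: measurable_itv.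
rewrite (_ : mkset _ = (fun z => `|flux G d z|) @^-1` `]-oo, k]); last first.
  by apply/seteqP; split => z /=; rewrite in_itv.
rewrite -[_ @^-1` _]setTI.
have mf : measurable_fun (setT : set (plane R)) (fun z => `|flux G d z|).
  by apply: measurableT_comp => //; exact: (measurable_flux d0 uG).
by apply: mf => //; exact: measurable_itv.
Qed.

Definition error (k e : R) (z : R * R) : R :=
  (u z - vint (truncated u G d k e \_ strip) z) ^+ 2 +
  (v z * (G z - truncated u G d k e z)) ^+ 2.

(** On a good line the error on [u] has three parts: what the cutoff removes, the leak not accounted
    for by the datum ([r2v]) and the dropped flux ([r3v]); the square of a sum of three terms costs
    the factor 3. The almost-everywhere identity for [cut_u] enters as a hypothesis at the given
    point. *)
Lemma error_le (k e : R) z : 0 <= k -> Upsilon z ->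
  ((`]d, 1 - 2 * d] `*` `]0, 1] : set (plane R)) z -> cut_u u d z = vint (cut_dy u G d) z) ->
  ((error k e z)%:E <= (3 * (energy z * \1_(bad_set k e) z) + 3 * e ^+ 2)%:E +
     3%:E * ((\1_rows z.2)%:E * ((128 / d)%:E * outer_slice z.1)))%E.
Proof.
have dd0 := d0; have dd1 := d1.
case: z => x y k0 Uz cutE; have [/= xI] := Uz; rewrite in_itv/= => /andP[y0 y1].
have en0 := energy_ge0 (x, y).
have row0 : (0 <= 3%:E * ((\1_rows y)%:E * ((128 / d)%:E * outer_slice x)))%E.
  rewrite mule_ge0// mule_ge0 ?lee_fin ?indicE// mule_ge0 ?outer_slice_ge0//.
  by rewrite lee_fin divr_ge0// ltW.
(* On a bad line the approximation is 0 in the square, and the error is the energy itself. *)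
have [gx|ngx] := pselect (good_abscissae u G d k e x); last first.
  rewrite /error vint_truncated_bad// subr0 /truncated/= indicE memNset// mul0r subr0.
  rewrite indicE mem_set; last by move=> [].
  rewrite -[leLHS]adde0; apply: leeD => //; rewrite lee_fin mulr1.
  by rewrite -/(energy (x, y)); have := sqr_ge0 e; lra.
have [/= xd _] := gx.
have {}cutE := cutE (conj xd (_ : `]0, 1]%classic y)).
have {cutE} cutE : cut_u u d (x, y) = vint (flux G d) (x, y) + vint (leak u d) (x, y).
  by rewrite cutE ?(vint_cut_dy d0 uG _ gx)//= in_itv/= y0 ltW.
set W := vint (truncated u G d k e \_ strip) (x, y).
have WE : W = vint (leak u d) (x, 2^-1) + vint (keep k (flux G d)) (x, y).
  exact: (vint_truncated_good d0 uG gx Uz).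
have [r20 r2A] := vint_leak_diff d0 d1 uG gx Uz.
have r3 := vint_drop d0 uG y gx.
set r2v := vint (leak u d) (x, y) - vint (leak u d) (x, 2^-1) in r20 r2A.
set r3v := vint (flux G d) (x, y) - vint (keep k (flux G d)) (x, y) in r3.
have uW : u (x, y) - W = (u (x, y) - cut_u u d (x, y)) + r2v + r3v.
  by rewrite cutE WE /r2v /r3v; ring.
have r3sq : r3v ^+ 2 <= e ^+ 2.
  exact: sqr_le_norm.
have trE : truncated u G d k e (x, y) = keep k (flux G d) (x, y).
  rewrite /truncated/= indicE mem_set// mul1r indicE memNset ?mul0r ?add0r//= in_itv/=.
  by rewrite leNgt y0.
(* Middle heights: [u] is not cut and [r2v] vanishes; the derivative is either exact or replaced by
   0 at a point of [bad_set]. *)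
have [ym|ym] := boolP (2 * d <= y <= 1 - 2 * d).
  have sq : square d (x, y).
    move: xd ym; rewrite /square/= !in_itv/= => /andP[? ?] /andP[? ?].
    by split; apply/andP; split; lra.
  have [c1 _] := cutoff_in d0 ym.
  have cu : cut_u u d (x, y) = u (x, y) by rewrite /cut_u patchE mem_set//= c1 mul1r.
  have fl : flux G d (x, y) = G (x, y) by rewrite /flux patchE mem_set//= c1 mul1r.
  rewrite -[leLHS]adde0; apply: leeD => //; rewrite lee_fin /error -/W uW cu subrr add0r.
  rewrite (r20 ym) add0r trE /keep fl.
  have [Gk|Gk] := boolP (`|G (x, y)| <= k).
    rewrite mulr1 subrr mulr0 expr0n addr0.
    have := sqr_ge0 e; have : 0 <= energy (x, y) * \1_(bad_set k e) (x, y) by rewrite mulr_ge0// indicE.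
    lra.
  rewrite mulr0 subr0 indicE mem_set; last first.
    by move=> [_ [_ /=]]; rewrite fl; exact/negP.
  by rewrite mulr1 /energy; have := sqr_ge0 (u (x, y)); have := sqr_ge0 (v (x, y) * G (x, y)); nra.
(* Near the bottom and the top all three parts occur. Such a point is bad, so its energy pays for
   what the cutoff and the truncation remove, and [leak_slice] pays for [r2v]. *)
have bad1 : bad_set k e (x, y).
  by move=> [_ [/= + _]]; rewrite in_itv/=; exact/negP.
have row1 : rows y.
  rewrite /rows/= !in_itv/= y0 (ltW y1) andbT/=; have [|y2] := leP y (2 * d); [by left|right].
  by move: ym; rewrite (ltW y2)/= -ltNge.
have [/= J1 [J2 _]] := gx.2.
have AE : slice_mass (leak u d) x = (fine (slice_mass (leak u d) x))%:E.
  rewrite fineK// ge0_fin_numE; first exact: le_lt_trans J2 (ltry _).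
  by apply: integral_ge0 => t _.
set A := fine _ in AE.
have lA := leak_slice AE.
have r2sq : ((r2v ^+ 2)%:E <= (128 / d)%:E * outer_slice x)%E.
  apply: le_trans lA; move: r2A; rewrite AE !lee_fin => r2A.
  exact: sqr_le_norm.
rewrite [\1_rows _]indicE (mem_set row1) mul1e [\1_(bad_set k e) _]indicE (mem_set bad1) mulr1.
apply: (@le_trans _ _ ((3 * energy (x, y) + 3 * e ^+ 2)%:E + 3%:E * (r2v ^+ 2)%:E)%E); last first.
  by apply: leeD => //; apply: lee_wpmul2l.
rewrite -EFinM -EFinD lee_fin /error -/W uW trE.
have /andP[cb0 cb1] := cutoff_bounds d y.
have s1 : (u (x, y) - cut_u u d (x, y)) ^+ 2 <= u (x, y) ^+ 2.
  rewrite /cut_u patchE; case: ifP => _ /=; last by rewrite -[point]/(0 : R) subr0.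
  have -> : u (x, y) - cutoff d y * u (x, y) = (1 - cutoff d y) * u (x, y) by ring.
  by rewrite exprMn ler_piMl ?sqr_ge0//; nra.
have s2 : (v (x, y) * (G (x, y) - keep k (flux G d) (x, y))) ^+ 2 <= (v (x, y) * G (x, y)) ^+ 2.
  rewrite !exprMn ler_wpM2l ?sqr_ge0//.
  have [c [cI ->]] : exists c, 0 <= c <= 1 /\ keep k (flux G d) (x, y) = c * G (x, y).
    rewrite /keep /flux patchE; case: (_ <= k); case: ifP => _ /=.
    - by exists (cutoff d y); rewrite cb0 cb1 mulr1.
    - by exists 0; rewrite lexx ler01 -[point]/(0 : R) !mul0r.
    - by exists 0; rewrite lexx ler01 mulr0 mul0r.
    - by exists 0; rewrite lexx ler01 mulr0 mul0r.
  have -> : G (x, y) - c * G (x, y) = (1 - c) * G (x, y) by ring.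
  by move: cI => /andP[c0 c1]; rewrite exprMn ler_piMl ?sqr_ge0//; nra.
have sq3 (a b c : R) : (a + b + c) ^+ 2 <= 3 * a ^+ 2 + 3 * b ^+ 2 + 3 * c ^+ 2.
  by have := sqr_ge0 (a - b); have := sqr_ge0 (b - c); have := sqr_ge0 (a - c); nra.
have combine (S a b c A' e' g g' : R) : S <= 3 * a + 3 * b + 3 * c -> a <= A' -> c <= e' ->
  g <= g' -> 0 <= g' -> S + g <= 3 * (A' + g') + 3 * e' + 3 * b by lra.
exact: combine (sq3 _ _ _) s1 r3sq s2 (sqr_ge0 _).
Qed.

End truncation_error.

(** * Integrated truncation error *)

Section truncation_integral.
Context {R : realType}.
Local Notation leb := (@lebesgue_measure R).
Variables (u G v : R * R -> R) (d : R).
Hypotheses (d0 : 0 < d) (d1 : 4 * d < 1) (uG : weak_dy Upsilon u G).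
Hypothesis mv : measurable_fun (Upsilon : set (plane R)) v.
Hypothesis ie : leb2.-integrable (Upsilon : set (plane R)) (EFin \o energy u G v).

Lemma leb2_Upsilon : (leb2 (Upsilon : set (plane R)) = 1)%E.
Proof.
rewrite /leb2 product_measure1E; [|exact: measurable_itv|exact: measurable_itv].
rewrite [X in (X * _)%E]lebesgue_measure_itv [X in (_ * X)%E]lebesgue_measure_itv/=.
by rewrite lte_fin ltr01 -EFinB subr0 mul1e.
Qed.

Lemma leb_rows : (leb (rows d) <= (4 * d)%:E)%E.
Proof.
have dd0 := d0; have dd1 := d1.
apply: le_trans (measureU2 _ _ _) _; [exact: measurable_itv|exact: measurable_itv|].
rewrite [X in (X + _)%E]lebesgue_measure_itv [X in (_ + X)%E]lebesgue_measure_itv/=.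
rewrite !lte_fin ifT; last lra.
by rewrite ifT; [rewrite -!EFinB -EFinD lee_fin; lra|lra].
Qed.

(** The rows have measure at most [4 * d], which cancels the factor [1 / d]:
    [3 * (4 * d) * (128 / d) = 12 * 128]. The constant does not depend on [d], so a small outer
    energy is enough. *)
Lemma rows_integral (c : R) : 0 <= c -> c = 12 * 128 ->
  (\int[leb2]_(z in Upsilon)
     (3%:E * ((\1_(rows d) z.2)%:E * ((128 / d)%:E * outer_slice u G v d z.1))) <=
   c%:E * \int[leb2]_z (outer_energy u G v d z)%:E)%E.
Proof.
move=> c0 cE; have cd0 : 0 <= 128 / d by rewrite divr_ge0// ltW.
have os0 := outer_slice_ge0 u G v d.
have mos := measurable_outer_slice d ie.
have mr : measurable (rows d) by apply: measurableU; exact: measurable_itv.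
have mi : measurable_fun setT (fun y => (\1_(rows d) y : R)%:E).
  by apply/measurable_EFinP; exact: measurable_indic.
pose f (z : plane R) := (3%:E * ((\1_(rows d) z.2)%:E * ((128 / d)%:E * outer_slice u G v d z.1)))%E.
have f0 z : (0 <= f z)%E.
  by rewrite mule_ge0// mule_ge0 ?lee_fin ?indicE// mule_ge0 ?lee_fin.
have mf : measurable_fun setT f.
  apply: emeasurable_funM => //; apply: emeasurable_funM.
    exact: (measurableT_comp mi).
  apply: emeasurable_funM => //; exact: (measurableT_comp mos).
apply: (@le_trans _ _ (\int[leb2]_z f z)%E).
  rewrite integral_mkcond; apply: ge0_le_integral => //.
  - by move=> z _; rewrite patchE; case: ifP => // _; exact: f0.
  - apply/(measurable_restrictT _ measurable_Upsilon); exact: measurable_funS mf.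
  - by move=> z _; rewrite patchE; case: ifP => // _; exact: f0.
rewrite /leb2 (fubini_tonelli1 f mf f0) /fubini_F/=.
have oeE : (\int[leb \x leb]_z (outer_energy u G v d z)%:E =
    \int[leb]_x outer_slice u G v d x)%E.
  have moe : measurable_fun (setT : set (plane R)) (EFin \o outer_energy u G v d).
    by apply/measurable_EFinP; exact: measurable_outer_energy.
  have oe0 z : (0 <= (EFin \o outer_energy u G v d) z)%E.
    by rewrite lee_fin outer_energy_ge0.
  exact: (@fubini_tonelli1 _ _ _ _ _ leb leb _ moe oe0).
rewrite oeE -ge0_integralZl//.
apply: ge0_le_integral => //.
- by move=> x _; apply: integral_ge0 => y _; exact: f0.
- exact: (measurable_fun_fubini_tonelli_F f mf f0).
- by apply: emeasurable_funM.
move=> x _; rewrite /f/=.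
under eq_integral do rewrite muleCA.
rewrite ge0_integralZr//; last by rewrite mule_ge0// mule_ge0 ?lee_fin.
rewrite integral_indic// setIT.
apply: (@le_trans _ _ ((4 * d)%:E * (3%:E * ((128 / d)%:E * outer_slice u G v d x)))%E).
  apply: lee_wpmul2r; last exact: leb_rows.
  by rewrite mule_ge0// mule_ge0 ?lee_fin.
rewrite !muleA -!EFinM (_ : 4 * d * 3 * (128 / d) = c)// cE.
by field; rewrite gt_eqF.
Qed.

Lemma error_integral (c k e e1 e2 : R) : 0 <= c -> c = 12 * 128 -> 0 <= k ->
  (\int[leb2]_z (outer_energy u G v d z)%:E <= e1%:E)%E ->
  (\int[leb2]_(z in Upsilon) (energy u G v z * \1_(bad_set u G d k e) z)%:E <= e2%:E)%E ->
  (\int[leb2]_(z in Upsilon) (error u G v d k e z)%:E <= (c * e1 + 3 * e2 + 3 * e ^+ 2)%:E)%E.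
Proof.
move=> c0 cE k0 oe1 be2.
have cd0 : 0 <= 128 / d by rewrite divr_ge0// ltW.
have mU := @measurable_Upsilon R.
have [[mu _] [mG _] _] := uG.
have bt := truncated_bounded d0 uG e k0.
have os0 := outer_slice_ge0 u G v d.
have mos := measurable_outer_slice d ie.
have mr : measurable (rows d) by apply: measurableU; exact: measurable_itv.
have mi : measurable_fun setT (fun y => (\1_(rows d) y : R)%:E).
  by apply/measurable_EFinP; exact: measurable_indic.
pose f (z : plane R) := (3%:E * ((\1_(rows d) z.2)%:E * ((128 / d)%:E * outer_slice u G v d z.1)))%E.
have f0 z : (0 <= f z)%E.
  by rewrite mule_ge0// mule_ge0 ?lee_fin ?indicE// mule_ge0 ?lee_fin.
have mf : measurable_fun (Upsilon : set (plane R)) f.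
  apply: (@measurable_funS _ _ _ _ setT) => //.
  apply: emeasurable_funM => //; apply: emeasurable_funM.
    exact: (measurableT_comp mi).
  apply: emeasurable_funM => //; exact: (measurableT_comp mos).
pose g z := 3 * (energy u G v z * \1_(bad_set u G d k e) z) + 3 * e ^+ 2.
have eb0 z : 0 <= energy u G v z * \1_(bad_set u G d k e) z.
  by rewrite mulr_ge0 ?energy_ge0// indicE.
have g0 z : 0 <= g z by rewrite addr_ge0// mulr_ge0// sqr_ge0.
have meb : measurable_fun (Upsilon : set (plane R)) (fun z => energy u G v z * \1_(bad_set u G d k e) z).
  apply: measurable_funM; first exact: measurable_energy.
  by apply: measurable_indic; exact: (measurable_bad_set d0 uG).
have mg : measurable_fun (Upsilon : set (plane R)) g.
  by apply: measurable_funD => //; exact: measurable_funM.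
have merr : measurable_fun (Upsilon : set (plane R)) (error u G v d k e).
  apply: measurable_funD; apply: measurable_funX.
    by apply: measurable_funB => //; exact: measurable_vint_strip bt.
  apply: measurable_funM => //; apply: measurable_funB => //.
  by apply: measurable_funS bt.1.
apply: (@le_trans _ _ (\int[leb2]_(z in Upsilon) ((g z)%:E + f z))%E).
  apply: ae_ge0_le_integral => //.
  - by move=> z _; rewrite lee_fin sqdist_ge0.
  - exact/measurable_EFinP.
  - by move=> z _; rewrite adde_ge0// lee_fin.
  - by apply: emeasurable_funD => //; exact/measurable_EFinP.
  have := cutoff_primitive d0 uG; apply: filterS => z cutE Uz.
  exact: (error_le d0 d1 uG ie).
rewrite ge0_integralD//; [|by move=> z _; rewrite lee_fin|exact/measurable_EFinP].
have -> : c * e1 + 3 * e2 + 3 * e ^+ 2 = (3 * e2 + 3 * e ^+ 2) + c * e1 by ring.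
rewrite EFinD; apply: leeD.
  apply: (integral_le_lin (k := 3) (l := 3) (b := e ^+ 2) mU meb (g := cst (e ^+ 2))) => //.
  - by move=> z _; exact: sqr_ge0.
  - by move=> z _; rewrite g0 lexx.
  rewrite (integral_cst leb2 mU (e ^+ 2)%:E).
  by rewrite [X in (_ * X)%E]leb2_Upsilon mule1.
apply: (le_trans (rows_integral c0 cE)); rewrite EFinM; exact: lee_wpmul2l.
Qed.

End truncation_integral.

Lemma cvge_near_lt (R : realType) (f : (\bar R)^nat) (l : \bar R) (c : R) :
  f n @[n --> \oo] --> l -> (l < c%:E)%E -> \forall n \near \oo, (f n < c%:E)%E.
Proof.
move=> fl lc; have H : nbhs l [set x | x < c%:E]%E by exact: open_ereal_lt'.
exact: fl H.
Qed.

Lemma integral_restrict_EFin d (T : measurableType d) (R : realType)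
    (mu : {measure set T -> \bar R}) (D : set T) (f : T -> R) :
  (\int[mu]_z ((f \_ D) z)%:E = \int[mu]_(z in D) (f z)%:E)%E.
Proof.
by rewrite [RHS]integral_mkcond; apply: eq_integral => z _; rewrite !patchE; case: ifP.
Qed.

(** * Density of continuous piecewise linear functions *)

Section density.
Context {R : realType}.
Local Notation leb := (@lebesgue_measure R).
Variables (u G v : R * R -> R).
Hypothesis uG : weak_dy Upsilon u G.
Hypothesis mv : measurable_fun (Upsilon : set (plane R)) v.
Hypothesis ie : leb2.-integrable (Upsilon : set (plane R)) (EFin \o energy u G v).

(** Dominated convergence with the energy as majorant; the strict inequality at the limit leaves
    room for some finite [n]. *)
Lemma energy_indic_cvg (A_ : (set (plane R))^nat) (A : set (plane R)) (c : R) :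
  (forall n, measurable (A_ n)) -> measurable A -> 0 < c ->
  {ae leb2, forall z : plane R, Upsilon z -> \forall n \near \oo, A_ n z <-> A z} ->
  (\int[leb2]_(z in Upsilon) (energy u G v z * \1_A z)%:E < c%:E)%E ->
  exists n : nat, (\int[leb2]_(z in Upsilon) (energy u G v z * \1_(A_ n) z)%:E <= c%:E)%E.
Proof.
move=> mA_ mA c0 AA Ac.
have mE (B : set (plane R)) : measurable B ->
    measurable_fun (Upsilon : set (plane R)) (fun z => (energy u G v z * \1_B z)%:E).
  move=> mB; apply/measurable_EFinP; apply: measurable_funM; first exact: measurable_energy.
  exact: measurable_indic.
have e0 := energy_ge0 u G v.
have := @dominated_convergence _ _ _ leb2 Upsilon (@measurable_Upsilon R)
  (fun n z => (energy u G v z * \1_(A_ n) z)%:E) (fun z => (energy u G v z * \1_A z)%:E)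
  (EFin \o energy u G v) _ (mE _ mA) _ ie _.
case.
- by move=> n; exact: mE.
- apply: filterS AA => z AAz Uz; apply: cvg_near_cst; apply: filterS (AAz Uz) => n Anz.
  congr ((_ * _)%:E); rewrite !indicE; congr (nat_of_bool _)%:R.
  by apply/idP/idP; rewrite !inE => /Anz.
- apply: aeW => z n Uz; rewrite /= lee_fin normrM ger0_norm// ler_piMr//.
  by rewrite indicE; case: (_ \in _); rewrite ?normr1 ?normr0.
move=> _ _ cv; have [n /ltW An] := filter_ex (cvge_near_lt cv Ac).
by exists n.
Qed.

Lemma small_outer_energy (c : R) : 0 < c -> exists2 d : R, 0 < d /\ 4 * d < 1 &
  (\int[leb2]_z (outer_energy u G v d z)%:E <= c%:E)%E.
Proof.
(* The denominator is at least 5, so that [4 * dd n < 1] for every [n]. *)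
move=> c0; pose dd (n : nat) : R := n.+4.+1%:R^-1.
have dd0 n : 0 < dd n by rewrite invr_gt0.
have dd1 n : 4 * dd n < 1.
  by rewrite /dd ltr_pdivrMr// mul1r ltr_nat.
have [n Hn] : exists n : nat,
    (\int[leb2]_(z in Upsilon) (energy u G v z * \1_(~` inner (dd n)) z)%:E <= c%:E)%E.
  apply: (energy_indic_cvg (A := set0)) => //.
  - by move=> n; apply: measurableC; exact: measurable_inner.
  - apply: aeW => -[x y] [/= xI yI].
    move: xI yI; rewrite !in_itv/= => /andP[x0 x1] /andP[y0 y1].
    (* [m] is the distance to the boundary; the point belongs to [inner (dd n)] once
       [2 * dd n < m]. *)
    pose m := Num.min (Num.min x (1 - x)) (Num.min y (1 - y)).
    have m0 : 0 < m by rewrite !lt_min x0 y0 !subr_gt0 x1 y1.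
    have [mx mx' my my'] : [/\ m <= x, m <= 1 - x, m <= y & m <= 1 - y].
      by split; rewrite !ge_min ?lexx ?orbT.
    near=> n; split => // nin; apply: nin.
    have dm : 2 * dd n < m.
      rewrite /dd ltr_pdivrMr// -ltr_pdivrMl//.
      have m2 : m^-1 * 2 <= (Num.bound (m^-1 * 2))%:R.
        by rewrite ltW// archi_boundP// mulr_ge0// invr_ge0 ltW.
      apply: le_lt_trans m2 _; rewrite ltr_nat; near: n.
      by exists (Num.bound (m^-1 * 2)) => // k /= bk; rewrite ltnS !leqW.
    have d0n := dd0 n.
    by split; rewrite /= in_itv/=; apply/andP; split; lra.
  - by rewrite integral0_eq// => z _; rewrite indicE in_set0 mulr0.
exists (dd n) => //.
by rewrite /outer_energy integral_restrict_EFin.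
Unshelve. all: by end_near. Qed.

(** The order of the choices matters. The width [d] comes from the outer energy alone, as the
    constant of the leak term is free of [d]; next comes [e]; the level [n] is last, since for fixed
    [d] and [e] the bad sets tend almost everywhere to the complement of [inner d]. *)
Lemma approx_bounded (c : R) : 0 < c -> exists C g, bounded_on_strip C g /\
  (\int[leb2]_(z in Upsilon)
    ((u z - vint (g \_ strip) z) ^+ 2 + (v z * (G z - g z)) ^+ 2)%:E <= c%:E)%E.
Proof.
move=> c0; have [K [K0 KE]] : exists K : R, 0 <= K /\ K = 12 * 128.
  by exists (12 * 128); split => //; rewrite mulr_ge0.
(* [K * e1] bounds the leak and [3 * (2 * e1)] the energy of the bad set; together they make
   [c / 2], and the other half is left for [3 * e ^+ 2]. *)
pose e1 := c / 2 / (K + 6).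
have e10 : 0 < e1 by rewrite divr_gt0 ?divr_gt0//; lra.
have [d [d0 d1] od] := small_outer_energy e10.
(* [e <= 1] gives [e ^+ 2 <= e <= c / 6]. *)
pose e := Num.min 1 (c / 6).
have e0 : 0 < e by rewrite lt_min ltr01 divr_gt0.
have esq : 3 * e ^+ 2 <= c / 2.
  have h1 : e <= 1 by rewrite ge_min lexx.
  have h2 : e <= c / 6 by rewrite ge_min lexx orbT.
  by nra.
(* The factor 2 leaves strict room above the limit value, which is at most [e1]. *)
have [n Hn] : exists n : nat,
    (\int[leb2]_(z in Upsilon) (energy u G v z * \1_(bad_set u G d n%:R e) z)%:E <= (2 * e1)%:E)%E.
  apply: (energy_indic_cvg (A := ~` inner d)) => //.
  - by move=> n; exact: (measurable_bad_set d0 uG).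
  - by apply: measurableC; exact: measurable_inner.
  - by rewrite mulr_gt0.
  - have [_ lG _] := uG; have [lu _ _] := uG.
    have [iG _] := cut_integrable d0 lG; have [_ iu] := cut_integrable d0 lu.
    have aeG := ae_fst (ae_integrable1 (m1 := leb) (m2 := leb) iG).
    have aeu := ae_fst (ae_integrable1 (m1 := leb) (m2 := leb) iu).
    apply: filterS2 aeG aeu => -[x y] /= ixG ixu _.
    have [xyin|xyout] := pselect (inner d (x, y)); last first.
      apply: nearW => n; split => // _ -[/= gx [ym _]]; apply: xyout; split => //.
      by case: gx.
    have JG : (slice_mass (flux G d) x < +oo)%E by case/integrableP : ixG.
    have Ju : (slice_mass (leak u d) x < +oo)%E by case/integrableP : ixu.
    have big (J : \bar R) : (0 <= J)%E -> (J < +oo)%E -> \forall n \near \oo, (J <= n%:R%:E)%E.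
      move=> J0 Joo; have JE : J = (fine J)%:E by rewrite fineK// ge0_fin_numE.
      near=> n; rewrite JE lee_fin (le_trans (ltW (archi_boundP _)))//; first exact: fine_ge0.
      by rewrite ler_nat; near: n; exact: nbhs_infty_ge.
    have cvI := drop_cvg (measurable_flux d0 uG) JG.
    near=> n; split => [nb|nin]; last by case: (nin xyin).
    exfalso; apply: nb; split; last split.
    + case: xyin => /= xI yI; split => //=; split; [|split].
      * near: n; apply: big => //; exact: integral_ge0.
      * near: n; apply: big => //; exact: integral_ge0.
      * apply: ltW; near: n; by apply: (cvge_near_lt cvI); rewrite lte_fin.
    + by case: xyin.
    + rewrite /= (le_trans (ltW (archi_boundP (normr_ge0 _))))//.
      by rewrite ler_nat; near: n; exact: nbhs_infty_ge.
  - apply: (@le_lt_trans _ _ e1%:E); last by rewrite lte_fin; lra.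
    by move: od; rewrite /outer_energy integral_restrict_EFin.
exists (n%:R + n%:R), (truncated u G d n%:R e); split.
  exact: truncated_bounded.
have := error_integral d0 d1 uG mv ie (c := K) (k := n%:R) K0 KE (ler0n _ _) od Hn.
move=> /le_trans; apply; rewrite lee_fin.
have : (K + 6) * e1 = c / 2 by rewrite /e1 mulrC divfK// gt_eqF//; lra.
lra.
Unshelve. all: by end_near. Qed.

Variable B : R.
Hypothesis vB : forall z, Upsilon z -> `|v z| <= B.

(** With a bounded derivative the weight costs no more than the factor [B ^+ 2], and the unweighted
    approximation on the strip suffices. *)
Lemma pl_density (c : R) : 0 < c -> exists p q, pl_pair p q /\
  (\int[leb2]_(z in Upsilon)
    ((u z - p z) ^+ 2 + (v z * (G z - q z)) ^+ 2)%:E <= c%:E)%E.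
Proof.
move=> c0; have [C [g [bg Eg]]] := approx_bounded (divr_gt0 c0 (ltr0n _ 4)).
(* The 2 is that of [(a - c)^2 <= 2 (a - b)^2 + 2 (b - c)^2]; [1 + B ^+ 2] covers both the function
   and the weighted derivative. *)
pose D := 2 * (1 + B ^+ 2).
have D0 : 0 < D by rewrite mulr_gt0// ltr_pwDl// sqr_ge0.
have [|p [q [Ppq Epq]]] := appr_bounded bg (eps := c / 2 / D).
  by rewrite divr_gt0// divr_gt0.
exists p, q; split => //; have [_ _ mp mq _] := Ppq.
have mU := @measurable_Upsilon R.
have [[mu _] [mG _] _] := uG.
have mT (f : R * R -> R) : measurable_fun (setT : set (plane R)) f ->
  measurable_fun (Upsilon : set (plane R)) f by exact: measurable_funS.
have Epq' : (\int[leb2]_(z in Upsilon)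
    ((vint (g \_ strip) z - p z) ^+ 2 + (g z - q z) ^+ 2)%:E <= (c / 2 / D)%:E)%E.
  apply: le_trans Epq; apply: ge0_subset_integral => //.
  - exact: measurable_strip.
  - apply/measurable_EFinP; apply: measurable_sqdist;
      [exact: measurable_vint_strip bg|by apply: measurable_funS bg.1|
       by apply: measurable_funS mp|by apply: measurable_funS mq].
  - by move=> z _; rewrite lee_fin sqdist_ge0.
  - exact: Upsilon_strip.
have -> : c = 2 * (c / 4) + D * (c / 2 / D) by field; rewrite gt_eqF.
have mvg (f : R * R -> R) : measurable_fun (Upsilon : set (plane R)) f ->
    measurable_fun (Upsilon : set (plane R)) (fun z => v z * (G z - f z)).
  by move=> mf; apply: measurable_funM => //; exact: measurable_funB.
apply: (integral_le_lin mU _ _ _ _ _ _ _ _ Eg Epq') => //.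
- apply: measurable_funD; apply: measurable_funX; last exact: (mvg _ (mT _ bg.1)).
  by apply: measurable_funB => //; exact: measurable_vint_strip bg.
- by apply: measurable_sqdist; [exact: measurable_vint_strip bg|exact: (mT _ bg.1)|exact: mT|exact: mT].
- apply: measurable_funD; apply: measurable_funX; last exact: (mvg _ (mT _ mq)).
  by apply: measurable_funB => //; exact: mT.
- by move=> z _; exact: sqdist_ge0.
- by move=> z _; exact: sqdist_ge0.
- move=> z Uz; rewrite sqdist_ge0/=.
  have v2 : v z ^+ 2 <= B ^+ 2 by apply: sqr_le_norm; exact: vB.
  have split2 (a b c' : R) : (a - c') ^+ 2 <= 2 * (a - b) ^+ 2 + 2 * (b - c') ^+ 2.
    by have := sqr_ge0 (a + c' - 2 * b); nra.
  have s1 := split2 (u z) (vint (g \_ strip) z) (p z).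
  have s2 := split2 (v z * G z) (v z * g z) (v z * q z).
  have -> : v z * (G z - q z) = v z * G z - v z * q z by ring.
  have -> : v z * (G z - g z) = v z * G z - v z * g z by ring.
  apply: le_trans (lerD s1 s2) _.
  have -> : v z * g z - v z * q z = v z * (g z - q z) by ring.
  rewrite exprMn /D.
  have h1 : v z ^+ 2 * (g z - q z) ^+ 2 <= B ^+ 2 * (g z - q z) ^+ 2.
    by rewrite ler_wpM2r// sqr_ge0.
  have h2 := sqr_ge0 (g z - q z).
  have h3 : 0 <= B ^+ 2 * (vint (g \_ strip) z - p z) ^+ 2 by rewrite mulr_ge0// sqr_ge0.
  move: h1 h2 h3; set X := v z ^+ 2 * _; set Y := (g z - q z) ^+ 2.
  set Z := (vint (g \_ strip) z - p z) ^+ 2; move=> h1 h2 h3.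
  by rewrite !mulrDr !mulrDl; lra.
- exact: ltW.
Qed.

End density.

(** * Extension by zero across the interface *)

Lemma Rintegral_mul_cvg d (T : measurableType d) (R : realType)
    (mu : {measure set T -> \bar R}) (D : set T) (f : T -> R) (b : nat -> T -> R) :
  measurable D -> mu.-integrable D (EFin \o f) -> (forall n, measurable_fun D (b n)) ->
  (forall n x, `|b n x| <= 1) -> (forall x, D x -> f x * b n x @[n --> \oo] --> f x) ->
  \int[mu]_(x in D) (f x * b n x) @[n --> \oo] --> \int[mu]_(x in D) f x.
Proof.
move=> mD fi mb b1 fb.
have mf : measurable_fun D f by apply/measurable_EFinP; exact: measurable_int fi.
have [||||] := @dominated_convergence _ _ _ mu D mD (fun n x => (f x * b n x)%:E)
  (EFin \o f) (fun x => `|(EFin \o f) x|%E) _ _ _ (integrable_abse fi) _.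
- by move=> n; apply/measurable_EFinP; exact: measurable_funM.
- exact/measurable_EFinP.
- by apply: aeW => x Dx; apply: cvg_EFin; [exact: nearW|exact: fb].
- by apply: aeW => x n Dx; rewrite /= lee_fin normrM ler_piMr.
move=> _ _ cv; apply: fine_cvg; rewrite fineK//.
exact: (integrable_fin_num mD fi).
Qed.

Section extension.
Context {R : realType}.
Variables (x0 : R) (u g v : R * R -> R).
Hypothesis v_cont : {within closure Upsilon, continuous v}.
Hypothesis v_neq0 : forall y, 0 < y < 1 -> v (x0, y) != 0.
Hypothesis ug : weak_dy (Omega1 x0) u g.
Hypothesis iu : leb2.-integrable (Omega1 x0 : set (plane R)) (EFin \o (fun z => u z ^+ 2)).
Hypothesis ivg : leb2.-integrable (Omega1 x0 : set (plane R)) (EFin \o (fun z => (v z * g z) ^+ 2)).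

Lemma Omega1E : Omega1 x0 = (Upsilon `&` fst @^-1` `]-oo, x0[)%classic.
Proof. by apply/seteqP; split => -[x y] [Uz /=]; rewrite in_itv/=; split => //=; rewrite ?in_itv. Qed.

Lemma measurable_Omega1 : measurable (Omega1 x0 : set (plane R)).
Proof.
rewrite Omega1E; apply: measurableI; first exact: measurable_Upsilon.
by rewrite -[_ @^-1` _]setTI; apply: measurable_fst => //; exact: measurable_itv.
Qed.

Lemma Omega1_Upsilon : Omega1 x0 `<=` Upsilon. Proof. by move=> z []. Qed.

Lemma measurable_restrict_Omega1 (f : R * R -> R) (D : set (plane R)) :
  measurable_fun (Omega1 x0 : set (plane R)) f -> measurable_fun D (f \_ (Omega1 x0)).
Proof.
move=> mf; apply: (@measurable_funS _ _ _ _ setT) => //.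
exact/(measurable_restrictT _ measurable_Omega1).
Qed.

Lemma leb2_Omega1_lty : (leb2 (Omega1 x0 : set (plane R)) < +oo)%E.
Proof.
apply: (@le_lt_trans _ _ (leb2 (Upsilon : set (plane R)))); last by rewrite leb2_Upsilon ltry.
by apply: le_measure; rewrite ?inE; [exact: measurable_Omega1|exact: measurable_Upsilon|
  exact: Omega1_Upsilon].
Qed.

(** [|f| <= f^2 + 1], on a set of finite measure. *)
Lemma integrable_of_sq (f : R * R -> R) : measurable_fun (Omega1 x0 : set (plane R)) f ->
  leb2.-integrable (Omega1 x0 : set (plane R)) (EFin \o (fun z => f z ^+ 2)) ->
  leb2.-integrable (Omega1 x0 : set (plane R)) (EFin \o f).
Proof.
have mO := measurable_Omega1; move=> mf if2.
have i1 : leb2.-integrable (Omega1 x0 : set (plane R)) (EFin \o (fun z => f z ^+ 2 + 1)).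
  apply: integrableD_real => //; apply: (integrable_bounded (C := 1)) => //.
    exact: leb2_Omega1_lty.
  by move=> z _; rewrite normr1.
apply: (le_integrable _ _ _ i1) => //; first exact/measurable_EFinP.
move=> z _; rewrite /= lee_fin [leRHS]ger0_norm ?addr_ge0// ?sqr_ge0//.
by rewrite -(real_normK (num_real (f z))); have := normr_ge0 (f z); nra.
Qed.

Lemma Omega1_restrict_integrable (f : R * R -> R) :
  leb2.-integrable (Omega1 x0 : set (plane R)) (EFin \o f) ->
  leb2.-integrable (Upsilon : set (plane R)) (EFin \o (f \_ (Omega1 x0))).
Proof.
move=> fi; apply: (@integrableS _ _ _ _ setT) => //; first exact: measurable_Upsilon.
exact: (integrable_restrictT _ measurable_Omega1 _).1.
Qed.

Lemma locint_u : locally_integrable2 Upsilon (u \_ (Omega1 x0)).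
Proof.
have [[mu _] _ _] := ug; split; first exact: measurable_restrict_Omega1.
move=> K KU cK; apply: (@integrableS _ _ _ _ (Upsilon : set (plane R))) => //.
- exact: measurable_Upsilon.
- exact: compact_measurable2.
- by apply: Omega1_restrict_integrable; exact: integrable_of_sq.
Qed.

(* By compactness, since [v] does not vanish on the interface. *)
Lemma interface_gap (K : set (R * R)) : compact K -> K `<=` Upsilon ->
  exists2 c : R, 0 < c & forall z, K z -> z.1 <= x0 -> c <= Num.max `|v z| (x0 - z.1).
Proof.
move=> cK KU; pose K0 := K `&` fst @^-1` [set x | x <= x0].
have cK0 : compact K0.
  apply: compact_closedI => //.
  by apply: (@closed_comp _ _ (fst : R * R -> R)); [move=> z _; exact: cvg_fst|exact: closed_le].
pose f z := Num.max `|v z| (x0 - z.1).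
have cf : {within K0, continuous f}.
  have cv0 : {within K0, continuous v}.
    apply: continuous_subspaceW v_cont => z [Kz _]; apply: subset_closure; exact: KU.
  have cx : {within K0, continuous (fun z : R * R => x0 - z.1)}.
    apply: continuous_subspaceT => z; apply: cvgB; [exact: cvg_cst|exact: cvg_fst].
  have cnv : {within K0, continuous (fun z => `|v z|)}.
    by move=> z; apply: cvg_norm; exact: cv0.
  move=> z; exact: (@continuous_max R (subspace K0) (fun z => `|v z|) (fun z => x0 - z.1) z (cnv z) (cx z)).
(* The image of [K0] is compact, hence closed, and misses 0: [f] is positive to the left of the
   interface by [x0 - z.1] and on it by [v]. A ball around 0 in the complement yields the gap
   [c]. *)
have : closed (f @` K0).
  by apply: compact_closed; [exact: norm_hausdorff|exact: continuous_compact].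
move=> /closed_openC oC.
have : nbhs (0 : R) (~` (f @` K0)).
  apply: open_nbhs_nbhs; split => // -[[x y] [Kz /= xx0] /eqP fz].
  have [/= xI] := KU _ Kz; rewrite in_itv/= => yI.
  have [xx|xx] := ltP x x0.
    by move: fz; rewrite /f/= gt_eqF// lt_max subr_gt0 xx orbT.
  have xE : x = x0 by apply/eqP; rewrite eq_le xx0 xx.
  move: fz; rewrite /f/= xE gt_eqF// lt_max normr_gt0 v_neq0//.
move=> /nbhs_ballP[c /= c0 bc]; exists c => // z Kz zx0; rewrite leNgt; apply/negP => fc.
apply: (bc (f z)); last by exists z.
by rewrite /ball/= sub0r normrN ger0_norm// /f le_max normr_ge0.
Qed.

(** By [interface_gap] each point of [K] in [Omega1] is either at distance at least [c] from the
    interface, in a compact part of [Omega1], or satisfies [|v| >= c], and then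
    [c * |g| <= |v * g| <= (v * g)^2 + 1]. *)
Lemma locint_g : locally_integrable2 Upsilon (g \_ (Omega1 x0)).
Proof.
have [_ [mg ig] _] := ug; have mO := measurable_Omega1.
split; first exact: measurable_restrict_Omega1.
move=> K KU cK; have [c c0 Kc] := interface_gap cK KU.
pose K1 := K `&` fst @^-1` [set x | x <= x0 - c].
have cK1 : compact K1.
  apply: compact_closedI => //.
  by apply: (@closed_comp _ _ (fst : R * R -> R)); [move=> z _; exact: cvg_fst|exact: closed_le].
have K1O : K1 `<=` Omega1 x0.
  by move=> z [Kz /= zc]; split; [exact: KU|rewrite /=; lra].
have i1 := ig K1 K1O cK1; have mK1 := compact_measurable2 cK1.
have mK := compact_measurable2 cK.
have [cst1 ivg1] : leb2.-integrable (Omega1 x0 : set (plane R)) (EFin \o (fun=> 1)) /\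
    leb2.-integrable (Omega1 x0 : set (plane R)) (EFin \o (fun z => c^-1 * ((v z * g z) ^+ 2 + 1))).
  have i2 : leb2.-integrable (Omega1 x0 : set (plane R)) (EFin \o (fun=> 1)).
    apply: (integrable_bounded (C := 1)) => //; first exact: leb2_Omega1_lty.
    by move=> z _; rewrite normr1.
  by split => //; apply: integrableZ_real => //; exact: integrableD_real.
pose h1 : R * R -> R := g \_ K1.
pose h2 : R * R -> R := (fun z => c^-1 * ((v z * g z) ^+ 2 + 1)) \_ (Omega1 x0).
have ih1 : leb2.-integrable (setT : set (plane R)) (EFin \o h1).
  exact: (integrable_restrictT _ mK1 _).1.
have ih2 : leb2.-integrable (setT : set (plane R)) (EFin \o h2).
  exact: (integrable_restrictT _ mO _).1.
have ih : leb2.-integrable (K : set (plane R)) (EFin \o (fun z => `|h1 z| + h2 z)).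
  apply: (@integrableS _ _ _ _ setT) => //; apply: integrableD_real => //.
  exact: integrable_norm ih1.
apply: (le_integrable _ _ _ ih) => //.
  by apply/measurable_EFinP; exact: measurable_restrict_Omega1.
move=> z Kz; rewrite /= lee_fin.
have h20 : 0 <= h2 z.
  rewrite /h2 patchE; case: ifP => // _.
  by rewrite mulr_ge0 ?invr_ge0 ?(ltW c0)// addr_ge0// sqr_ge0.
rewrite [leRHS]ger0_norm ?addr_ge0// [in leLHS]patchE; case: ifPn => [|_]; last first.
  by rewrite -[point]/(0 : R) normr0 addr_ge0.
move=> /[dup] zO' /set_mem zO; have [Uz /= zx] := zO.
have := Kc z Kz (ltW zx); rewrite le_max => /orP[vc|xc].
  rewrite -[leLHS]add0r lerD// /h2 patchE zO' -ler_pdivrMl ?invr_gt0// invrK.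
  have := normr_ge0 (g z); rewrite exprMn -(real_normK (num_real (v z))) -(real_normK (num_real (g z))) => g0.
  have h : c * `|g z| <= `|v z| * `|g z| by rewrite ler_wpM2r.
  rewrite -exprMn; apply: le_trans h _; set t := _ * _.
  by have := sqr_ge0 (t - 1); nra.
rewrite /h1 patchE mem_set ?lerDl//; split => //=; lra.
Qed.

(** The factor depends on x only and vanishes for x >= x0 - 1 / (n + 1), which makes the support a
    compact subset of [Omega1]. *)
Lemma C1c_cut (phi : R * R -> R) (n : nat) : C1c Upsilon phi ->
  C1c (Omega1 x0) (fun z => phi z * kappa (- n.+1%:R * z.1 + (n.+1%:R * x0 - 1))).
Proof.
move=> [C1phi cK KU]; set K := closure _ in cK KU.
pose K1 := K `&` fst @^-1` [set x | x <= x0 - n.+1%:R^-1].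
have n0 : 0 < n.+1%:R^-1 :> R by rewrite invr_gt0.
apply: (C1c_closed_in (K := K1)).
- exact: (C1_mul C1phi (C1_fst (C1_with_kappa _ _))).
- apply: compact_closedI => //.
  by apply: (@closed_comp _ _ (fst : R * R -> R)); [move=> z _; exact: cvg_fst|exact: closed_le].
- by move=> z [Kz /= zc]; split; [exact: KU|apply: (le_lt_trans zc); rewrite ltrBlDr ltrDl].
move=> z nz; have [Kz|nKz] := pselect (K z); last first.
  rewrite (_ : phi z = 0) ?mul0r//; apply/eqP/negPn/negP => pz; apply: nKz.
  exact: subset_closure.
rewrite kappa0 ?mulr0//.
have zx : x0 - n.+1%:R^-1 < z.1 by rewrite ltNge; apply/negP => zx; apply: nz.
have : n.+1%:R * (x0 - n.+1%:R^-1) <= n.+1%:R * z.1 by rewrite ler_wpM2l// ltW.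
rewrite mulrBr divff// => h; move: h; set N := n.+1%:R; move=> h; lra.
Qed.

(** A factor in x commutes with the y-derivative, so cutting the test function off near the
    interface creates no extra term and no trace of [u] appears. Dominated convergence removes the
    cut; integrability of the extended [g] against the test function, up to the interface, is used
    there. *)
Lemma weak_dy_extension : weak_dy Upsilon (u \_ (Omega1 x0)) (g \_ (Omega1 x0)).
Proof.
split; [exact: locint_u|exact: locint_g|move=> phi cphi].
have mU := @measurable_Upsilon R; have mO := measurable_Omega1.
have [lu' lg' w] := ug.
pose k (n : nat) (z : R * R) := kappa (- n.+1%:R * z.1 + (n.+1%:R * x0 - 1)).
have k1 n z : `|k n z| <= 1.
  by have /andP[? ?] := kappa_bounds (- n.+1%:R * z.1 + (n.+1%:R * x0 - 1)); rewrite ger0_norm.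
have mk n : measurable_fun (Upsilon : set (plane R)) (k n).
  apply: (@measurable_funS _ _ _ _ setT) => //.
  exact: (measurable_fst_comp
    (C1_with_continuous (C1_with_kappa (- n.+1%:R) (n.+1%:R * x0 - 1)))).
have kcv (f : R * R -> R) z : (f \_ (Omega1 x0)) z * k n z @[n --> \oo] --> (f \_ (Omega1 x0)) z.
  rewrite patchE; case: ifPn => [/set_mem [_ /= zx]|_]; last first.
    by rewrite -[point]/(0 : R); under eq_fun do rewrite mul0r; exact: cvg_cst.
  apply: cvg_near_cst; near=> n; rewrite /k kappa1 ?mulr1//.
  have dz : 0 < x0 - z.1 by rewrite subr_gt0.
  (* The argument of [kappa] is [n.+1 * (x0 - z.1) - 1]; it reaches 1 when the product reaches 2. *)
  have : 2 * (x0 - z.1)^-1 <= n.+1%:R.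
    apply: (@le_trans _ _ (Num.bound (2 * (x0 - z.1)^-1))%:R).
      by rewrite ltW// archi_boundP// mulr_ge0// invr_ge0 ltW.
    rewrite ler_nat; near: n; exists (Num.bound (2 * (x0 - z.1)^-1)) => // m /= bm.
    exact: leqW.
  rewrite ler_pdivrMr// => h; move: h; set N := n.+1%:R; rewrite mulrBr => h.
  by rewrite mulNr; lra.
have restr (f b : R * R -> R) n :
    \int[leb2]_(z in Upsilon) ((f \_ (Omega1 x0)) z * b z * k n z) =
    \int[leb2]_(z in Omega1 x0) (f z * (b z * k n z)).
  rewrite Rintegral_mkcond [RHS]Rintegral_mkcond; apply: eq_Rintegral => z _; rewrite !patchE.
  have [zO|zO] := boolP (z \in Omega1 x0).
    rewrite ifT ?mulrA//; apply: mem_set; apply: Omega1_Upsilon; exact: set_mem.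
  by rewrite -[point]/(0 : R) !mul0r; case: ifP.
have i1 := C1c_integrable_dy mU locint_u cphi.
have i2 := C1c_integrable mU locint_g cphi.
have c1 : \int[leb2]_(z in Upsilon)
    ((u \_ (Omega1 x0)) z * 'D_((0, 1) : R * R) phi z * k n z) @[n --> \oo] -->
    \int[leb2]_(z in Upsilon) ((u \_ (Omega1 x0)) z * 'D_((0, 1) : R * R) phi z).
  apply: (Rintegral_mul_cvg mU i1 mk k1) => z _.
  under eq_fun do rewrite mulrAC.
  by apply: cvgM; [exact: kcv|exact: cvg_cst].
have c2 : \int[leb2]_(z in Upsilon) ((g \_ (Omega1 x0)) z * phi z * k n z) @[n --> \oo] -->
    \int[leb2]_(z in Upsilon) ((g \_ (Omega1 x0)) z * phi z).
  apply: (Rintegral_mul_cvg mU i2 mk k1) => z _.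
  under eq_fun do rewrite mulrAC.
  by apply: cvgM; [exact: kcv|exact: cvg_cst].
have E n : \int[leb2]_(z in Upsilon)
    ((u \_ (Omega1 x0)) z * 'D_((0, 1) : R * R) phi z * k n z) =
    - \int[leb2]_(z in Upsilon) ((g \_ (Omega1 x0)) z * phi z * k n z).
  rewrite !restr -(w _ (C1c_cut n cphi)); apply: eq_Rintegral => z _; congr (_ * _).
  by have [C1phi _ _] := cphi; rewrite (derive_y_mul_fst z C1phi (C1_with_kappa _ _)).
move: c1; rewrite (funext E) => c1.
exact: (cvg_unique _ c1 (cvgN c2)).
Unshelve. all: by end_near. Qed.

End extension.

(** * Membership in L2 and the square of the norm *)

Section L2_facts.
Context {R : realType}.
Implicit Types (u w : R * R -> R) (D : set (R * R)).

Lemma L2_integrable_sq D u : measurable (D : set (plane R)) -> L2 D u ->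
  leb2.-integrable (D : set (plane R)) (EFin \o (fun z => u z ^+ 2)).
Proof.
move=> mD /Lfun2_integrable_sqr H; apply: (integrable_restrictT _ mD _).2.
rewrite (_ : (fun z => u z ^+ 2) \_ D = fun z => (u \_ D) z ^+ 2)//.
by apply/funext => z; rewrite !patchE; case: ifP => // _; rewrite -[point]/(0 : R) expr0n.
Qed.

Lemma Lnorm_sq D u : measurable (D : set (plane R)) ->
  ('N[leb2]_2%:E[EFin \o (u \_ D : plane R -> R)] `^ 2 = \int[leb2]_(z in D) (u z ^+ 2)%:E)%E.
Proof.
move=> mD; rewrite powR_Lnorm// [RHS]integral_mkcond.
apply: eq_integral => z _; rewrite /= !patchE; case: ifP => _.
  by rewrite /= powR_mulrn// real_normK// num_real.
by rewrite -[point]/(0 : R) normr0 powR0.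
Qed.

(** [L2norm] is read through [fine], so the identity for its square needs a finite integral; the
    bound by [c] supplies it along with membership in L2. *)
Lemma L2_of_sq D u (c : R) : measurable (D : set (plane R)) ->
  measurable_fun (D : set (plane R)) u ->
  (\int[leb2]_(z in D) (u z ^+ 2)%:E <= c%:E)%E ->
  L2 D u /\ (L2norm D u ^+ 2)%:E = (\int[leb2]_(z in D) (u z ^+ 2)%:E)%E.
Proof.
move=> mD mu uc; have NE := Lnorm_sq u mD.
have N0 : (0 <= 'N[leb2]_2%:E[EFin \o (u \_ D : plane R -> R)])%E by exact: Lnorm_ge0.
have Nfin : ('N[leb2]_2%:E[EFin \o (u \_ D : plane R -> R)] < +oo)%E.
  rewrite (@lty_poweRy _ _ 2)// NE; exact: le_lt_trans uc (ltry _).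
split.
  rewrite /L2 inE; apply/andP; split; rewrite inE/=; last exact: Nfin.
  exact/(measurable_restrictT _ mD).
rewrite -NE /L2norm.
have NE' : ('N[leb2]_2%:E[EFin \o (u \_ D : plane R -> R)])%E =
    (fine 'N[leb2]_2%:E[EFin \o (u \_ D : plane R -> R)])%:E.
  by rewrite fineK// ge0_fin_numE.
rewrite [in RHS]NE' poweR_EFin powR_mulrn// fine_ge0//.
Qed.

End L2_facts.

Unset Implicit Arguments.

(** The difference of the two solutions has a weak derivative [g] with [v2 * g = w1 - w2] almost
    everywhere, hence [v2 * g] is in L2. Extension by zero across the interface gives a pair on the
    whole square, to which the density result applies with tolerance [eps2]. *)
Theorem theorem3p1 (R : realType) (x0 : R) (v2 gam f u1 u2 : R * R -> R)
    (al1 al2 : R)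
    (hx0 : 0 < x0 < 1)
    (v2_cont : {within closure Upsilon, continuous v2})
    (gam_cont : {within closure Upsilon, continuous gam})
    (f_L2 : L2 Upsilon f)
    (inflow_bottom :
      inflow_boundary (vertical v2) = [set q | 0 < q.1 < 1 /\ q.2 = 0])
    (interface_streamline :
      streamline (vertical v2) (x0, 0) (Interface x0))
    (u1_sol : solution x0 v2 gam f al1 u1)
    (u2_sol : solution x0 v2 gam f al2 u2) :
  let chi : R * R -> R := (u1 \- u2) \_ (Omega1 x0) in
  exists D1 D2 : R,
    forall eps2 eps3 : R, 0 < eps2 -> 0 < eps3 ->
      exists p w : R * R -> R,
        [/\ continuous_piecewise_linear Upsilon p,
            L2 Upsilon (chi \- p),
            weak_dbeta Upsilon v2 (chi \- p) w,
            L2 Upsilon w &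
            Num.sqrt (L2norm Upsilon (chi \- p) ^+ 2 + L2norm Upsilon w ^+ 2)
            <= D1 * Num.sqrt eps2 + D2 * Num.sqrt eps3].
Proof.
move=> chi; exists 1, 1 => eps2 eps3 eps20 eps30.
have mU := @measurable_Upsilon R; have mO := measurable_Omega1 x0.
(* A streamline has no stagnation points and its trajectory is the interface, so the vertical field
   is nonzero there. *)
have v_neq0 y : 0 < y < 1 -> v2 (x0, y) != 0.
  move=> yI; have [c [T [_ _ cT cI]]] := interface_streamline.
  have : Interface x0 (x0, y) by split.
  rewrite -cI => -[t [t0 tT] ct]; have [_] := cT t t0 tT.
  by rewrite ct /vertical; apply: contraNN => /eqP ->.
have [B B0 vB] : exists2 B : R, 0 <= B & forall z, Upsilon z -> `|v2 z| <= B.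
  have cU : compact (closure Upsilon : set (R * R)).
    have cS : compact (`[0, 1] `*` `[0, 1] : set (R * R)).
      by apply: (@compact_setX R R); exact: segment_compact.
    apply: (subclosed_compact _ cS); first exact: closed_closure.
    have -> : `[0, 1] `*` `[0, 1] = closure (`[0, 1] `*` `[0, 1] : set (R * R)).
      by apply/closure_id; apply: compact_closed => //; exact: norm_hausdorff.
    apply: closureS => -[x y]; rewrite /Upsilon/= !in_itv/= => -[/andP[? ?] /andP[? ?]].
    by split; apply/andP; split; exact: ltW.
  have [B B0 HB] := compact_continuous_bound cU v2_cont.
  by exists B => // z Uz; apply: HB; exact: subset_closure.
have mv : measurable_fun (Upsilon : set (plane R)) v2.
  apply: within_continuous_measurable2 => //.
  by apply: continuous_subspaceW v2_cont; exact: subset_closure.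
have [L2u1 [w1 [[g1 [wg1 w1E]] L2w1 _]] _] := u1_sol.
have [L2u2 [w2 [[g2 [wg2 w2E]] L2w2 _]] _] := u2_sol.
pose u := u1 \- u2; pose g := g1 \- g2.
have ug : weak_dy (Omega1 x0) u g.
  have := weak_dy_lin 1 (-1) mO wg1 wg2.
  by congr weak_dy; apply/funext => z; rewrite /u /g/=; ring.
have [[mu _] [mg _] _] := ug.
have sub_sq (a b : R * R -> R) : L2 (Omega1 x0) a -> L2 (Omega1 x0) b ->
    leb2.-integrable (Omega1 x0 : set (plane R)) (EFin \o (fun z => 2 * a z ^+ 2 + 2 * b z ^+ 2)).
  by move=> /(L2_integrable_sq mO) ia /(L2_integrable_sq mO) ib;
    apply: integrableD_real => //; exact: integrableZ_real.
have ineq (a b : R) : (a - b) ^+ 2 <= 2 * a ^+ 2 + 2 * b ^+ 2.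
  by have := sqr_ge0 (a + b); nra.
have sq20 (a b : R) : 0 <= 2 * a ^+ 2 + 2 * b ^+ 2.
  by rewrite addr_ge0// mulr_ge0// sqr_ge0.
have iu : leb2.-integrable (Omega1 x0 : set (plane R)) (EFin \o (fun z => u z ^+ 2)).
  apply: (le_integrable _ _ _ (sub_sq _ _ L2u1 L2u2)) => //.
    by apply/measurable_EFinP; exact: measurable_funX.
  by move=> z _; rewrite /= lee_fin !ger0_norm ?sqr_ge0//; exact: ineq.
have mvg : measurable_fun (Omega1 x0 : set (plane R)) (fun z => v2 z * g z).
  apply: measurable_funM => //; apply: measurable_funS mv => //.
  exact: Omega1_Upsilon.
have w12E : {ae leb2, forall z : plane R, Omega1 x0 z -> w1 z = v2 z * g1 z /\ w2 z = v2 z * g2 z}.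
  have FF := ae_filter_ringOfSetsType (@leb2 R).
  by apply: (@filterS2 _ _ FF _ _ _ _ w1E w2E) => z E1 E2 Oz; split; [exact: E1|exact: E2].
(* [v2 * g] is only almost everywhere equal to [w1 - w2], so its square is compared with the
   integrable [2 * w1 ^+ 2 + 2 * w2 ^+ 2] under the integral. *)
have ivg : leb2.-integrable (Omega1 x0 : set (plane R)) (EFin \o (fun z => (v2 z * g z) ^+ 2)).
  apply/integrableP; split; first by apply/measurable_EFinP; exact: measurable_funX.
  have is2 := sub_sq _ _ L2w1 L2w2; have /integrableP[ms2 ls2] := is2.
  apply: le_lt_trans ls2; apply: ae_ge0_le_integral => //.
  - apply: measurableT_comp => //; apply/measurable_EFinP; exact: measurable_funX.
  - exact: measurableT_comp.
  apply: filterS w12E => z E12 Oz; rewrite /= lee_fin !ger0_norm ?sqr_ge0//.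
  by have [E1 E2] := E12 Oz; rewrite /g/= mulrBr -E1 -E2; exact: ineq.
pose G := g \_ (Omega1 x0).
have chiG : weak_dy Upsilon chi G by exact: (weak_dy_extension v2_cont v_neq0 ug iu ivg).
have ie : leb2.-integrable (Upsilon : set (plane R)) (EFin \o energy chi G v2).
  have := Omega1_restrict_integrable (integrableD_real mO iu ivg).
  congr (leb2.-integrable _ (EFin \o _)); apply/funext => z.
  rewrite /energy /chi /G !patchE; case: ifP => // _.
  by rewrite -[point]/(0 : R) mulr0 expr0n addr0.
have [p [q [Ppq Epq]]] := pl_density chiG mv ie vB eps20.
have [cpl wpq mp mq _] := Ppq.
have wr : weak_dy Upsilon (chi \- p) (G \- q).
  have := weak_dy_lin 1 (-1) mU chiG wpq.
  by congr weak_dy; apply/funext => z /=; ring.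
have [[mr _] [mG _] _] := wr.
(* Taken as the exact product, so the relation required by [weak_dbeta] holds at every point. *)
pose w z := v2 z * (G z - q z).
have mw : measurable_fun (Upsilon : set (plane R)) w by exact: measurable_funM.
have mr2 : measurable_fun (Upsilon : set (plane R)) (fun z => ((chi z - p z) ^+ 2)%:E).
  by apply/measurable_EFinP; exact: measurable_funX.
have mw2 : measurable_fun (Upsilon : set (plane R)) (fun z => (w z ^+ 2)%:E).
  by apply/measurable_EFinP; exact: measurable_funX.
have split_int : (\int[leb2]_(z in Upsilon) ((chi z - p z) ^+ 2)%:E +
    \int[leb2]_(z in Upsilon) (w z ^+ 2)%:E <= eps2%:E)%E.
  rewrite -ge0_integralD//.
  - by move=> z _; rewrite lee_fin sqr_ge0.
  - by move=> z _; rewrite lee_fin sqr_ge0.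
have r0 : (0 <= \int[leb2]_(z in Upsilon) ((chi z - p z) ^+ 2)%:E)%E.
  by apply: integral_ge0 => z _; rewrite lee_fin sqr_ge0.
have w0 : (0 <= \int[leb2]_(z in Upsilon) (w z ^+ 2)%:E)%E.
  by apply: integral_ge0 => z _; rewrite lee_fin sqr_ge0.
have [L2r rE] : L2 Upsilon (chi \- p) /\ (L2norm Upsilon (chi \- p) ^+ 2)%:E =
    (\int[leb2]_(z in Upsilon) ((chi \- p) z ^+ 2)%:E)%E.
  apply: (L2_of_sq (c := eps2)) => //.
  by apply: le_trans split_int; rewrite leeDl.
have [L2w wE] : L2 Upsilon w /\ (L2norm Upsilon w ^+ 2)%:E =
    (\int[leb2]_(z in Upsilon) (w z ^+ 2)%:E)%E.
  apply: (L2_of_sq (c := eps2)) => //.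
  by apply: le_trans split_int; rewrite leeDr.
exists p, w; split => //.
  exists (G \- q); split => //; exact: aeW.
have : L2norm Upsilon (chi \- p) ^+ 2 + L2norm Upsilon w ^+ 2 <= eps2.
  by rewrite -lee_fin EFinD rE wE.
move=> /ler_wsqrtr /le_trans; apply.
by rewrite !mul1r lerDl sqrtr_ge0.
Qed.
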